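(* Let $0<\alpha\le 1$, let $A$ be a bounded linear operator on a complex Banach space $\mathbb{X}$, and let $f\in BUC(\mathbb{R}^+,\mathbb{X})$ be asymptotic $1$-periodic, i.e. $\lim_{t\to\infty}(f(t+1)-f(t))=0$. Assume that the set $e^{\Sigma_i(A,\alpha)}\setminus\{1\}$ is closed, where $e^{\Sigma_i(A,\alpha)}=\{e^{\zeta}:\zeta\in\Sigma_i(A,\alpha)\}$. Then the equation $D^{\alpha}_C u(t)=Au(t)+f(t)$, $t\ge 0$, has an asymptotic mild solution that is asymptotic $1$-periodic if and only if it has an asymptotic mild solution (which by definition is bounded and uniformly continuous on $\mathbb{R}^+$).
   Context: $\mathbb{R}^+=[0,\infty)$. $BUC(\mathbb{R}^+,\mathbb{X})$ is the Banach space of bounded uniformly continuous functions $\mathbb{R}^+\to\mathbb{X}$ with the sup-norm; $C_0(\mathbb{R}^+,\mathbb{X})$ is its subspace of functions tending to $0$ at infinity. A function $g\in BUC(\mathbb{R}^+,\mathbb{X})$ is asymptotic $1$-periodic if $\lim_{t\to\infty}(g(t+1)-g(t))=0$. $J^\alpha u(t)=\int_0^t \frac{(t-\tau)^{\alpha-1}}{\Gamma(\alpha)}u(\tau)\,d\tau$. For $g$ continuous, a mild solution on $\mathbb{R}^+$ of $D^\alpha_C u=Au+g$ ($D^\alpha_C$ is the Caputo derivative) is a continuous $u:\mathbb{R}^+\to\mathbb{X}$ such that for each $t\ge 0$, $J^\alpha u(t)\in D(A)$ and $u(t)=AJ^\alpha u(t)+J^\alpha g(t)+u(0)$. An asymptotic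 mild solution of $D^\alpha_Cu=Au+f$ is a function $u\in BUC(\mathbb{R}^+,\mathbb{X})$ for which there is $\epsilon\in C_0(\mathbb{R}^+,\mathbb{X})$ such that $u$ is a mild solution of $D^\alpha_C u=Au+f+\epsilon$. Powers: $\lambda^\alpha=|\lambda|^\alpha e^{i\alpha\arg\lambda}$ with $-\pi<\arg\lambda<\pi$. $\rho(A,\alpha)$ is the set of all $\xi_0\in\mathbb{C}$ such that $\lambda^\alpha-A$ has a (bounded) inverse $(\lambda^\alpha-A)^{-1}$ that is analytic in $\lambda$ in a neighborhood of $\xi_0$; $\Sigma_i(A,\alpha):=i\mathbb{R}\setminus\rho(A,\alpha)$. *)

(* Defs.v *)
(* A complex Banach space is a [CompleteNormedModule C_AbsRing]; Coquelicot's [is_linear] between normed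
   modules includes boundedness of the operator. *)
From Stdlib Require Import Reals.
From Coquelicot Require Import Coquelicot.
Open Scope R_scope.

(* Coquelicot integrates functions with values in normed modules over R, so we
   restrict scalars along [RtoC]; carrier, group, uniform structure, norm and
   completeness are those of [X] itself. *)
Section RealSpace.
Variable X : CompleteNormedModule C_AbsRing.

Lemma real_scal_assoc (a b : R) (x : X) :
  scal (RtoC a) (scal (RtoC b) x) = scal (RtoC (mult a b)) x.
Proof.
rewrite scal_assoc; apply (f_equal (fun c : C => scal c x)).
symmetry; exact (RtoC_mult a b).
Qed.

Lemma real_scal_one (x : X) : scal (RtoC one) x = x.
Proof. exact (scal_one x). Qed.

Lemma real_scal_distr_l (a : R) (x y : X) :
  scal (RtoC a) (plus x y) = plus (scal (RtoC a) x) (scal (RtoC a) y).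
Proof. exact (scal_distr_l (RtoC a) x y). Qed.

Lemma real_scal_distr_r (a b : R) (x : X) :
  scal (RtoC (plus a b)) x = plus (scal (RtoC a) x) (scal (RtoC b) x).
Proof.
rewrite <- (scal_distr_r (RtoC a) (RtoC b) x).
apply (f_equal (fun c : C => scal c x)); exact (RtoC_plus a b).
Qed.

Lemma real_norm_scal (a : R) (x : X) :
  norm (scal (RtoC a) x) <= abs a * norm x.
Proof.
apply (Rle_trans _ _ _ (norm_scal (RtoC a) x)).
apply Rmult_le_compat_r; [apply norm_ge_0 |].
right; exact (Cmod_R a).
Qed.

Definition real_ModuleSpace_class : ModuleSpace.class_of R_Ring X :=
  ModuleSpace.Class R_Ring X (AbelianGroup.class X)
    (ModuleSpace.Mixin R_Ring _ (fun a : R => scal (RtoC a))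
       real_scal_assoc real_scal_one real_scal_distr_l real_scal_distr_r).

Definition real_NormedModuleAux_class : NormedModuleAux.class_of R_AbsRing X :=
  NormedModuleAux.Class R_AbsRing X real_ModuleSpace_class (UniformSpace.class X).

Definition real_NormedModule_class : NormedModule.class_of R_AbsRing X :=
  NormedModule.Class R_AbsRing X real_NormedModuleAux_class
    (NormedModule.Mixin R_AbsRing
       (NormedModuleAux.Pack R_AbsRing X real_NormedModuleAux_class X)
       (fun x : X => norm x) (@norm_factor _ X)
       (@norm_triangle _ X) real_norm_scal
       (@norm_compat1 _ X) (@norm_compat2 _ X) (@norm_eq_zero _ X)).

Definition real_space : CompleteNormedModule R_AbsRing :=
  CompleteNormedModule.Pack R_AbsRing X
    (CompleteNormedModule.Class R_AbsRing X real_NormedModule_class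
       (CompleteNormedModule.mixin C_AbsRing X
          (CompleteNormedModule.class C_AbsRing X))) X.

End RealSpace.

(* Functions R^+ -> X are represented by functions R -> X of which only the
   values on [0, +oo) are constrained or used. *)
Section FunctionSpaces.
Context {X : CompleteNormedModule C_AbsRing}.

Definition bounded_on_nonneg (u : R -> X) : Prop :=
  exists M : R, forall t : R, 0 <= t -> norm (u t) <= M.

Definition uniformly_continuous_on_nonneg (u : R -> X) : Prop :=
  forall eps : posreal, exists delta : posreal, forall s t : R,
    0 <= s -> 0 <= t -> Rabs (t - s) < delta -> norm (minus (u t) (u s)) < eps.

Definition BUC (u : R -> X) : Prop :=
  bounded_on_nonneg u /\ uniformly_continuous_on_nonneg u.

Definition tends_to_zero (u : R -> X) : Prop :=
  filterlim u (Rbar_locally p_infty) (locally (zero : X)).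

Definition C0 (u : R -> X) : Prop := BUC u /\ tends_to_zero u.

Definition asymptotic_1_periodic (g : R -> X) : Prop :=
  BUC g /\ tends_to_zero (fun t => minus (g (t + 1)) (g t)).

End FunctionSpaces.

Definition Gamma (a : R) : R :=
  RInt_gen (fun s => Rpower s (a - 1) * exp (- s))
    (at_right 0) (Rbar_locally p_infty).

Section MildSolutions.
Context {X : CompleteNormedModule C_AbsRing}.

(* The kernel is singular at tau = t when alpha < 1, so the integral is the
   limit of the Riemann integrals over [0, s] as s increases to t.  At t = 0
   the integral is over a point, while [at_left 0] would leave R^+. *)
Definition J (alpha : R) (u : R -> X) (t : R) : X :=
  if Rlt_dec 0 t then
    RInt_gen (V := real_space X)
      (fun tau => @scal _ (real_space X)
                    (Rpower (t - tau) (alpha - 1) / Gamma alpha) (u tau))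
      (at_point 0) (at_left t)
  else zero.

(* As [A] is everywhere defined, "J alpha u t lies in the domain of A" is
   automatic. *)
Definition mild_solution (alpha : R) (A : X -> X) (g u : R -> X) : Prop :=
  continuous_on (fun t : R => 0 <= t) u /\
  forall t : R, 0 <= t ->
    u t = plus (plus (A (J alpha u t)) (J alpha g t)) (u 0).

Definition asymptotic_mild_solution
    (alpha : R) (A : X -> X) (f u : R -> X) : Prop :=
  BUC u /\
  exists eps : R -> X,
    C0 eps /\ mild_solution alpha A (fun t => plus (f t) (eps t)) u.

End MildSolutions.

Definition cis (theta : R) : C := (cos theta, sin theta).

Definition Cexp (z : C) : C := (RtoC (exp (Re z)) * cis (Im z))%C.

(* Principal argument; the value on the negative axis is PI. *)
Definition Carg (z : C) : R :=
  if Rle_dec 0 (Im z) then acos (Re z / Cmod z) else - acos (Re z / Cmod z).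

(* Principal power, extended to the cut by Carg = PI and by 0 at 0 (Stdlib has
   Rpower 0 a = 1).  Thus z^1 = z everywhere, whereas for a < 1 the extension
   is discontinuous across the negative axis. *)
Definition Cpower (z : C) (a : R) : C :=
  if Req_EM_T (Cmod z) 0 then RtoC 0
  else (RtoC (Rpower (Cmod z) a) * cis (a * Carg z))%C.

Section Spectrum.
Context {X : CompleteNormedModule C_AbsRing}.

Definition is_bounded_inverse (T S : X -> X) : Prop :=
  is_linear S /\ (forall x, S (T x) = x) /\ (forall x, T (S x) = x).

(* Complex differentiability at z in the operator norm: the remainder
   F w - F z - (w - z) D has operator norm at most eps |w - z|. *)
Definition is_op_derive (F : C -> X -> X) (z : C) (D : X -> X) : Prop :=
  is_linear D /\
  forall eps : posreal, locally z (fun w : C => forall x : X,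
    norm (minus (minus (F w x) (F z x)) (scal (w - z)%C (D x)))
      <= eps * Cmod (w - z)%C * norm x).

(* Analyticity is complex differentiability throughout a neighborhood. *)
Definition rho (A : X -> X) (alpha : R) (xi0 : C) : Prop :=
  exists F : C -> X -> X,
    locally xi0 (fun lambda : C =>
      is_bounded_inverse
        (fun x => minus (scal (Cpower lambda alpha) x) (A x)) (F lambda) /\
      exists D : X -> X, is_op_derive F lambda D).

Definition Sigma_i (A : X -> X) (alpha : R) (zeta : C) : Prop :=
  Re zeta = 0 /\ ~ rho A alpha zeta.

Definition exp_Sigma_i (A : X -> X) (alpha : R) (z : C) : Prop :=
  exists zeta : C, Sigma_i A alpha zeta /\ z = Cexp zeta.

End Spectrum.

(* Main.v *)
(* Work modulo functions vanishing at +oo, with the seminorm limsup |u(t)|: translations T_s become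
   invertible isometries there.  If u is an asymptotic mild solution, then w = T_1 u - u asymptotically solves
   D^alpha w = A w.  On such homogeneous solutions T_1 - e^{i theta} is bounded below whenever no i eta with
   e^{i eta} = e^{i theta} lies in Sigma_i: an approximate eigenvector of T_1 refines, by taking square roots of
   T_1, to an approximate eigenvector z of the whole group, T_s z ~ e^{i eta s} z, and inserting it into
   the increments J z(t) - J z(t - h) gives ((i eta)^alpha - A) z ~ 0.  The closedness hypothesis makes 1 isolated, so
   these lower bounds hold for 0 < |theta| < d.  Then Fejer means of e^{-i n theta} T_n w tend to 0 there, hence
   phi(T_1) w depends only on phi near 1; shrinking the support of phi to {1} and using w = (T_1 - 1) u yields
   phi(T_1) w = 0 for a trapezoid phi equal to 1 near 1.  Thus v = phi(T_1) u is asymptotically 1-periodic, and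
   phi(T_1) f = f.  Writing u = u(0) + J G, the function x0 + J (phi(T_1) G) differs from v by a function vanishing at infinity
   and is an exact mild solution for f + eps' with eps' in C_0. *)

(* [J] neither commutes with translations nor preserves boundedness, so the equation is used through
   its increments over a time h: the weight which their kernel gives to the remote past tends to 0,
   also for a = 1. With h half a period of e^{i eta s}, the increment of this exponential is twice
   its value, and for a = 1 the oscillating boundary terms cancel. Square roots of T_1 rest on
   T_{2s} - e^{2 i eta s} = (T_s + e^{i eta s})(T_s - e^{i eta s}). For small s the first factor is
   bounded below, because a bounded A gives |T_s - 1| = O(s^a) on homogeneous solutions. For larger
   s it equals T_s - e^{i eta' s} with another eta' over the same point of the circle; this is why
   the hypothesis concerns the image e^{Sigma_i}. The trapezoid has Fourier coefficients O(1/n^2),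
   so phi(T_1) is an absolutely convergent series. The variation of the coefficients is of the order
   of the width, so summation by parts makes phi(T_1)(T_1 - 1) u small for narrow supports. [J]
   commutes with this series only up to the memory of an initial segment, which fades for a < 1 and
   is constant for a = 1, where x0 absorbs it. *)
Require Import Defs.
From Stdlib Require Import Reals Lra Lia ClassicalEpsilon FunctionalExtensionality.
From Coquelicot Require Import Coquelicot.
Open Scope R_scope.

(** * Linear identities in a complex module *)

Section ModuleIdentities.
Context {X : ModuleSpace C_Ring}.

(** Linear identities in a module are proved by reflection: both sides become formal combinations of
    atoms, and only equalities between complex coefficients remain. *)
Inductive vexp : Type :=
| Vvar (n : nat) | Vzero | Vplus (a b : vexp) | Vopp (a : vexp) | Vscal (c : C) (a : vexp).

Fixpoint vden (env : nat -> X) (e : vexp) : X :=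
  match e with
  | Vvar n => env n
  | Vzero => zero
  | Vplus a b => plus (vden env a) (vden env b)
  | Vopp a => opp (vden env a)
  | Vscal c a => scal c (vden env a)
  end.

Fixpoint vcoef (e : vexp) (n : nat) : C :=
  match e with
  | Vvar m => if Nat.eqb m n then RtoC 1 else RtoC 0
  | Vzero => RtoC 0
  | Vplus a b => Cplus (vcoef a n) (vcoef b n)
  | Vopp a => Copp (vcoef a n)
  | Vscal c a => Cmult c (vcoef a n)
  end.

Fixpoint vbound (e : vexp) (k : nat) : Prop :=
  match e with
  | Vvar n => (n < k)%nat
  | Vzero => True
  | Vplus a b => vbound a k /\ vbound b k
  | Vopp a => vbound a k
  | Vscal _ a => vbound a k
  end.

Fixpoint vlin (env : nat -> X) (co : nat -> C) (k : nat) : X :=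
  match k with
  | O => zero
  | S k => plus (vlin env co k) (scal (co k) (env k))
  end.

Lemma vlin_zero (env : nat -> X) (co : nat -> C) (k : nat) :
  (forall n, (n < k)%nat -> co n = RtoC 0) -> vlin env co k = zero.
Proof.
  induction k as [|k IH]; intros H; simpl; [reflexivity|].
  rewrite IH by (intros; apply H; lia).
  rewrite (H k) by lia. rewrite plus_zero_l. exact (scal_zero_l (env k)).
Qed.

Lemma vlin_ext (env : nat -> X) (co co' : nat -> C) (k : nat) :
  (forall n, (n < k)%nat -> co n = co' n) -> vlin env co k = vlin env co' k.
Proof.
  induction k as [|k IH]; intros H; simpl; [reflexivity|].
  rewrite IH by (intros; apply H; lia). now rewrite (H k) by lia.
Qed.

Lemma vlin_var (env : nat -> X) (m k : nat) : (m < k)%nat ->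
  vlin env (fun n => if Nat.eqb m n then RtoC 1 else RtoC 0) k = env m.
Proof.
  induction k as [|k IH]; intros H; simpl; [lia|].
  destruct (Nat.eq_dec m k) as [->|Hne].
  - rewrite vlin_zero.
    + rewrite Nat.eqb_refl, plus_zero_l. exact (scal_one (env k)).
    + intros n Hn. destruct (Nat.eqb_spec k n); [lia|reflexivity].
  - rewrite IH by lia. destruct (Nat.eqb_spec m k); [lia|].
    transitivity (plus (env m) zero); [|apply plus_zero_r].
    apply f_equal. exact (scal_zero_l (env k)).
Qed.

Lemma plus_interchange (a b c d : X) : plus (plus a b) (plus c d) = plus (plus a c) (plus b d).
Proof.
  rewrite <- !plus_assoc. apply f_equal. rewrite !plus_assoc. f_equal. apply plus_comm.
Qed.

Lemma vlin_plus (env : nat -> X) (co co' : nat -> C) (k : nat) :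
  vlin env (fun n => Cplus (co n) (co' n)) k = plus (vlin env co k) (vlin env co' k).
Proof.
  induction k as [|k IH]; simpl; [now rewrite plus_zero_l|].
  rewrite IH, plus_interchange. apply f_equal. exact (scal_distr_r (co k) (co' k) (env k)).
Qed.

Lemma vlin_scal (env : nat -> X) (c : C) (co : nat -> C) (k : nat) :
  vlin env (fun n => Cmult c (co n)) k = scal c (vlin env co k).
Proof.
  induction k as [|k IH]; simpl; [symmetry; exact (scal_zero_r c)|].
  rewrite IH. rewrite scal_distr_l. apply f_equal.
  symmetry. exact (scal_assoc c (co k) (env k)).
Qed.

Lemma vlin_opp (env : nat -> X) (co : nat -> C) (k : nat) :
  vlin env (fun n => Copp (co n)) k = opp (vlin env co k).
Proof.
  induction k as [|k IH]; simpl; [symmetry; exact opp_zero|].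
  rewrite IH. transitivity (plus (opp (vlin env co k)) (opp (scal (co k) (env k)))).
  - apply f_equal. exact (scal_opp_l (co k) (env k)).
  - symmetry. exact (@opp_plus (ModuleSpace.AbelianGroup C_Ring X) _ _).
Qed.

Lemma vden_vlin (env : nat -> X) (e : vexp) (k : nat) :
  vbound e k -> vden env e = vlin env (vcoef e) k.
Proof.
  induction e as [m| |a IHa b IHb|a IHa|c a IHa]; intros Hb; simpl in *.
  - symmetry; now apply vlin_var.
  - symmetry; now apply vlin_zero.
  - rewrite IHa, IHb by tauto. symmetry; apply vlin_plus.
  - rewrite IHa by tauto. symmetry; apply vlin_opp.
  - rewrite IHa by tauto. symmetry; apply vlin_scal.
Qed.

Fixpoint vsame (e1 e2 : vexp) (k : nat) : Prop :=
  match k with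
  | O => True
  | S k => vsame e1 e2 k /\ vcoef e1 k = vcoef e2 k
  end.

Lemma vden_eq (env : nat -> X) (k : nat) (e1 e2 : vexp) :
  vbound e1 k -> vbound e2 k -> vsame e1 e2 k -> vden env e1 = vden env e2.
Proof.
  intros H1 H2 H. rewrite (vden_vlin env e1 k), (vden_vlin env e2 k) by assumption.
  apply vlin_ext. clear H1 H2. induction k as [|k IH]; intros n Hn; [lia|].
  destruct H as [H Hk]. destruct (Nat.eq_dec n k) as [->|]; [exact Hk|].
  apply IH; [exact H|lia].
Qed.

End ModuleIdentities.

Fixpoint list_env {X : ModuleSpace C_Ring} (l : list X) (n : nat) : X :=
  match l, n with
  | nil, _ => zero
  | cons x _, O => x
  | cons _ l, S n => list_env l n
  end.

Ltac v_mem x l :=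
  lazymatch l with
  | nil => constr:(false)
  | cons x _ => constr:(true)
  | cons _ ?l => v_mem x l
  end.
Ltac v_atoms e l :=
  lazymatch e with
  | @plus _ ?a ?b => let l := v_atoms a l in v_atoms b l
  | @minus _ ?a ?b => let l := v_atoms a l in v_atoms b l
  | @opp _ ?a => v_atoms a l
  | @scal _ _ _ ?a => v_atoms a l
  | @zero _ => l
  | _ => let b := v_mem e l in
         lazymatch b with true => l | false => constr:(cons e l) end
  end.
Ltac v_index x l :=
  lazymatch l with
  | cons x _ => constr:(O)
  | cons _ ?l => let n := v_index x l in constr:(S n)
  end.
Ltac v_reify e l :=
  lazymatch e with
  | @plus _ ?a ?b => let a := v_reify a l in let b := v_reify b l in constr:(Vplus a b)
  | @minus _ ?a ?b => let a := v_reify a l in let b := v_reify b l in constr:(Vplus a (Vopp b))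
  | @opp _ ?a => let a := v_reify a l in constr:(Vopp a)
  | @scal _ _ ?c ?a => let a := v_reify a l in constr:(Vscal c a)
  | @zero _ => constr:(Vzero)
  | _ => let n := v_index e l in constr:(Vvar n)
  end.
(** Leaves the coefficient equations open, for places where they need facts such as [cis_plus] and
    not only [ring]. *)
Ltac v_prep :=
  lazymatch goal with
  | |- @eq ?T ?a ?b =>
    let l := v_atoms a (@nil T) in
    let l := v_atoms b l in
    let ea := v_reify a l in
    let eb := v_reify b l in
    let k := eval compute in (length l) in
    refine (vden_eq (list_env l) k ea eb _ _ _);
    [ simpl; repeat split; lia | simpl; repeat split; lia
    | cbn [vsame vcoef Nat.eqb]; repeat split ]
  end.
Ltac vring := v_prep; try ring.

(** * The seminorm limsup at infinity *)

Ltac norm_as B :=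
  match goal with
  | |- context [@norm C_AbsRing ?V ?u] =>
    let H := fresh in
    assert (H : @norm C_AbsRing V u = @norm C_AbsRing V B) by (apply f_equal; vring);
    rewrite H; clear H
  end.

Section Functions.
Context {X : CompleteNormedModule C_AbsRing}.
Implicit Types x y z : R -> X.

Lemma norm_scal_C (c : C) (v : X) : norm (scal c v) <= Cmod c * norm v.
Proof. exact (norm_scal c v). Qed.

Lemma norm_opp_C (v : X) : norm (opp v) = norm v.
Proof. exact (norm_opp v). Qed.

Lemma norm_zero_C : norm (zero : X) = 0.
Proof. exact norm_zero. Qed.

Lemma norm_plus_le (u v : X) : norm (plus u v) <= norm u + norm v.
Proof. exact (norm_triangle u v). Qed.

Lemma norm_minus_sym (u v : X) : norm (minus u v) = norm (minus v u).
Proof. rewrite <- norm_opp_C. apply f_equal. vring. Qed.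

Lemma norm_minus_le (u v : X) : norm (minus u v) <= norm u + norm v.
Proof.
  apply Rle_trans with (norm u + norm (opp v)); [exact (norm_triangle u (opp v))|].
  rewrite norm_opp_C; lra.
Qed.

Lemma norm_le_minus (u v : X) : norm u <= norm v + norm (minus u v).
Proof.
  replace (norm u) with (norm (plus v (minus u v))); [apply norm_plus_le|].
  apply f_equal; vring.
Qed.

Lemma norm_minus_trans (u v w : X) :
  norm (minus u w) <= norm (minus u v) + norm (minus v w).
Proof.
  replace (minus u w) with (plus (minus u v) (minus v w)); [apply norm_plus_le|].
  vring.
Qed.

Lemma eq_of_small_norm (u v : X) : (forall e, 0 < e -> norm (minus u v) <= e) -> u = v.
Proof.
  intros H. assert (E : minus u v = zero).
  { apply (norm_eq_zero (minus u v)). apply Rle_antisym; [|apply norm_ge_0].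
    apply le_epsilon. intros e He. rewrite Rplus_0_l. now apply H. }
  replace u with (plus v (minus u v)) by vring. rewrite E. vring.
Qed.

Definition vadd x y := fun t => plus (x t) (y t).
Definition vsub x y := fun t => minus (x t) (y t).
Definition vsc (c : C) x := fun t => scal c (x t).
Definition shift (r : R) x := fun t => x (t + r).

(** Bounds are taken on the whole line, so that translations to either side stay in the class;
    functions on the half line enter through [ext0]. *)
Definition bdd x := exists M, forall t, norm (x t) <= M.
Definition ucont x := forall e, 0 < e -> exists d, 0 < d /\
  forall s t, Rabs (t - s) < d -> norm (minus (x t) (x s)) < e.
Definition BU x := bdd x /\ ucont x.
Definition vanish x := forall e, 0 < e -> exists T, forall t, T <= t -> norm (x t) <= e.

Lemma bdd_pos x : bdd x -> exists M, 0 < M /\ forall t, norm (x t) <= M.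
Proof.
  intros [M HM]. exists (Rmax M 1). split.
  - apply Rlt_le_trans with 1; [lra|apply Rmax_r].
  - intros t. apply Rle_trans with (1 := HM t), Rmax_l.
Qed.

Lemma bdd_vadd x y : bdd x -> bdd y -> bdd (vadd x y).
Proof.
  intros [M HM] [N HN]. exists (M + N). intros t. unfold vadd.
  eapply Rle_trans; [apply norm_plus_le|]. specialize (HM t); specialize (HN t); lra.
Qed.
Lemma bdd_vsub x y : bdd x -> bdd y -> bdd (vsub x y).
Proof.
  intros [M HM] [N HN]. exists (M + N). intros t. unfold vsub.
  eapply Rle_trans; [apply norm_minus_le|]. specialize (HM t); specialize (HN t); lra.
Qed.
Lemma bdd_vsc c x : bdd x -> bdd (vsc c x).
Proof.
  intros [M HM]. exists (Cmod c * M). intros t. unfold vsc.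
  eapply Rle_trans; [apply norm_scal_C|]. apply Rmult_le_compat_l; [apply Cmod_ge_0|apply HM].
Qed.
Lemma bdd_shift r x : bdd x -> bdd (shift r x).
Proof. intros [M HM]. exists M. intros t; apply HM. Qed.
Lemma BU_bdd x : BU x -> bdd x.
Proof. now intros []. Qed.

Lemma BU_vadd x y : BU x -> BU y -> BU (vadd x y).
Proof.
  intros [Hb Hu] [Hb' Hu']. split; [now apply bdd_vadd|]. intros e He.
  destruct (Hu (e/2)) as [d [Hd H]]; [lra|]. destruct (Hu' (e/2)) as [d' [Hd' H']]; [lra|].
  exists (Rmin d d'). split; [now apply Rmin_pos|]. intros s t Hst. unfold vadd.
  norm_as (plus (minus (x t) (x s)) (minus (y t) (y s))).
  eapply Rle_lt_trans; [apply norm_plus_le|].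
  specialize (H s t (Rlt_le_trans _ _ _ Hst (Rmin_l _ _))).
  specialize (H' s t (Rlt_le_trans _ _ _ Hst (Rmin_r _ _))). lra.
Qed.
Lemma BU_vsc c x : BU x -> BU (vsc c x).
Proof.
  intros [Hb Hu]. split; [now apply bdd_vsc|]. intros e He.
  assert (Hc := Cmod_ge_0 c).
  destruct (Hu (e / (Cmod c + 1))) as [d [Hd H]]; [apply Rdiv_lt_0_compat; lra|].
  exists d. split; [exact Hd|]. intros s t Hst. unfold vsc.
  norm_as (scal c (minus (x t) (x s))).
  eapply Rle_lt_trans; [apply norm_scal_C|]. specialize (H s t Hst).
  assert (Hn := norm_ge_0 (minus (x t) (x s))).
  apply Rle_lt_trans with ((Cmod c + 1) * norm (minus (x t) (x s))); [nra|].
  apply (Rmult_lt_compat_l (Cmod c + 1)) in H; [|lra].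
  replace ((Cmod c + 1) * (e / (Cmod c + 1))) with e in H by (field; lra). exact H.
Qed.
Lemma BU_ext x y : (forall t, x t = y t) -> BU x -> BU y.
Proof. intros H. replace y with x; [easy|]. now apply functional_extensionality. Qed.
Lemma BU_vsub x y : BU x -> BU y -> BU (vsub x y).
Proof.
  intros Hx Hy. apply (BU_ext (vadd x (vsc (RtoC (-1)) y))).
  - intros t. unfold vadd, vsub, vsc. vring.
  - apply BU_vadd; [exact Hx|now apply BU_vsc].
Qed.
Lemma BU_shift r x : BU x -> BU (shift r x).
Proof.
  intros [Hb Hu]. split; [now apply bdd_shift|]. intros e He.
  destruct (Hu e He) as [d [Hd H]]. exists d. split; [exact Hd|].
  intros s t Hst. apply H. replace (t + r - (s + r)) with (t - s) by ring. exact Hst.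
Qed.
Lemma BU_const (v : X) : BU (fun _ => v).
Proof.
  split; [exists (norm v); intros; apply Rle_refl|]. intros e He. exists 1.
  split; [lra|]. intros s t _. norm_as (zero : X).
  rewrite norm_zero_C. exact He.
Qed.

Lemma is_linear_minus (A : X -> X) (HA : is_linear A) (u v : X) :
  A (minus u v) = minus (A u) (A v).
Proof.
  replace (minus u v) with (plus u (scal (RtoC (-1)) v)) by vring.
  rewrite (linear_plus A HA), (linear_scal A HA). vring.
Qed.

Lemma BU_linear (A : X -> X) x : is_linear A -> BU x -> BU (fun t => A (x t)).
Proof.
  intros HA [[M HM] Hu]. destruct (linear_norm A HA) as [K [HK Hn]]. split.
  - exists (K * M). intros t. eapply Rle_trans; [apply Hn|].
    apply Rmult_le_compat_l; [lra|apply HM].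
  - intros e He. destruct (Hu (e / K)) as [d [Hd H]]; [now apply Rdiv_lt_0_compat|].
    exists d. split; [exact Hd|]. intros s t Hst. rewrite <- (is_linear_minus A HA).
    eapply Rle_lt_trans; [apply Hn|]. specialize (H s t Hst).
    apply (Rmult_lt_compat_l K) in H; [|exact HK].
    replace (K * (e / K)) with e in H by (field; lra). exact H.
Qed.

(* Meaningful only for eventually bounded functions: otherwise the infimum is [+oo] and [real] returns [0]. *)
Definition evle x (m : R) := exists T, forall t, T <= t -> norm (x t) <= m.
Definition asn x : R := real (Glb_Rbar (evle x)).

Lemma evle_ge0 x m : evle x m -> 0 <= m.
Proof.
  intros [T H]. apply Rle_trans with (norm (x T)); [apply norm_ge_0|apply H; lra].
Qed.

Lemma evle_mono x m n : evle x m -> m <= n -> evle x n.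
Proof. intros [T H] Hmn. exists T. intros t Ht. specialize (H t Ht). lra. Qed.

Lemma asn_glb x m : evle x m ->
  exists r, Glb_Rbar (evle x) = Finite r /\ 0 <= r <= m.
Proof.
  intros Hm. destruct (Glb_Rbar_correct (evle x)) as [H1 H2].
  assert (H0 : Rbar_le 0 (Glb_Rbar (evle x))).
  { apply H2. intros n Hn. exact (evle_ge0 x n Hn). }
  specialize (H1 m Hm). destruct (Glb_Rbar (evle x)) as [r| |]; simpl in *; try easy.
  exists r. split; [reflexivity|lra].
Qed.

Lemma asn_le_evle x m : evle x m -> asn x <= m.
Proof. intros H. destruct (asn_glb x m H) as [r [Hr Hrm]]. unfold asn. rewrite Hr. simpl; lra. Qed.

Lemma asn_le x m : (forall e, 0 < e -> evle x (m + e)) -> asn x <= m.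
Proof.
  intros H. apply Rnot_lt_le. intros Hlt.
  specialize (asn_le_evle x _ (H ((asn x - m) / 2) ltac:(lra))). lra.
Qed.

Lemma bdd_evle x : bdd x -> exists m, evle x m.
Proof. intros [M HM]. exists M, 0. intros; apply HM. Qed.

Lemma asn_ge0 x : 0 <= asn x.
Proof.
  unfold asn. destruct (Glb_Rbar_correct (evle x)) as [H1 H2].
  assert (H0 : Rbar_le 0 (Glb_Rbar (evle x))).
  { apply H2. intros n Hn. exact (evle_ge0 x n Hn). }
  destruct (Glb_Rbar (evle x)) as [r| |]; simpl in *; lra.
Qed.

Lemma asn_ev x e : bdd x -> 0 < e -> evle x (asn x + e).
Proof.
  intros Hb He. destruct (bdd_evle x Hb) as [m Hm].
  destruct (asn_glb x m Hm) as [r [Hr _]].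
  destruct (Glb_Rbar_correct (evle x)) as [_ H2].
  destruct (Classical_Prop.classic (evle x (asn x + e))) as [H|H]; [exact H|exfalso].
  assert (Hle : Rbar_le (Finite (asn x + e)) (Glb_Rbar (evle x))).
  { apply H2. intros n Hn. simpl. apply Rnot_lt_le. intros Hlt.
    apply H. apply (evle_mono x n); [exact Hn|lra]. }
  unfold asn in Hle. rewrite Hr in Hle. simpl in Hle. lra.
Qed.

Lemma evle_vadd x y m n : evle x m -> evle y n -> evle (vadd x y) (m + n).
Proof.
  intros [T H] [S K]. exists (Rmax T S). intros t Ht. unfold vadd.
  eapply Rle_trans; [apply norm_plus_le|].
  specialize (H t (Rle_trans _ _ _ (Rmax_l _ _) Ht)).
  specialize (K t (Rle_trans _ _ _ (Rmax_r _ _) Ht)). lra.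
Qed.

Lemma asn_vadd x y : bdd x -> bdd y -> asn (vadd x y) <= asn x + asn y.
Proof.
  intros Hx Hy. apply asn_le. intros e He.
  replace (asn x + asn y + e) with ((asn x + e/2) + (asn y + e/2)) by field.
  apply evle_vadd; apply asn_ev; trivial; lra.
Qed.

Lemma asn_vsc c x : bdd x -> asn (vsc c x) <= Cmod c * asn x.
Proof.
  intros Hx. apply asn_le. intros e He. assert (Hc := Cmod_ge_0 c).
  destruct (asn_ev x (e / (Cmod c + 1)) Hx) as [T H]; [apply Rdiv_lt_0_compat; lra|].
  exists T. intros t Ht. eapply Rle_trans; [apply norm_scal_C|].
  specialize (H t Ht).
  apply Rle_trans with (Cmod c * (asn x + e / (Cmod c + 1))).
  { apply Rmult_le_compat_l; assumption. }
  rewrite Rmult_plus_distr_l. apply Rplus_le_compat_l.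
  apply Rle_trans with ((Cmod c + 1) * (e / (Cmod c + 1))).
  - apply Rmult_le_compat_r; [apply Rlt_le, Rdiv_lt_0_compat; lra|lra].
  - right; field; lra.
Qed.

Lemma asn_ext x y : (forall t, x t = y t) -> asn x = asn y.
Proof. intros H. now rewrite (functional_extensionality x y H). Qed.

Lemma asn_shift r x : asn (shift r x) = asn x.
Proof.
  assert (H : forall r x m, evle x m -> evle (shift r x) m).
  { intros r' x' m [T H]. exists (T - r'). intros t Ht. apply H. lra. }
  unfold asn. apply f_equal, Glb_Rbar_eqset. intros m. split; [|apply H].
  intros Hm. apply (H (- r)) in Hm.
  replace x with (shift (- r) (shift r x)); [exact Hm|].
  apply functional_extensionality. intros t. unfold shift. apply f_equal. ring.
Qed.

Lemma asn_vanish x : vanish x -> asn x = 0.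
Proof.
  intros H. apply Rle_antisym; [|apply asn_ge0]. apply asn_le. intros e He.
  rewrite Rplus_0_l. exact (H e He).
Qed.

Lemma vanish_asn x : bdd x -> asn x <= 0 -> vanish x.
Proof.
  intros Hb H e He. destruct (asn_ev x e Hb He) as [T HT]. exists T.
  intros t Ht. specialize (HT t Ht). lra.
Qed.

Lemma asn_vsub x y : bdd x -> bdd y -> asn (vsub x y) <= asn x + asn y.
Proof.
  intros Hx Hy.
  rewrite (asn_ext (vsub x y) (vadd x (vsc (RtoC (-1)) y))).
  - eapply Rle_trans; [apply asn_vadd; [exact Hx|now apply bdd_vsc]|].
    assert (H := asn_vsc (RtoC (-1)) y Hy). rewrite Cmod_R, Rabs_left in H by lra. lra.
  - intros t. unfold vsub, vadd, vsc. vring.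
Qed.

Lemma asn_le_vsub x y : bdd x -> bdd y -> asn x <= asn y + asn (vsub x y).
Proof.
  intros Hx Hy. rewrite (asn_ext x (vadd y (vsub x y))) at 1.
  - apply asn_vadd; [exact Hy|now apply bdd_vsub].
  - intros t. unfold vsub, vadd. vring.
Qed.

Lemma vanish_vadd x y : vanish x -> vanish y -> vanish (vadd x y).
Proof.
  intros Hx Hy e He. replace e with (e/2 + e/2) by field.
  apply evle_vadd; [apply Hx|apply Hy]; lra.
Qed.
Lemma vanish_vsc c x : vanish x -> vanish (vsc c x).
Proof.
  intros H e He. assert (Hc := Cmod_ge_0 c).
  destruct (H (e / (Cmod c + 1))) as [T HT]; [apply Rdiv_lt_0_compat; lra|].
  exists T. intros t Ht. eapply Rle_trans; [apply norm_scal_C|].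
  specialize (HT t Ht). assert (Hn := norm_ge_0 (x t)).
  apply Rle_trans with ((Cmod c + 1) * (e / (Cmod c + 1))); [|right; field; lra].
  apply Rmult_le_compat; lra.
Qed.
Lemma vanish_shift r x : vanish x -> vanish (shift r x).
Proof.
  intros H e He. destruct (H e He) as [T HT]. exists (T - r). intros t Ht. apply HT. lra.
Qed.
Lemma vanish_linear (A : X -> X) x : is_linear A -> vanish x -> vanish (fun t => A (x t)).
Proof.
  intros HA H e He. destruct (linear_norm A HA) as [K [HK Hn]].
  destruct (H (e / K)) as [T HT]; [now apply Rdiv_lt_0_compat|].
  exists T. intros t Ht. eapply Rle_trans; [apply Hn|].
  replace e with (K * (e / K)) by (field; lra).
  apply Rmult_le_compat_l; [lra|now apply HT].
Qed.
Lemma vanish_eventually x y T : (forall t, T <= t -> x t = y t) -> vanish x -> vanish y.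
Proof.
  intros Hxy H e He. destruct (H e He) as [S HS]. exists (Rmax T S).
  intros t Ht. rewrite <- Hxy.
  - apply HS, (Rle_trans _ _ _ (Rmax_r T S)), Ht.
  - apply (Rle_trans _ _ _ (Rmax_l T S)), Ht.
Qed.
Lemma vanish_vsub x y : vanish x -> vanish y -> vanish (vsub x y).
Proof.
  intros Hx Hy. apply (vanish_eventually (vadd x (vsc (RtoC (-1)) y)) _ 0).
  - intros t _. unfold vadd, vsub, vsc. vring.
  - apply vanish_vadd; [exact Hx|now apply vanish_vsc].
Qed.
Lemma vanish_le x (g : R -> R) T : (forall t, T <= t -> norm (x t) <= g t) ->
  (forall e, 0 < e -> exists S, forall t, S <= t -> g t <= e) -> vanish x.
Proof.
  intros Hxg Hg e He. destruct (Hg e He) as [S HS]. exists (Rmax T S). intros t Ht.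
  apply Rle_trans with (g t).
  - apply Hxg, (Rle_trans _ _ _ (Rmax_l T S)), Ht.
  - apply HS, (Rle_trans _ _ _ (Rmax_r T S)), Ht.
Qed.

Lemma tends_to_zero_vanish x : tends_to_zero x <-> vanish x.
Proof.
  assert (E := filterlim_locally_ball_norm (K := C_AbsRing) (U := X)
    (F := Rbar_locally p_infty) x zero).
  unfold tends_to_zero. split.
  - intros H e He. destruct (proj1 E H (mkposreal e He)) as [T HT]. exists (T + 1).
    intros t Ht. specialize (HT t ltac:(lra)). unfold ball_norm in HT; simpl in HT.
    norm_as (minus (x t) zero). now apply Rlt_le.
  - intros H. apply E. intros [e He]. unfold ball_norm. destruct (H (e/2)) as [T HT]; [lra|]. exists T. intros t Ht. simpl.
    norm_as (x t).
    apply Rle_lt_trans with (e/2); [apply HT; lra|lra].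
Qed.

End Functions.

#[export] Hint Resolve bdd_vadd bdd_vsub bdd_vsc bdd_shift BU_bdd : bdd.
#[export] Hint Resolve BU_vadd BU_vsub BU_vsc BU_shift BU_const : BU.

(** * Real powers *)

Lemma is_RInt_gen_lim {V : CompleteNormedModule R_AbsRing} (Fa Fb : (R -> Prop) -> Prop)
    {FFa : Filter Fa} {FFb : Filter Fb} (f : R -> V) (l : V) :
  filter_prod Fa Fb (fun ab => ex_RInt f (fst ab) (snd ab)) ->
  filterlim (fun ab => RInt f (fst ab) (snd ab)) (filter_prod Fa Fb) (locally l) ->
  is_RInt_gen f Fa Fb l.
Proof.
  intros Hex Hl P HP. specialize (Hl P HP). unfold filtermap in Hl. unfold filtermapi.
  generalize (filter_and _ _ Hex Hl). apply filter_imp. intros [a b] [H1 H2].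
  exists (RInt f a b). split; [now apply RInt_correct|exact H2].
Qed.

Lemma is_RInt_gen_filterlim {V : CompleteNormedModule R_AbsRing} (Fa Fb : (R -> Prop) -> Prop)
    {FFa : Filter Fa} {FFb : Filter Fb} (f : R -> V) (l : V) :
  is_RInt_gen f Fa Fb l ->
  filterlim (fun ab => RInt f (fst ab) (snd ab)) (filter_prod Fa Fb) (locally l).
Proof.
  intros H P HP. specialize (H P HP). unfold filtermapi in H. unfold filtermap.
  revert H. apply filter_imp. intros [a b] [y [H1 H2]]. simpl in *.
  now rewrite (is_RInt_unique _ _ _ _ H1).
Qed.

Lemma INR_ge1 n : (1 <= n)%nat -> 1 <= INR n.
Proof. intros Hn. change 1 with (INR 1). now apply le_INR. Qed.

Lemma div_INR_small D e : 0 <= D -> 0 < e ->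
  exists m, (1 <= m)%nat /\ forall n, (m <= n)%nat -> D / INR n <= e.
Proof.
  intros HD He. destruct (INR_unbounded (D / e + 1)) as [m Hm].
  assert (H0 : 0 <= D / e) by (apply Rmult_le_pos; [lra|apply Rlt_le, Rinv_0_lt_compat; lra]).
  exists m. split; [apply INR_le; simpl; lra|]. intros n Hn. apply le_INR in Hn.
  apply Rmult_le_reg_r with (INR n); [lra|].
  replace (D / INR n * INR n) with (D / e * e) by (field; lra).
  rewrite (Rmult_comm e). apply Rmult_le_compat_r; lra.
Qed.

Lemma exp_le_compat x y : x <= y -> exp x <= exp y.
Proof. intros [H|<-]; [now apply Rlt_le, exp_increasing|lra]. Qed.

Lemma Rpower_gt0 s a : 0 < Rpower s a.
Proof. apply exp_pos. Qed.

Lemma is_derive_Rpower a s : 0 < s ->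
  is_derive (fun s => Rpower s a) s (a * Rpower s (a - 1)).
Proof. intros Hs. apply is_derive_Reals. now apply derivable_pt_lim_power. Qed.

Lemma Rpower_split s a : 0 < s -> Rpower s a = s * Rpower s (a - 1).
Proof.
  intros Hs. rewrite <- (Rpower_1 s Hs) at 2. rewrite <- Rpower_plus. f_equal. ring.
Qed.

Lemma continuous_Rpower a s : 0 < s -> continuous (fun s => Rpower s a) s.
Proof.
  intros Hs. apply (ex_derive_continuous (fun s => Rpower s a)).
  eexists. now apply is_derive_Rpower.
Qed.

Lemma Rpower_le_incr a s t : 0 <= a -> 0 < s -> s <= t -> Rpower s a <= Rpower t a.
Proof.
  intros Ha Hs Hst. unfold Rpower. apply exp_le_compat.
  assert (ln s <= ln t).
  { destruct Hst as [H|<-]; [apply Rlt_le, ln_increasing; lra|lra]. }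
  nra.
Qed.

Lemma Rpower_le_decr a s t : a <= 0 -> 0 < s -> s <= t -> Rpower t a <= Rpower s a.
Proof.
  intros Ha Hs Hst. unfold Rpower. apply exp_le_compat.
  assert (ln s <= ln t).
  { destruct Hst as [H|<-]; [apply Rlt_le, ln_increasing; lra|lra]. }
  nra.
Qed.

Lemma Rpower_small a e : 0 < a -> 0 < e ->
  exists d, 0 < d /\ forall s, 0 < s -> s <= d -> Rpower s a <= e.
Proof.
  intros Ha He. exists (Rpower e (/ a)). split; [apply Rpower_gt0|].
  intros s Hs Hsd. apply Rle_trans with (Rpower (Rpower e (/ a)) a).
  - apply Rpower_le_incr; lra.
  - rewrite Rpower_mult, Rinv_l, Rpower_1; lra.
Qed.

Lemma Rpower_large a e : a < 0 -> 0 < e ->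
  exists T, 0 < T /\ forall s, T <= s -> Rpower s a <= e.
Proof.
  intros Ha He. exists (Rpower e (/ a)). split; [apply Rpower_gt0|].
  intros s Hs. apply Rle_trans with (Rpower (Rpower e (/ a)) a).
  - apply Rpower_le_decr; [lra|apply Rpower_gt0|lra].
  - rewrite Rpower_mult, Rinv_l, Rpower_1; lra.
Qed.

(** The mean value theorem, applied to [g - c f] with c = 1 and c = -1. *)
Lemma derive_dominated (f g df dg : R -> R) a b : a <= b ->
  (forall x, a <= x <= b -> is_derive f x (df x)) ->
  (forall x, a <= x <= b -> is_derive g x (dg x)) ->
  (forall x, a <= x <= b -> Rabs (df x) <= dg x) ->
  Rabs (f b - f a) <= g b - g a.
Proof.
  intros Hab Hf Hg Hd.
  assert (K : forall c, Rabs c = 1 -> c * (f b - f a) <= g b - g a).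
  { intros c Hc.
    destruct (MVT_gen (fun x => g x - c * f x) a b (fun x => dg x - c * df x)) as [x [Hx E]].
    - intros x Hx. rewrite Rmin_left, Rmax_right in Hx by lra.
      apply (is_derive_minus (V := R_NormedModule) g (fun x => c * f x)).
      + apply Hg; lra.
      + apply (is_derive_scal f x c). apply Hf; lra.
    - intros x Hx. rewrite Rmin_left, Rmax_right in Hx by lra.
      apply continuity_pt_minus.
      + apply continuity_pt_filterlim, (ex_derive_continuous g). eexists; now apply Hg.
      + apply continuity_pt_mult; [apply continuity_pt_const; now intros ? ?|].
        apply continuity_pt_filterlim, (ex_derive_continuous f). eexists; now apply Hf.
    - rewrite Rmin_left, Rmax_right in Hx by lra. specialize (Hd x Hx).
      assert (c * df x <= dg x).
      { apply Rle_trans with (2 := Hd). rewrite <- (Rmult_1_l (Rabs (df x))), <- Hc.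
        rewrite <- Rabs_mult. apply Rle_abs. }
      assert (0 <= (dg x - c * df x) * (b - a)) by (apply Rmult_le_pos; lra). lra. }
  apply Rabs_le. generalize (K 1 ltac:(apply Rabs_R1)) (K (-1) ltac:(rewrite Rabs_left; lra)). lra.
Qed.

(** A weak Jordan inequality, from sin y >= y - y^3/6 and y^2 <= 3 at y = PI/2 - x. It makes the
    integral of exp (- T cos phi) over the outer arc of order 1/T. *)
Lemma cos_lower x : 0 <= x <= PI / 2 -> (PI / 2 - x) / 2 <= cos x.
Proof.
  intros Hx. rewrite <- sin_shift. set (y := PI / 2 - x).
  assert (P4 := PI_4). assert (Hy : 0 <= y <= 2) by (unfold y; lra).
  destruct (sin_bound y 0) as [H _]; [lra|unfold y; generalize PI_RGT_0; lra|].
  unfold sin_approx, sin_term in H. simpl in H.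
  apply Rle_trans with (2 := H). 
  replace (1 * (y * 1 / 1) + - (1) * 1 * (y * (y * (y * 1)) / (1 + 1 + 1 + 1 + 1 + 1)))
    with (y - y * (y * y) / 6) by field.
  assert (y * y <= 3).
  { unfold y. assert (PI / 2 - x <= PI / 2) by lra.
    assert (PI <= 3.4) by (generalize PI_ineq; intros Q; destruct (Q 2%nat) as [_ Q2];
      unfold tg_alt, PI_tg in Q2; simpl in Q2; lra). nra. }
  nra.
Qed.

(** * Rotating the Gamma integral to the imaginary axis *)

Section Sector.
Variables (a b : R).

(* Real part of [e^{i b} e^{i a phi} s^{a-1} exp (- s e^{i phi})] on the ray of angle [phi]: its
   [phi]-derivative is the [s]-derivative of [flux] (Cauchy's theorem on a sector), and [b = 0],
   [b = - PI/2] give the real and imaginary parts. *)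
Definition psi (phi s : R) : R := a * phi - s * sin phi + b.
Definition ray (phi s : R) : R := Rpower s (a - 1) * exp (- (s * cos phi)) * cos (psi phi s).
Definition dray (phi s : R) : R :=
  Rpower s (a - 1) * exp (- (s * cos phi)) *
  (s * sin phi * cos (psi phi s) - (a - s * cos phi) * sin (psi phi s)).
Definition flux (phi s : R) : R := - (Rpower s a * exp (- (s * cos phi)) * sin (psi phi s)).

Lemma is_derive_ray phi s : is_derive (fun phi => ray phi s) phi (dray phi s).
Proof. unfold ray, dray, psi, Rminus. auto_derive; [trivial|]. ring. Qed.

Lemma is_derive_flux phi s : 0 < s -> is_derive (flux phi) s (dray phi s).
Proof.
  intros Hs. unfold flux.
  assert (H : is_derive (fun s => (fun s => Rpower s a) s * (fun s => - (exp (- (s * cos phi)) * sin (psi phi s))) s) s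
    (a * Rpower s (a - 1) * (- (exp (- (s * cos phi)) * sin (psi phi s))) +
     Rpower s a * (- (exp (- (s * cos phi)) * (- cos phi * sin (psi phi s) - sin phi * cos (psi phi s)))))).
  { apply (is_derive_mult (fun s => Rpower s a) (fun s => - (exp (- (s * cos phi)) * sin (psi phi s)))).
    - now apply is_derive_Rpower.
    - unfold psi, Rminus. auto_derive; [trivial|]. ring.
    - intros; apply Rmult_comm. }
  rewrite (Rpower_split s a Hs) in H.
  replace (dray phi s) with
    (a * Rpower s (a - 1) * - (exp (- (s * cos phi)) * sin (psi phi s)) +
     s * Rpower s (a - 1) *
     - (exp (- (s * cos phi)) *
        (- cos phi * sin (psi phi s) - sin phi * cos (psi phi s)))) by (unfold dray; ring).
  eapply is_derive_ext; [|exact H]. intros t. simpl. ring.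
Qed.

Lemma continuous2_dray x t : 0 < t -> continuous (fun z : R * R => dray (fst z) (snd z)) (x, t).
Proof.
  intros Ht.
  assert (c1 : continuous (fun z : R * R => fst z) (x, t)) by apply continuous_fst.
  assert (c2 : continuous (fun z : R * R => snd z) (x, t)) by apply continuous_snd.
  assert (comp : forall (g : R -> R) (f : R * R -> R), continuous f (x, t) ->
     (forall y, continuity_pt g y) -> continuous (fun z => g (f z)) (x, t)).
  { intros g f Hf Hg. apply (continuous_comp f g); [exact Hf|].
    apply continuity_pt_filterlim, Hg. }
  assert (cc : continuous (fun z : R * R => cos (fst z)) (x, t)) by (apply (comp cos); [exact c1|apply continuity_cos]).
  assert (cs : continuous (fun z : R * R => sin (fst z)) (x, t)) by (apply (comp sin); [exact c1|apply continuity_sin]).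
  assert (mul : forall f g : R * R -> R, continuous f (x, t) -> continuous g (x, t) ->
     continuous (fun z => f z * g z) (x, t)).
  { intros f g Hf Hg. exact (continuous_mult f g (x, t) Hf Hg). }
  assert (opp : forall f : R * R -> R, continuous f (x, t) ->
     continuous (fun z => - f z) (x, t)).
  { intros f Hf. exact (continuous_opp f (x, t) Hf). }
  assert (add : forall f g : R * R -> R, continuous f (x, t) -> continuous g (x, t) ->
     continuous (fun z => f z + g z) (x, t)).
  { intros f g Hf Hg. exact (continuous_plus f g (x, t) Hf Hg). }
  assert (sub : forall f g : R * R -> R, continuous f (x, t) -> continuous g (x, t) ->
     continuous (fun z => f z - g z) (x, t)).
  { intros f g Hf Hg. exact (continuous_minus f g (x, t) Hf Hg). }
  assert (cst : forall c : R, continuous (fun _ : R * R => c) (x, t)) by (intros; apply continuous_const).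
  assert (cp : continuous (fun z : R * R => psi (fst z) (snd z)) (x, t)).
  { unfold psi. auto. }
  assert (ccp : continuous (fun z : R * R => cos (psi (fst z) (snd z))) (x, t)).
  { apply (comp cos); [exact cp|apply continuity_cos]. }
  assert (csp : continuous (fun z : R * R => sin (psi (fst z) (snd z))) (x, t)).
  { apply (comp sin); [exact cp|apply continuity_sin]. }
  unfold dray. apply mul; [apply mul|].
  - apply (continuous_comp (fun z : R * R => snd z) (fun s => Rpower s (a - 1))); [exact c2|].
    now apply continuous_Rpower.
  - apply (comp exp); [auto|]. intros y. apply derivable_continuous_pt, derivable_pt_exp.
  - auto.
Qed.

Lemma continuous_dray phi s : 0 < s -> continuous (dray phi) s.
Proof.
  intros Hs. apply (continuous_comp (fun s => (phi, s)) (fun z => dray (fst z) (snd z)) s).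
  - apply (continuous_comp_2 (fun _ => phi) (fun s => s) (fun x y => (x, y))).
    + apply continuous_const.
    + apply continuous_id.
    + apply (continuous_ext (fun z : R * R => z)); [now intros []|]. apply continuous_id.
  - now apply continuous2_dray.
Qed.

Lemma continuous_ray phi s : 0 < s -> continuous (ray phi) s.
Proof.
  intros Hs. unfold ray, psi.
  apply (continuous_mult (fun s => Rpower s (a - 1) * exp (- (s * cos phi)))
    (fun s => cos (a * phi - s * sin phi + b))).
  - apply (continuous_mult (fun s => Rpower s (a - 1)) (fun s => exp (- (s * cos phi)))).
    + now apply continuous_Rpower.
    + apply (ex_derive_continuous (fun s => exp (- (s * cos phi)))). auto_derive; trivial.
  - apply (ex_derive_continuous (fun s => cos (a * phi - s * sin phi + b))). auto_derive; trivial.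
Qed.

Section Range.
Variables (e T : R).
Hypothesis (He : 0 < e) (HeT : e <= T).

Lemma ex_RInt_ray phi : ex_RInt (ray phi) e T.
Proof.
  apply (ex_RInt_continuous (V := R_CompleteNormedModule)). intros z Hz. rewrite Rmin_left in Hz by lra.
  apply continuous_ray; lra.
Qed.

Lemma is_derive_RInt_ray phi :
  is_derive (fun phi => RInt (ray phi) e T) phi (flux phi T - flux phi e).
Proof.
  assert (E : RInt (fun t => Derive (fun u => ray u t) phi) e T = flux phi T - flux phi e).
  { apply (is_RInt_unique (V := R_CompleteNormedModule)).
    apply (is_RInt_ext (V := R_NormedModule) (dray phi)).
    - intros x _. symmetry. apply is_derive_unique, is_derive_ray.
    - apply (is_RInt_derive (V := R_CompleteNormedModule) (flux phi) (dray phi)).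
      + intros x Hx. rewrite Rmin_left in Hx by lra. apply is_derive_flux; lra.
      + intros x Hx. rewrite Rmin_left in Hx by lra. apply continuous_dray; lra. }
  rewrite <- E. apply is_derive_RInt_param.
  - apply filter_forall. intros x t _. eexists. apply is_derive_ray.
  - intros t Ht. rewrite Rmin_left in Ht by lra.
    apply continuity_2d_pt_ext with dray.
    + intros x y. symmetry. apply is_derive_unique, is_derive_ray.
    + apply continuity_2d_pt_filterlim. apply (continuous2_dray phi t). lra.
  - apply filter_forall. intros x. apply ex_RInt_ray.
Qed.

Lemma flux_bound phi s : 0 < s ->
  Rabs (flux phi s) <= Rpower s a * exp (- (s * cos phi)).
Proof.
  intros Hs. unfold flux. rewrite Rabs_Ropp, !Rabs_mult.
  rewrite (Rabs_pos_eq (Rpower s a)) by apply Rlt_le, Rpower_gt0.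
  rewrite (Rabs_pos_eq (exp _)) by apply Rlt_le, exp_pos.
  rewrite <- (Rmult_1_r (_ * exp _)) at 2. apply Rmult_le_compat_l.
  - apply Rlt_le, Rmult_lt_0_compat; apply exp_pos.
  - apply Rabs_le, SIN_bound.
Qed.

(** The outer error 2 T^(a-1) tends to 0 only for a < 1, which is why order one is treated apart in
    [osc_pair]. *)
Lemma sector_bound :
  Rabs (RInt (ray (PI / 2)) e T - RInt (ray 0) e T) <= Rpower e a * (PI / 2) + 2 * Rpower T (a - 1).
Proof.
  assert (P := PI_RGT_0). assert (HT : 0 < T) by lra.
  (* The flux through the inner arc is at most e^a per unit angle. Through the outer arc it is at
     most T^a exp (- T cos phi), which [cos_lower] bounds by the derivative of the second term of
     [g]. *)
  set (g := fun phi => Rpower e a * phi + 2 * Rpower T (a - 1) * exp (- (T * ((PI / 2 - phi) / 2)))).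
  apply Rle_trans with (g (PI / 2) - g 0).
  - apply (derive_dominated (fun phi => RInt (ray phi) e T) g (fun phi => flux phi T - flux phi e)
      (fun phi => Rpower e a + Rpower T a * exp (- (T * ((PI / 2 - phi) / 2))))); [lra| | |].
    + intros; apply is_derive_RInt_ray.
    + intros x _. unfold g. auto_derive; [trivial|]. rewrite (Rpower_split T a HT). unfold Rminus, Rdiv. field.
    + intros x Hx. unfold Rminus. eapply Rle_trans; [apply Rabs_triang|]. rewrite Rabs_Ropp, Rplus_comm.
      assert (Hc := cos_lower x Hx).
      apply Rplus_le_compat; (eapply Rle_trans; [apply flux_bound; lra|]).
      * rewrite <- (Rmult_1_r (Rpower e a)) at 2. apply Rmult_le_compat_l; [apply Rlt_le, Rpower_gt0|].
        rewrite <- exp_0. apply exp_le_compat.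
        assert (0 <= cos x) by lra. assert (0 <= e * cos x) by (apply Rmult_le_pos; lra). lra.
      * apply Rmult_le_compat_l; [apply Rlt_le, Rpower_gt0|]. apply exp_le_compat.
        apply Ropp_le_contravar, Rmult_le_compat_l; lra.
  - unfold g. assert (0 < 2 * Rpower T (a - 1) * exp (- (T * ((PI / 2 - 0) / 2)))).
    { apply Rmult_lt_0_compat; [apply Rmult_lt_0_compat; [lra|apply Rpower_gt0]|apply exp_pos]. }
    replace (- (T * ((PI / 2 - PI / 2) / 2))) with 0 by field. rewrite exp_0. lra.
Qed.
End Range.
End Sector.

Lemma is_RInt_Rpower a e T : a <> 0 -> 0 < e -> e <= T ->
  is_RInt (fun s => Rpower s (a - 1)) e T ((Rpower T a - Rpower e a) / a).
Proof.
  intros Ha He HeT.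
  replace ((Rpower T a - Rpower e a) / a) with (minus (/ a * Rpower T a) (/ a * Rpower e a))
    by (unfold minus, plus, opp; simpl; field; exact Ha).
  apply (is_RInt_derive (V := R_CompleteNormedModule) (fun s => / a * Rpower s a)).
  - intros x Hx. rewrite Rmin_left in Hx by lra.
    replace (Rpower x (a - 1)) with (/ a * (a * Rpower x (a - 1))) by (field; exact Ha).
    apply (is_derive_scal (fun s => Rpower s a)). apply is_derive_Rpower; lra.
  - intros x Hx. rewrite Rmin_left in Hx by lra. apply continuous_Rpower; lra.
Qed.

Section GammaFunction.
Variable a : R.
Hypothesis Ha : 0 < a <= 1.

Definition gint (s : R) : R := Rpower s (a - 1) * exp (- s).

Lemma gint_ge0 s : 0 <= gint s.
Proof. apply Rlt_le, Rmult_lt_0_compat; apply exp_pos. Qed.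

Lemma ex_RInt_gint e T : 0 < e -> 0 < T -> ex_RInt gint e T.
Proof.
  intros He HT. apply (ex_RInt_continuous (V := R_CompleteNormedModule)). intros z Hz.
  assert (0 < z) by (apply Rlt_le_trans with (2 := proj1 Hz), Rmin_pos; assumption).
  apply (continuous_mult (fun s => Rpower s (a - 1)) (fun s => exp (- s))).
  - now apply continuous_Rpower.
  - apply (ex_derive_continuous (fun s => exp (- s))). auto_derive; trivial.
Qed.

Lemma gint_near0 d e : 0 < d -> d <= e -> 0 <= RInt gint d e <= Rpower e a / a.
Proof.
  intros Hd Hde. split.
  - apply RInt_ge_0; [lra|apply ex_RInt_gint; lra|]. intros; apply gint_ge0.
  - apply Rle_trans with ((Rpower e a - Rpower d a) / a).
    + rewrite <- (is_RInt_unique (V := R_CompleteNormedModule) _ _ _ _ (is_RInt_Rpower a d e ltac:(lra) Hd Hde)).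
      apply RInt_le; [lra|apply ex_RInt_gint; lra| |].
      * eexists. apply is_RInt_Rpower; lra.
      * intros x Hx. unfold gint. rewrite <- (Rmult_1_r (Rpower x (a - 1))) at 2.
        apply Rmult_le_compat_l; [apply Rlt_le, Rpower_gt0|].
        rewrite <- exp_0. apply exp_le_compat; lra.
    + assert (H := Rpower_gt0 d a). apply Rmult_le_compat_r; [apply Rlt_le, Rinv_0_lt_compat; lra|lra].
Qed.

Lemma gint_tail S T : 1 <= S -> S <= T -> 0 <= RInt gint S T <= exp (- S).
Proof.
  intros HS HST. split.
  - apply RInt_ge_0; [lra|apply ex_RInt_gint; lra|]. intros; apply gint_ge0.
  - assert (E : is_RInt (fun s => exp (- s)) S T (minus (- exp (- T)) (- exp (- S)))).
    { apply (is_RInt_derive (V := R_CompleteNormedModule) (fun s => - exp (- s))).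
      - intros x _. auto_derive; [trivial|ring].
      - intros x _. apply (ex_derive_continuous (fun s => exp (- s))). auto_derive; trivial. }
    apply Rle_trans with (minus (- exp (- T)) (- exp (- S))).
    + rewrite <- (is_RInt_unique (V := R_CompleteNormedModule) _ _ _ _ E).
      apply RInt_le; [lra|apply ex_RInt_gint; lra|eexists; exact E|].
      intros x Hx. unfold gint. rewrite <- (Rmult_1_l (exp (- x))) at 2.
      apply Rmult_le_compat_r; [apply Rlt_le, exp_pos|].
      apply Rle_trans with (Rpower 1 (a - 1)).
      * apply Rpower_le_decr; lra.
      * unfold Rpower. rewrite ln_1, Rmult_0_r, exp_0. lra.
    + unfold minus, plus, opp; simpl. generalize (exp_pos (- T)). lra.
Qed.

Lemma gint_extend d e S T : 0 < d -> d <= e -> e <= 1 -> 1 <= S -> S <= T ->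
  0 <= RInt gint d T - RInt gint e S <= Rpower e a / a + exp (- S).
Proof.
  intros Hd Hde He HS HST.
  assert (E : RInt gint d T = RInt gint d e + RInt gint e S + RInt gint S T).
  { rewrite <- (RInt_Chasles (V := R_CompleteNormedModule) gint d S T);
      [|apply ex_RInt_gint; lra|apply ex_RInt_gint; lra].
    rewrite <- (RInt_Chasles (V := R_CompleteNormedModule) gint d e S);
      [|apply ex_RInt_gint; lra|apply ex_RInt_gint; lra].
    reflexivity. }
  rewrite E. generalize (gint_near0 d e Hd Hde) (gint_tail S T HS HST). lra.
Qed.

Lemma exp_opp_small eps : 0 < eps -> exists S, 1 <= S /\ exp (- S) <= eps.
Proof.
  intros He. exists (Rmax 1 (- ln eps)). split; [apply Rmax_l|].
  rewrite <- (exp_ln eps He) at 2. apply exp_le_compat.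
  generalize (Rmax_r 1 (- ln eps)). lra.
Qed.

(** [RInt_gen] is an integral only if the limit exists; convergence follows from the Cauchy
    criterion, both ends being controlled by [gint_extend]. *)
Lemma Gamma_lim : filterlim (fun ab => RInt gint (fst ab) (snd ab))
  (filter_prod (at_right 0) (Rbar_locally p_infty)) (locally (Gamma a)).
Proof.
  assert (Hdom : filter_prod (at_right 0) (Rbar_locally p_infty)
    (fun ab => ex_RInt gint (fst ab) (snd ab))).
  { apply Filter_prod with (fun x => 0 < x) (fun x => 1 < x).
    - apply filter_forall with (P := fun x => 0 < x -> 0 < x). trivial.
    - exists 1. trivial.
    - intros x y Hx Hy. apply ex_RInt_gint; simpl; lra. }
  refine (is_RInt_gen_filterlim (V := R_CompleteNormedModule) _ _ gint (Gamma a) _).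
  refine (RInt_gen_correct (V := R_CompleteNormedModule) (Fa := at_right 0) (Fb := Rbar_locally p_infty) gint _).
  destruct (proj1 (filterlim_locally_cauchy (U := R_CompleteSpace)
    (F := filter_prod (at_right 0) (Rbar_locally p_infty))
    (fun ab => RInt gint (fst ab) (snd ab)))) as [l Hl].
  - intros [eps Heps].
    destruct (Rpower_small a (a * eps / 8)) as [d [Hd H1]];
      [lra|apply Rdiv_lt_0_compat; [apply Rmult_lt_0_compat|]; lra|].
    destruct (exp_opp_small (eps / 8)) as [S [HS H2]]; [lra|].
    set (e := Rmin d 1). assert (He : 0 < e) by (apply Rmin_pos; lra).
    assert (He1 : e <= 1) by apply Rmin_r.
    specialize (H1 e He (Rmin_l _ _)).
    assert (H3 : Rpower e a / a <= eps / 8).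
    { apply Rmult_le_reg_r with a; [lra|]. unfold Rdiv at 1. rewrite Rmult_assoc, Rinv_l by lra. lra. }
    exists (fun ab => 0 < fst ab < e /\ S < snd ab). split.
    + apply Filter_prod with (fun x => 0 < x < e) (fun x => S < x).
      * exists (mkposreal e He). intros y Hy Hy0. split; [exact Hy0|].
        unfold ball in Hy; simpl in Hy. unfold AbsRing_ball, abs, minus, plus, opp in Hy; simpl in Hy.
        apply Rabs_def2 in Hy. lra.
      * exists S. trivial.
      * simpl; tauto.
    + intros [x1 y1] [x2 y2] [A1 B1] [A2 B2]. simpl in *.
      assert (G1 := gint_extend x1 e S y1 ltac:(lra) ltac:(lra) He1 HS ltac:(lra)).
      assert (G2 := gint_extend x2 e S y2 ltac:(lra) ltac:(lra) He1 HS ltac:(lra)).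
      unfold ball; simpl. unfold AbsRing_ball, abs, minus, plus, opp; simpl.
      apply Rabs_def1; lra.
  - exists l. exact (is_RInt_gen_lim (V := R_CompleteNormedModule) _ _ gint l Hdom Hl).
Qed.

Lemma Gamma_approx e T : 0 < e <= 1 -> 1 <= T ->
  0 <= Gamma a - RInt gint e T <= Rpower e a / a + exp (- T).
Proof.
  intros He HT.
  assert (K : forall eta, 0 < eta ->
    - eta <= Gamma a - RInt gint e T <= Rpower e a / a + exp (- T) + eta).
  { intros eta Heta.
    assert (HG := Gamma_lim (ball (Gamma a) (mkposreal eta Heta)) (locally_ball _ _)).
    unfold filtermap in HG. destruct HG as [P Q [d HP] [S HQ] H].
    set (x := Rmin (d / 2) e). assert (Hd := cond_pos d).
    assert (Hx : 0 < x) by (apply Rmin_pos; lra).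
    set (y := Rmax (S + 1) T).
    assert (Hxd : x <= d / 2) by apply Rmin_l. assert (Hxe : x <= e) by apply Rmin_r.
    assert (Hy1 : S + 1 <= y) by apply Rmax_l. assert (Hy2 : T <= y) by apply Rmax_r.
    specialize (H x y).
    unfold ball in H; simpl in H. unfold AbsRing_ball, abs, minus, plus, opp in H; simpl in H.
    assert (Hb : Rabs (RInt gint x y + - Gamma a) < eta).
    { apply H.
      - apply HP; [|exact Hx]. unfold ball; simpl.
        unfold AbsRing_ball, abs, minus, plus, opp; simpl. apply Rabs_def1; lra.
      - apply HQ. lra. }
    apply Rabs_def2 in Hb.
    assert (G := gint_extend x e T y Hx Hxe ltac:(lra) HT Hy2). lra. }
  split; apply le_epsilon; intros eta Heta; specialize (K eta Heta); lra.
Qed.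

Lemma Gamma_gt0 : 0 < Gamma a.
Proof.
  apply Rlt_le_trans with (RInt gint 1 2).
  - apply RInt_gt_0; [lra| |].
    + intros x _. apply Rmult_lt_0_compat; apply exp_pos.
    + intros x Hx. apply (continuous_mult (fun s => Rpower s (a - 1)) (fun s => exp (- s))).
      * apply continuous_Rpower; lra.
      * apply (ex_derive_continuous (fun s => exp (- s))). auto_derive; trivial.
  - generalize (Gamma_approx 1 2 ltac:(lra) ltac:(lra)). lra.
Qed.

(** The first two terms come from the arcs of the sector, the last from truncating the Gamma
    integral. *)
Definition osc_err (e T : R) : R :=
  Rpower e a * (PI / 2) + 2 * Rpower T (a - 1) + (Rpower e a / a + exp (- T)).

Lemma osc_phase_cos e T : 0 < e <= 1 -> 1 <= T ->
  Rabs (RInt (fun s => Rpower s (a - 1) * cos (a * (PI / 2) - s)) e T - Gamma a) <= osc_err e T.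
Proof.
  intros He HT.
  assert (B := sector_bound a 0 e T ltac:(lra) ltac:(lra)).
  rewrite (RInt_ext (V := R_CompleteNormedModule) (ray a 0 (PI / 2))
    (fun s => Rpower s (a - 1) * cos (a * (PI / 2) - s))) in B.
  2:{ intros x _. unfold ray, psi. rewrite cos_PI2, sin_PI2, Rmult_0_r, Ropp_0, exp_0.
      rewrite !Rmult_1_r, Rplus_0_r. reflexivity. }
  rewrite (RInt_ext (V := R_CompleteNormedModule) (ray a 0 0) gint) in B.
  2:{ intros x _. unfold ray, psi, gint. rewrite sin_0, cos_0.
      replace (a * 0 - x * 0 + 0) with 0 by ring. rewrite cos_0, !Rmult_1_r. reflexivity. }
  assert (G := Gamma_approx e T He HT). unfold osc_err.
  apply Rabs_le. apply Rabs_le_between in B. lra.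
Qed.

(** The phase - PI/2 selects the imaginary part, which is zero on the real ray. *)
Lemma osc_phase_sin e T : 0 < e <= 1 -> 1 <= T ->
  Rabs (RInt (fun s => Rpower s (a - 1) * sin (a * (PI / 2) - s)) e T) <= osc_err e T.
Proof.
  intros He HT.
  assert (B := sector_bound a (- (PI / 2)) e T ltac:(lra) ltac:(lra)).
  rewrite (RInt_ext (V := R_CompleteNormedModule) (ray a (- (PI / 2)) (PI / 2))
    (fun s => Rpower s (a - 1) * sin (a * (PI / 2) - s))) in B.
  2:{ intros x _. unfold ray, psi. rewrite cos_PI2, sin_PI2, Rmult_0_r, Ropp_0, exp_0.
      rewrite !Rmult_1_r. f_equal. rewrite cos_sin. f_equal. ring. }
  rewrite (RInt_ext (V := R_CompleteNormedModule) (ray a (- (PI / 2)) 0) (fun _ => 0)) in B.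
  2:{ intros x _. unfold ray, psi. rewrite sin_0.
      replace (a * 0 - x * 0 + - (PI / 2)) with (- (PI / 2)) by ring.
      rewrite cos_neg, cos_PI2. apply Rmult_0_r. }
  rewrite (RInt_const (V := R_CompleteNormedModule)) in B. unfold scal in B; simpl in B; unfold mult in B; simpl in B.
  rewrite Rmult_0_r, Rminus_0_r in B.
  assert (0 <= Rpower e a / a + exp (- T)); [|unfold osc_err; lra].
  apply Rlt_le, Rplus_lt_0_compat; [apply Rdiv_lt_0_compat; [apply Rpower_gt0|lra]|apply exp_pos].
Qed.

Lemma ex_RInt_Rpower_mult (g : R -> R) e T : 0 < e -> e <= T -> (forall s, continuous g s) ->
  ex_RInt (fun s => Rpower s (a - 1) * g s) e T.
Proof.
  intros He HeT Hg. apply (ex_RInt_continuous (V := R_CompleteNormedModule)). intros z Hz.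
  rewrite Rmin_left in Hz by lra.
  apply (continuous_mult (fun s => Rpower s (a - 1)) g); [apply continuous_Rpower; lra|apply Hg].
Qed.

Lemma continuous_cos_shift c s : continuous (fun s => cos (c - s)) s.
Proof. apply (ex_derive_continuous (fun s => cos (c - s))). auto_derive; trivial. Qed.
Lemma continuous_sin_shift c s : continuous (fun s => sin (c - s)) s.
Proof. apply (ex_derive_continuous (fun s => sin (c - s))). auto_derive; trivial. Qed.

(** By the addition formulas, cos s and sin s are combinations of the two shifted phases; [c1] goes
    with the integral tending to Gamma a, [c2] with the one tending to 0. *)
Lemma osc_combine c1 c2 e T : 0 < e <= 1 -> 1 <= T -> Rabs c1 <= 1 -> Rabs c2 <= 1 ->
  Rabs (RInt (fun s => Rpower s (a - 1) *
     (c1 * cos (a * (PI / 2) - s) + c2 * sin (a * (PI / 2) - s))) e T - Gamma a * c1)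
  <= 2 * osc_err e T.
Proof.
  intros He HT H1 H2.
  assert (X1 := ex_RInt_Rpower_mult (fun s => cos (a * (PI / 2) - s)) e T ltac:(lra) ltac:(lra) (continuous_cos_shift _)).
  assert (X2 := ex_RInt_Rpower_mult (fun s => sin (a * (PI / 2) - s)) e T ltac:(lra) ltac:(lra) (continuous_sin_shift _)).
  assert (E : RInt (fun s => Rpower s (a - 1) *
     (c1 * cos (a * (PI / 2) - s) + c2 * sin (a * (PI / 2) - s))) e T =
     c1 * RInt (fun s => Rpower s (a - 1) * cos (a * (PI / 2) - s)) e T +
     c2 * RInt (fun s => Rpower s (a - 1) * sin (a * (PI / 2) - s)) e T).
  { apply (is_RInt_unique (V := R_CompleteNormedModule)).
    apply (is_RInt_ext (V := R_NormedModule) (fun s =>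
      plus (scal c1 (Rpower s (a - 1) * cos (a * (PI / 2) - s)))
           (scal c2 (Rpower s (a - 1) * sin (a * (PI / 2) - s))))).
    - intros x _. unfold plus, scal; simpl. unfold mult; simpl. ring.
    - apply (is_RInt_plus (V := R_NormedModule));
        apply (is_RInt_scal (V := R_NormedModule)), (RInt_correct (V := R_CompleteNormedModule)); assumption. }
  rewrite E. clear E.
  assert (B1 := osc_phase_cos e T He HT). assert (B2 := osc_phase_sin e T He HT).
  set (I1 := RInt _ e T) in *. set (I2 := RInt (fun s => _ * sin _) e T) in *.
  replace (c1 * I1 + c2 * I2 - Gamma a * c1) with (c1 * (I1 - Gamma a) + c2 * I2) by ring.
  eapply Rle_trans; [apply Rabs_triang|]. rewrite !Rabs_mult.
  assert (N1 := Rabs_pos (I1 - Gamma a)). assert (N2 := Rabs_pos I2).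
  assert (N3 := Rabs_pos c1). assert (N4 := Rabs_pos c2). nra.
Qed.

Lemma osc_err_small eps : a < 1 -> 0 < eps -> exists d S, 0 < d <= 1 /\ 1 <= S /\
  forall e T, 0 < e <= d -> S <= T -> osc_err e T <= eps.
Proof.
  intros Ha1 He. assert (P := PI_RGT_0).
  assert (Hk : 0 < PI / 2 + / a).
  { assert (0 < / a) by (apply Rinv_0_lt_compat; lra). lra. }
  destruct (Rpower_small a (eps / 3 / (PI / 2 + / a))) as [d [Hd H1]];
    [lra|apply Rdiv_lt_0_compat; lra|].
  destruct (Rpower_large (a - 1) (eps / 6)) as [S1 [HS1 H2]]; [lra|lra|].
  destruct (exp_opp_small (eps / 3)) as [S2 [HS2 H3]]; [lra|].
  exists (Rmin d 1), (Rmax S1 S2).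
  assert (Rmin d 1 <= d) by apply Rmin_l. assert (Rmin d 1 <= 1) by apply Rmin_r.
  assert (0 < Rmin d 1) by (apply Rmin_pos; lra).
  assert (S1 <= Rmax S1 S2) by apply Rmax_l. assert (S2 <= Rmax S1 S2) by apply Rmax_r.
  split; [lra|]. split; [lra|]. intros e T He' HT.
  specialize (H1 e ltac:(lra) ltac:(lra)). specialize (H2 T ltac:(lra)).
  assert (exp (- T) <= exp (- S2)) by (apply exp_le_compat; lra).
  unfold osc_err.
  assert (Rpower e a * (PI / 2 + / a) <= eps / 3).
  { apply (Rmult_le_compat_r (PI / 2 + / a)) in H1; [|lra].
    replace (eps / 3 / (PI / 2 + / a) * (PI / 2 + / a)) with (eps / 3) in H1 by (field; split; nra). exact H1. }
  unfold Rdiv in *. lra.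
Qed.

Lemma scale_osc (g : R -> R) eta e T : 0 < eta -> 0 < e -> e <= T -> (forall s, continuous g s) ->
  RInt (fun s => Rpower s (a - 1) * g (eta * s)) e T =
  Rpower eta (- a) * RInt (fun s => Rpower s (a - 1) * g s) (eta * e) (eta * T).
Proof.
  intros Heta He HeT Hg.
  assert (X := ex_RInt_Rpower_mult g (eta * e + 0) (eta * T + 0) ltac:(nra) ltac:(nra) Hg).
  assert (Y := RInt_correct (V := R_CompleteNormedModule) _ _ _ X).
  apply (is_RInt_unique (V := R_CompleteNormedModule)).
  apply (is_RInt_comp_lin (V := R_NormedModule)) in Y.
  apply (is_RInt_scal (V := R_NormedModule) _ _ _ (Rpower eta (- a))) in Y.
  rewrite !Rplus_0_r in Y.
  eapply (is_RInt_ext (V := R_NormedModule)); [|exact Y].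
  intros x Hx. rewrite Rmin_left, Rmax_right in Hx by lra.
  unfold scal; simpl. unfold mult; simpl. rewrite Rplus_0_r.
  rewrite <- (Rpower_mult_distr eta x (a - 1)) by lra.
  assert (E : Rpower eta (- a) * eta * Rpower eta (a - 1) = 1).
  { rewrite <- (Rpower_1 eta Heta) at 2. rewrite <- !Rpower_plus.
    replace (- a + 1 + (a - 1)) with 0 by ring. now apply Rpower_O. }
  transitivity ((Rpower eta (- a) * eta * Rpower eta (a - 1)) * (Rpower x (a - 1) * g (eta * x))); [|rewrite E]; ring.
Qed.

(** The integral of s^(a-1) e^{i eta s} over the half line is Gamma(a) eta^(-a) e^{i a PI/2}; the
    variable is scaled by eta to reduce to eta = 1. *)
Lemma osc_limit_pos eta eps : a < 1 -> 0 < eta -> 0 < eps -> exists d S, 0 < d <= S /\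
  forall e T, 0 < e <= d -> S <= T ->
  Rabs (RInt (fun s => Rpower s (a - 1) * cos (eta * s)) e T -
        Gamma a * (Rpower eta (- a) * cos (a * (PI / 2)))) <= eps /\
  Rabs (RInt (fun s => Rpower s (a - 1) * sin (eta * s)) e T -
        Gamma a * (Rpower eta (- a) * sin (a * (PI / 2)))) <= eps.
Proof.
  intros Ha1 Heta Heps. assert (Hp := Rpower_gt0 eta (- a)).
  destruct (osc_err_small (eps / Rpower eta (- a) / 2)) as [d [S [Hd [HS H]]]];
    [exact Ha1|apply Rdiv_lt_0_compat; [apply Rdiv_lt_0_compat|]; lra|].
  assert (Hi : 0 < / eta) by now apply Rinv_0_lt_compat.
  exists (d / eta), (S / eta).
  assert (K1 : d / eta <= S / eta) by (apply Rmult_le_compat_r; lra).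
  assert (K2 : 0 < d / eta) by (apply Rdiv_lt_0_compat; lra).
  split; [lra|]. intros e T He HT.
  assert (Q1 : 0 < eta * e <= d).
  { split; [nra|]. apply Rmult_le_reg_r with (/ eta); [exact Hi|].
    replace (eta * e * / eta) with e by (field; lra). unfold Rdiv in *; lra. }
  assert (Q2 : S <= eta * T).
  { apply Rmult_le_reg_r with (/ eta); [exact Hi|].
    replace (eta * T * / eta) with T by (field; lra). exact HT. }
  specialize (H (eta * e) (eta * T) Q1 Q2).
  assert (B1 : Rabs (cos (a * (PI / 2))) <= 1) by (apply Rabs_le, COS_bound).
  assert (B2 : Rabs (sin (a * (PI / 2))) <= 1) by (apply Rabs_le, SIN_bound).
  assert (B3 : Rabs (- cos (a * (PI / 2))) <= 1) by (rewrite Rabs_Ropp; exact B1).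
  assert (cont_cos : forall s, continuous cos s).
  { intros s. apply (ex_derive_continuous cos). auto_derive; trivial. }
  assert (cont_sin : forall s, continuous sin s).
  { intros s. apply (ex_derive_continuous sin). auto_derive; trivial. }
  assert (fin : forall I c, Rabs (I - Gamma a * c) <= 2 * osc_err (eta * e) (eta * T) ->
    Rabs (Rpower eta (- a) * I - Gamma a * (Rpower eta (- a) * c)) <= eps).
  { intros I c HI.
    replace (Rpower eta (- a) * I - Gamma a * (Rpower eta (- a) * c))
      with (Rpower eta (- a) * (I - Gamma a * c)) by ring.
    rewrite Rabs_mult, Rabs_pos_eq by lra.
    apply Rle_trans with (Rpower eta (- a) * (2 * (eps / Rpower eta (- a) / 2))).
    - apply Rmult_le_compat_l; lra.
    - right; field; lra. }
  split.
  - rewrite (scale_osc cos) by (trivial; lra). apply fin.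
    erewrite RInt_ext; [apply (osc_combine (cos (a * (PI / 2))) (sin (a * (PI / 2)))); trivial; lra|].
    intros x _. simpl. f_equal. rewrite <- cos_minus. f_equal. ring.
  - rewrite (scale_osc sin) by (trivial; lra). apply fin.
    erewrite RInt_ext; [apply (osc_combine (sin (a * (PI / 2))) (- cos (a * (PI / 2)))); trivial; lra|].
    intros x _. simpl. f_equal.
    transitivity (sin (a * (PI / 2) - (a * (PI / 2) - x))); [f_equal; ring|].
    rewrite sin_minus. ring.
Qed.

End GammaFunction.

(** * Vector-valued integrals and the fractional kernel *)

Section Integral.
Context {X : CompleteNormedModule C_AbsRing}.

(* Restating integrals over [real_space X] with the complex structure of [X]. *)
Definition isX (f : R -> X) (u v : R) (l : X) : Prop := @is_RInt (real_space X) f u v l.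
Definition exX (f : R -> X) (u v : R) : Prop := @ex_RInt (real_space X) f u v.
Definition intX (f : R -> X) (u v : R) : X := @RInt (real_space X) f u v.

Lemma exX_correct f u v : exX f u v -> isX f u v (intX f u v).
Proof. exact (RInt_correct (V := real_space X) f u v). Qed.

Lemma isX_unique f u v l : isX f u v l -> intX f u v = l.
Proof. exact (is_RInt_unique (V := real_space X) f u v l). Qed.

Lemma isX_plus f g u v (l m : X) : isX f u v l -> isX g u v m ->
  isX (fun s => plus (f s) (g s)) u v (plus l m).
Proof. exact (is_RInt_plus (V := real_space X) f g u v l m). Qed.

Lemma isX_minus f g u v (l m : X) : isX f u v l -> isX g u v m ->
  isX (fun s => minus (f s) (g s)) u v (minus l m).
Proof. exact (is_RInt_minus (V := real_space X) f g u v l m). Qed.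

Lemma intX_Chasles f u v w : exX f u v -> exX f v w ->
  plus (intX f u v) (intX f v w) = intX f u w.
Proof. exact (RInt_Chasles (V := real_space X) f u v w). Qed.

Lemma isX_ext f g u v l : u <= v -> (forall s, u < s < v -> f s = g s) ->
  isX f u v l -> isX g u v l.
Proof.
  intros Huv H. apply (is_RInt_ext (V := real_space X)). intros s Hs.
  rewrite Rmin_left, Rmax_right in Hs by lra. now apply H.
Qed.

Lemma isX_shift f r u v l : isX f (u + r) (v + r) l -> isX (fun s => f (s + r)) u v l.
Proof.
  intros H. assert (K := is_RInt_comp_lin (V := real_space X) f 1 r u v l).
  rewrite !Rmult_1_l in K. specialize (K H).
  eapply (is_RInt_ext (V := real_space X)); [|exact K].
  intros s _. simpl. rewrite Rmult_1_l. exact (scal_one (V := real_space X) (f (s + r))).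
Qed.

Lemma norm_isX_le f (g : R -> R) u v l m : u <= v ->
  (forall s, u <= s <= v -> norm (f s) <= g s) -> isX f u v l -> is_RInt g u v m -> norm l <= m.
Proof. exact (norm_RInt_le (V := real_space X) f g u v l m). Qed.

(** [A] commutes with every Riemann sum and is continuous, so it passes to the limit. *)
Lemma isX_linear (A : X -> X) f u v l : is_linear A -> isX f u v l ->
  isX (fun s => A (f s)) u v (A l).
Proof.
  intros HA H. destruct (linear_norm A HA) as [K [HK Hn]].
  assert (Ascal : forall (c : R) (x : real_space X), A (scal c x) = scal c (A x : real_space X)).
  { intros c x. exact (linear_scal A HA (RtoC c) x). }
  unfold isX, is_RInt in *.
  apply (filterlim_ext (fun ptd => A (@scal _ (real_space X) (sign (v - u)) (@Riemann_sum (real_space X) f ptd)))).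
  - intros ptd. rewrite Ascal. apply f_equal.
    pattern ptd. apply SF_cons_ind; clear ptd.
    + intros x0. change (A zero = zero).
      transitivity (A (scal (RtoC 0) zero)); [apply f_equal; vring|].
      rewrite (linear_scal A HA). exact (scal_zero_l (A zero)).
    + intros h s IH. rewrite !Riemann_sum_cons, <- IH, <- Ascal. exact (linear_plus A HA _ _).
  - apply (filterlim_comp _ _ _ _ A _ (locally (T := real_space X) l)); [exact H|].
    apply (filterlim_locally_ball_norm (K := C_AbsRing) (U := X) (F := locally (T := X) l)
      (FF := filter_filter (ProperFilter := locally_filter (T := X) l))).
    intros [e He].
    apply (filter_imp (F := locally (T := X) l) (Filter := filter_filter (ProperFilter := locally_filter (T := X) l)) (ball_norm l (mkposreal (e / K) (Rdiv_lt_0_compat _ _ He HK)))).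
    + intros x Hx. unfold ball_norm in *. simpl in *.
      rewrite <- (is_linear_minus A HA). eapply Rle_lt_trans; [apply Hn|].
      apply (Rmult_lt_compat_l K) in Hx; [|exact HK].
      replace (K * (e / K)) with e in Hx by (field; lra). exact Hx.
    + exact (locally_ball_norm (K := C_AbsRing) (V := X) l _).
Qed.

Lemma ucont_continuous (x : R -> X) t : ucont x -> continuous (T := R_UniformSpace) (U := real_space X) x t.
Proof.
  intros H. unfold continuous.
  apply (filterlim_locally_ball_norm (K := C_AbsRing) (U := X) (F := locally (T := R_UniformSpace) t)).
  intros [e He]. destruct (H e He) as [d [Hd Hx]]. exists (mkposreal d Hd).
  intros y Hy. unfold ball_norm. simpl. apply Hx. exact Hy.
Qed.

Lemma exX_continuous f u v : u <= v ->
  (forall s, u <= s <= v -> continuous (T := R_UniformSpace) (U := real_space X) f s) -> exX f u v.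
Proof.
  intros Huv H. apply (ex_RInt_continuous (V := real_space X)). intros s Hs.
  rewrite Rmin_left, Rmax_right in Hs by lra. now apply H.
Qed.

Lemma norm_intX_le f (g : R -> R) u v m : u <= v -> exX f u v ->
  (forall s, u <= s <= v -> norm (f s) <= g s) -> is_RInt g u v m -> norm (intX f u v) <= m.
Proof.
  intros Huv Hf Hfg Hg. apply (norm_isX_le f g u v); trivial. now apply exX_correct.
Qed.

Lemma norm_scal_real (c : R) (x : X) : norm (scal (RtoC c) x) <= Rabs c * norm x.
Proof. rewrite <- Cmod_R. apply norm_scal_C. Qed.

End Integral.

Section Kernel.
Variable a : R.
Hypothesis Ha : 0 < a <= 1.

(** This is a times the kernel mass of lags between r - h and r. That it converges for long lags (to
    0 if a < 1, to h if a = 1) is what makes increments forget the distant past. *)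
Definition dif (h r : R) : R := Rpower r a - Rpower (r - h) a.

Lemma Rpower_subadd x h : 0 < x -> 0 < h -> Rpower (x + h) a <= Rpower x a + Rpower h a.
Proof.
  intros Hx Hh. rewrite (Rpower_split (x + h)), (Rpower_split x), (Rpower_split h) by lra.
  assert (Rpower (x + h) (a - 1) <= Rpower x (a - 1)) by (apply Rpower_le_decr; lra).
  assert (Rpower (x + h) (a - 1) <= Rpower h (a - 1)) by (apply Rpower_le_decr; lra).
  nra.
Qed.

Lemma dif_le h r : 0 < h -> h < r -> dif h r <= Rpower h a.
Proof.
  intros Hh Hr. unfold dif. assert (H := Rpower_subadd (r - h) h ltac:(lra) Hh).
  replace (r - h + h) with r in H by ring. lra.
Qed.

Lemma dif_ge0 h r : 0 < h -> h < r -> 0 <= dif h r.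
Proof. intros Hh Hr. unfold dif. generalize (Rpower_le_incr a (r - h) r). lra. Qed.

Lemma dif_le_linear h r : 0 < h -> h < r -> dif h r <= h * Rpower r (a - 1).
Proof.
  intros Hh Hr. unfold dif. rewrite (Rpower_split r), (Rpower_split (r - h)) by lra.
  assert (Rpower r (a - 1) <= Rpower (r - h) (a - 1)) by (apply Rpower_le_decr; lra). nra.
Qed.

Lemma dif_lim h : 0 < h ->
  exists l, forall e, 0 < e -> exists S, 0 < S /\ forall r, S <= r -> Rabs (dif h r - l) <= e.
Proof.
  intros Hh. destruct (Rle_lt_or_eq_dec _ _ (proj2 Ha)) as [H1|H1].
  - exists 0. intros e He.
    destruct (Rpower_large (a - 1) (e / h)) as [S [HS H]]; [lra|now apply Rdiv_lt_0_compat|].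
    exists (Rmax S (h + 1)). assert (B1 := Rmax_l S (h + 1)). assert (B2 := Rmax_r S (h + 1)).
    split; [lra|]. intros r Hr. rewrite Rminus_0_r, Rabs_pos_eq by (apply dif_ge0; lra).
    eapply Rle_trans; [apply dif_le_linear; lra|]. specialize (H r ltac:(lra)).
    apply (Rmult_le_compat_l h) in H; [|lra].
    replace (h * (e / h)) with e in H by (field; lra). exact H.
  - exists h. intros e He. exists (h + 1). split; [lra|]. intros r Hr.
    unfold dif. rewrite H1, !Rpower_1 by lra. replace (r - (r - h) - h) with 0 by ring.
    rewrite Rabs_R0. lra.
Qed.

Lemma is_RInt_kernel t u v : u <= v -> v < t ->
  is_RInt (fun s => Rpower (t - s) (a - 1)) u v ((Rpower (t - u) a - Rpower (t - v) a) / a).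
Proof.
  intros Huv Hvt.
  replace ((Rpower (t - u) a - Rpower (t - v) a) / a)
    with (minus (- (/ a * Rpower (t - v) a)) (- (/ a * Rpower (t - u) a)))
    by (unfold minus, plus, opp; simpl; field; lra).
  apply (is_RInt_derive (V := R_CompleteNormedModule) (fun s => - (/ a * Rpower (t - s) a))).
  - intros x Hx. rewrite Rmax_right in Hx by lra.
    assert (D := is_derive_Rpower a (t - x) ltac:(lra)).
    assert (E : is_derive (fun s => t - s) x (-1)) by (auto_derive; [trivial|ring]).
    assert (K := is_derive_comp (fun s => Rpower s a) (fun s => t - s) x _ _ D E).
    apply (is_derive_scal _ _ (- / a)) in K.
    unfold scal in K; simpl in K; unfold mult in K; simpl in K.
    replace (- / a * (-1 * (a * Rpower (t - x) (a - 1)))) with (Rpower (t - x) (a - 1)) in K by (field; lra).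
    eapply is_derive_ext; [|exact K]. intros s. simpl. ring.
  - intros x Hx. rewrite Rmax_right in Hx by lra.
    apply (continuous_comp (fun s => t - s) (fun s => Rpower s (a - 1))).
    + apply (ex_derive_continuous (fun s => t - s)). auto_derive; trivial.
    + apply continuous_Rpower; lra.
Qed.

End Kernel.

(** * The fractional integral *)

Section FractionalIntegral.
Context {X : CompleteNormedModule C_AbsRing}.
Variable a : R.
Hypothesis Ha : 0 < a <= 1.
Implicit Types g : R -> X.

Definition kf (t : R) g (s : R) : X := scal (RtoC (Rpower (t - s) (a - 1) / Gamma a)) (g s).

Let G0 : 0 < Gamma a := Gamma_gt0 a Ha.

Lemma norm_kf t g s : norm (kf t g s) <= Rpower (t - s) (a - 1) / Gamma a * norm (g s).
Proof.
  unfold kf. eapply Rle_trans; [apply norm_scal_real|].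
  rewrite Rabs_pos_eq; [lra|]. apply Rlt_le, Rdiv_lt_0_compat; [apply Rpower_gt0|exact G0].
Qed.

Lemma continuous_kf t g s : ucont g -> s < t ->
  continuous (T := R_UniformSpace) (U := real_space X) (kf t g) s.
Proof.
  intros Hg Hs. unfold kf.
  apply (continuous_scal (V := real_space X) (fun s => Rpower (t - s) (a - 1) / Gamma a) g).
  - apply (continuous_mult (fun s => Rpower (t - s) (a - 1)) (fun _ => / Gamma a)).
    + apply (continuous_comp (fun s => t - s) (fun s => Rpower s (a - 1))).
      * apply (ex_derive_continuous (fun s => t - s)). auto_derive; trivial.
      * apply continuous_Rpower; lra.
    + apply continuous_const.
  - now apply ucont_continuous.
Qed.

Lemma exX_kf t g u v : ucont g -> u <= v -> v < t -> exX (kf t g) u v.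
Proof. intros Hg Huv Hvt. apply exX_continuous; [exact Huv|]. intros; apply continuous_kf; trivial; lra. Qed.

Lemma is_RInt_kf t u v M : u <= v -> v < t ->
  is_RInt (fun s => Rpower (t - s) (a - 1) / Gamma a * M) u v
    (M * (Rpower (t - u) a - Rpower (t - v) a) / (a * Gamma a)).
Proof.
  intros Huv Hvt.
  replace (M * (Rpower (t - u) a - Rpower (t - v) a) / (a * Gamma a))
    with (scal (M / Gamma a) ((Rpower (t - u) a - Rpower (t - v) a) / a))
    by (unfold scal; simpl; unfold mult; simpl; field; lra).
  eapply (is_RInt_ext (V := R_NormedModule)).
  2:{ apply (is_RInt_scal (V := R_NormedModule)). apply is_RInt_kernel; assumption || lra. }
  intros x _. unfold scal; simpl; unfold mult; simpl. field; lra.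
Qed.

Lemma norm_intX_kf t g u v M : ucont g -> u <= v -> v < t ->
  (forall s, u <= s <= v -> norm (g s) <= M) ->
  norm (intX (kf t g) u v) <= M * (Rpower (t - u) a - Rpower (t - v) a) / (a * Gamma a).
Proof.
  intros Hg Huv Hvt HM.
  apply (norm_intX_le (kf t g) (fun s => Rpower (t - s) (a - 1) / Gamma a * M)); trivial.
  - now apply exX_kf.
  - intros s Hs. eapply Rle_trans; [apply norm_kf|]. apply Rmult_le_compat_l; [|now apply HM].
    apply Rlt_le, Rdiv_lt_0_compat; [apply Rpower_gt0|exact G0].
  - now apply is_RInt_kf.
Qed.

(** Left limits in epsilon form. Facts about [J] are proved for truncated integrals, which stay away
    from the singular end point, and carried over by such limits. *)
Definition approaches (F : R -> X) (t : R) (l : X) : Prop :=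
  forall e, 0 < e -> exists d, 0 < d /\ forall s, t - d < s -> s < t -> norm (minus (F s) l) <= e.

Lemma approaches_unique F t l m : approaches F t l -> approaches F t m -> l = m.
Proof.
  intros Hl Hm. apply eq_of_small_norm. intros e He.
  destruct (Hl (e/2)) as [d [Hd H1]]; [lra|]. destruct (Hm (e/2)) as [d' [Hd' H2]]; [lra|].
  set (s := t - Rmin d d' / 2). assert (0 < Rmin d d') by now apply Rmin_pos.
  assert (Rmin d d' <= d) by apply Rmin_l. assert (Rmin d d' <= d') by apply Rmin_r.
  specialize (H1 s ltac:(unfold s; lra) ltac:(unfold s; lra)).
  specialize (H2 s ltac:(unfold s; lra) ltac:(unfold s; lra)).
  eapply Rle_trans; [apply (norm_minus_trans l (F s) m)|].
  rewrite (norm_minus_sym l). lra.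
Qed.

Lemma is_J t g : 0 < t -> ucont g ->
  @is_RInt_gen (real_space X) (kf t g) (at_point 0) (at_left t) (J a g t).
Proof.
  intros Ht Hg. unfold J. destruct (Rlt_dec 0 t) as [_|]; [|lra].
  assert (Hdom : filter_prod (at_point 0) (at_left t)
    (fun ab => @ex_RInt (real_space X) (kf t g) (fst ab) (snd ab))).
  { apply Filter_prod with (fun x => x = 0) (fun x => 0 < x < t).
    - reflexivity.
    - exists (mkposreal t Ht). intros y Hy Hyt. split; [|exact Hyt].
      unfold ball in Hy; simpl in Hy. unfold AbsRing_ball, abs, minus, plus, opp in Hy; simpl in Hy.
      apply Rabs_def2 in Hy. lra.
    - intros x y -> Hy. apply exX_kf; simpl; trivial; lra. }
  refine (RInt_gen_correct (V := real_space X) (Fa := at_point 0) (Fb := at_left t) (kf t g) _).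
  (* Uniform continuity alone bounds [g] on [0, t]: walk from 0 in steps of d/2, each changing the
     value by less than 1. *)
  assert (HM : exists M, 0 < M /\ forall s, 0 <= s <= t -> norm (g s) <= M).
  { destruct (Hg 1 Rlt_0_1) as [d [Hd H]].
    assert (K : forall n s, 0 <= s <= INR n * (d / 2) -> norm (g s) <= norm (g 0) + INR n).
    { induction n as [|n IH]; intros s Hs.
      - simpl in *. replace s with 0 by lra. lra.
      - rewrite S_INR in *. destruct (Rle_dec s (d / 2)) as [Hsd|Hsd].
        + eapply Rle_trans; [apply (norm_le_minus (g s) (g 0))|].
          assert (norm (minus (g s) (g 0)) < 1) by (apply H; rewrite Rminus_0_r, Rabs_pos_eq; lra).
          assert (0 <= INR n) by apply pos_INR. lra.
        + eapply Rle_trans; [apply (norm_le_minus (g s) (g (s - d / 2)))|].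
          assert (norm (minus (g s) (g (s - d / 2))) < 1).
          { apply H. replace (s - (s - d / 2)) with (d / 2) by ring. rewrite Rabs_pos_eq; lra. }
          specialize (IH (s - d / 2)). lra. }
    destruct (INR_unbounded (t / (d / 2))) as [n Hn].
    exists (norm (g 0) + INR n + 1). assert (0 <= norm (g 0)) by apply norm_ge_0.
    assert (0 <= INR n) by apply pos_INR. split; [lra|]. intros s Hs.
    apply Rle_trans with (norm (g 0) + INR n); [|lra]. apply K. split; [lra|].
    apply Rle_trans with (t / (d / 2) * (d / 2)).
    - replace (t / (d / 2) * (d / 2)) with t by (field; lra). lra.
    - apply Rmult_le_compat_r; lra. }
  destruct HM as [M [HM0 HM]].
  destruct (proj1 (filterlim_locally_cauchy (U := real_space X)
    (F := filter_prod (at_point 0) (at_left t))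
    (fun ab => @RInt (real_space X) (kf t g) (fst ab) (snd ab)))) as [l Hl].
  - intros [eps Heps].
    (* The integral from u to beyond is at most M (t - u)^a / (a Gamma a); this threshold for the
       power keeps it below eps / 2. *)
    assert (Hq : 0 < eps * (a * Gamma a) / (2 * M)).
    { apply Rdiv_lt_0_compat; [apply Rmult_lt_0_compat; [lra|apply Rmult_lt_0_compat; lra]|lra]. }
    destruct (Rpower_small a _ (proj1 Ha) Hq) as [d [Hd Hsmall]].
    set (r := Rmax 0 (t - d)).
    assert (Hr0 : 0 <= r) by apply Rmax_l. assert (Hrd : t - d <= r) by apply Rmax_r.
    assert (Hrt : r < t) by (apply Rmax_lub_lt; lra).
    assert (K : forall u v, r < u -> u <= v -> v < t ->
       norm (minus (intX (kf t g) 0 v) (intX (kf t g) 0 u)) < eps).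
    { intros u v Hru Huv Hvt.
      rewrite <- (intX_Chasles (kf t g) 0 u v) by (apply exX_kf; trivial; lra).
      norm_as (intX (kf t g) u v).
      eapply Rle_lt_trans; [apply (norm_intX_kf t g u v M); trivial|].
      + intros; apply HM; lra.
      + specialize (Hsmall (t - u) ltac:(lra) ltac:(lra)).
        assert (P := Rpower_gt0 (t - v) a).
        apply Rle_lt_trans with (M * (eps * (a * Gamma a) / (2 * M)) / (a * Gamma a)).
        * apply Rmult_le_compat_r; [apply Rlt_le, Rinv_0_lt_compat, Rmult_lt_0_compat; lra|].
          apply Rmult_le_compat_l; lra.
        * replace (M * (eps * (a * Gamma a) / (2 * M)) / (a * Gamma a)) with (eps / 2) by (field; lra). lra. }
    exists (fun ab => fst ab = 0 /\ r < snd ab < t). split.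
    + apply Filter_prod with (fun x => x = 0) (fun x => r < x < t).
      * reflexivity.
      * exists (mkposreal (t - r) ltac:(lra)). intros y Hy Hyt. split; [|exact Hyt].
        unfold ball in Hy; simpl in Hy. unfold AbsRing_ball, abs, minus, plus, opp in Hy; simpl in Hy.
        apply Rabs_def2 in Hy. lra.
      * simpl; tauto.
    + intros [x1 y1] [x2 y2] [A1 B1] [A2 B2]. simpl in *. subst x1 x2.
      apply (norm_compat1 (V := X)).
      change (norm (minus (intX (kf t g) 0 y2) (intX (kf t g) 0 y1)) < eps).
      destruct (Rle_dec y1 y2); [|rewrite norm_minus_sym]; apply K; lra.
  - exists l. exact (is_RInt_gen_lim (V := real_space X) _ _ (kf t g) l Hdom Hl).
Qed.

Lemma J_approaches t g : 0 < t -> ucont g -> approaches (intX (kf t g) 0) t (J a g t).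
Proof.
  intros Ht Hg e He.
  assert (H := is_RInt_gen_filterlim (V := real_space X) _ _ _ _ (is_J t g Ht Hg)).
  assert (H2 := proj1 (filterlim_locally_ball_norm (K := C_AbsRing) (U := X)
    (F := filter_prod (at_point 0) (at_left t)) _ _) H (mkposreal e He)).
  destruct H2 as [P Q HP [d HQ] H2]. exists d. split; [apply cond_pos|].
  intros s Hs1 Hs2. apply Rlt_le. apply (H2 0 s HP). apply HQ; [|exact Hs2].
  unfold ball; simpl. unfold AbsRing_ball, abs, minus, plus, opp; simpl. apply Rabs_def1; lra.
Qed.

Lemma J_eq t g l : 0 < t -> ucont g -> approaches (intX (kf t g) 0) t l -> J a g t = l.
Proof. intros Ht Hg. apply approaches_unique. now apply J_approaches. Qed.

Lemma J_nonpos t g : t <= 0 -> J a g t = zero.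
Proof. intros Ht. unfold J. destruct (Rlt_dec 0 t); [lra|reflexivity]. Qed.

(** Regularity is asked of [g] only, so [g'] may be a half-line datum with arbitrary values at
    negative times. *)
Lemma J_ext t g g' : ucont g -> (forall s, 0 <= s <= t -> g s = g' s) -> J a g t = J a g' t.
Proof.
  intros Hg H. destruct (Rlt_dec 0 t) as [Ht|Ht]; [|now rewrite !J_nonpos by lra].
  assert (K := is_J t g Ht Hg).
  unfold J at 2. destruct (Rlt_dec 0 t) as [_|]; [|lra]. symmetry.
  refine (is_RInt_gen_unique (V := real_space X) (Fa := at_point 0) (Fb := at_left t) _ _ _).
  refine (is_RInt_gen_ext (V := real_space X) (Fa := at_point 0) (Fb := at_left t) (kf t g) _ _ _ K).
  apply Filter_prod with (fun x => x = 0) (fun x => 0 < x < t).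
  - reflexivity.
  - exists (mkposreal t Ht). intros y Hy Hyt. split; [|exact Hyt].
    unfold ball in Hy; simpl in Hy. unfold AbsRing_ball, abs, minus, plus, opp in Hy; simpl in Hy.
    apply Rabs_def2 in Hy. lra.
  - intros x y -> Hy s Hs. simpl in Hs. rewrite Rmin_left, Rmax_right in Hs by lra.
    unfold kf. rewrite H by lra. reflexivity.
Qed.

Lemma approaches_plus F F' t l l' : approaches F t l -> approaches F' t l' ->
  approaches (fun s => plus (F s) (F' s)) t (plus l l').
Proof.
  intros H H' e He. destruct (H (e/2)) as [d [Hd H1]]; [lra|].
  destruct (H' (e/2)) as [d' [Hd' H2]]; [lra|]. exists (Rmin d d').
  split; [now apply Rmin_pos|]. intros s Hs1 Hs2.
  assert (Rmin d d' <= d) by apply Rmin_l. assert (Rmin d d' <= d') by apply Rmin_r.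
  norm_as (plus (minus (F s) l) (minus (F' s) l')).
  eapply Rle_trans; [apply norm_plus_le|].
  specialize (H1 s ltac:(lra) Hs2). specialize (H2 s ltac:(lra) Hs2). lra.
Qed.

Lemma approaches_linear (A : X -> X) F t l : is_linear A -> approaches F t l ->
  approaches (fun s => A (F s)) t (A l).
Proof.
  intros HA H e He. destruct (linear_norm A HA) as [K [HK Hn]].
  destruct (H (e / K)) as [d [Hd H1]]; [now apply Rdiv_lt_0_compat|].
  exists d. split; [exact Hd|]. intros s Hs1 Hs2. rewrite <- (is_linear_minus A HA).
  eapply Rle_trans; [apply Hn|]. replace e with (K * (e / K)) by (field; lra).
  apply Rmult_le_compat_l; [lra|now apply H1].
Qed.

Lemma approaches_ext F F' t l : (exists d, 0 < d /\ forall s, t - d < s -> s < t -> F s = F' s) ->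
  approaches F t l -> approaches F' t l.
Proof.
  intros [d [Hd HF]] H e He. destruct (H e He) as [d' [Hd' H1]]. exists (Rmin d d').
  split; [now apply Rmin_pos|]. intros s Hs1 Hs2.
  assert (Rmin d d' <= d) by apply Rmin_l. assert (Rmin d d' <= d') by apply Rmin_r.
  rewrite <- HF by lra. apply H1; lra.
Qed.

Lemma J_linear (A : X -> X) g t : is_linear A -> BU g -> J a (fun s => A (g s)) t = A (J a g t).
Proof.
  intros HA Hg. destruct (Rlt_dec 0 t) as [Ht|Ht].
  - apply J_eq; [exact Ht|apply (BU_linear A g HA Hg)|].
    apply (approaches_ext (fun s => A (intX (kf t g) 0 s))).
    + exists t. split; [exact Ht|]. intros s Hs1 Hs2. symmetry. apply isX_unique.
      apply (isX_ext (fun s => A (kf t g s))); [lra| |].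
      * intros r _. unfold kf. apply (linear_scal A HA).
      * apply isX_linear; [exact HA|]. apply exX_correct, exX_kf; [apply Hg|lra|lra].
    + apply approaches_linear; [exact HA|]. apply J_approaches; [exact Ht|apply Hg].
  - rewrite !J_nonpos by lra. transitivity (A (scal (RtoC 0) zero)).
    + rewrite (linear_scal A HA). symmetry. exact (scal_zero_l (A zero)).
    + apply f_equal. vring.
Qed.

Lemma J_vadd g g' t : BU g -> BU g' -> J a (vadd g g') t = plus (J a g t) (J a g' t).
Proof.
  intros Hg Hg'. destruct (Rlt_dec 0 t) as [Ht|Ht].
  - apply J_eq; [exact Ht|apply BU_vadd; assumption|].
    apply (approaches_ext (fun s => plus (intX (kf t g) 0 s) (intX (kf t g') 0 s))).
    + exists t. split; [exact Ht|]. intros s Hs1 Hs2. symmetry. apply isX_unique.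
      apply (isX_ext (fun s => plus (kf t g s) (kf t g' s))); [lra| |].
      * intros r _. unfold kf, vadd. vring.
      * apply isX_plus; apply exX_correct, exX_kf; [apply Hg|lra|lra|apply Hg'|lra|lra].
    + apply approaches_plus; apply J_approaches; [exact Ht|apply Hg|exact Ht|apply Hg'].
  - rewrite !J_nonpos by lra. vring.
Qed.

Lemma is_linear_scal_C (c : C) : is_linear (fun x : X => scal c x).
Proof.
  split.
  - intros x y. exact (scal_distr_l c x y).
  - intros k x. vring.
  - exists (Cmod c + 1). assert (H := Cmod_ge_0 c). split; [lra|]. intros x.
    eapply Rle_trans; [apply norm_scal_C|]. assert (0 <= norm x) by apply norm_ge_0. nra.
Qed.

Lemma J_vsc c g t : BU g -> J a (vsc c g) t = scal c (J a g t).
Proof. intros Hg. apply (J_linear (fun x => scal c x) g t); [apply is_linear_scal_C|exact Hg]. Qed.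

Lemma J_vsub g g' t : BU g -> BU g' -> J a (vsub g g') t = minus (J a g t) (J a g' t).
Proof.
  intros Hg Hg'. rewrite <- (J_ext t (vadd g (vsc (RtoC (-1)) g'))).
  - rewrite J_vadd, J_vsc by auto with BU. vring.
  - apply BU_vadd; auto with BU.
  - intros s _. unfold vadd, vsub, vsc. vring.
Qed.

Lemma approaches_norm_le F t l (b : R) : approaches F t l ->
  (exists d, 0 < d /\ forall s, t - d < s -> s < t -> norm (F s) <= b) -> norm l <= b.
Proof.
  intros H [d [Hd Hb]]. apply le_epsilon. intros e He.
  destruct (H e He) as [d' [Hd' H1]].
  assert (0 < Rmin d d') by now apply Rmin_pos.
  assert (Rmin d d' <= d) by apply Rmin_l. assert (Rmin d d' <= d') by apply Rmin_r.
  set (s := t - Rmin d d' / 2).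
  specialize (H1 s ltac:(unfold s; lra) ltac:(unfold s; lra)).
  specialize (Hb s ltac:(unfold s; lra) ltac:(unfold s; lra)).
  eapply Rle_trans; [apply (norm_le_minus l (F s))|]. rewrite (norm_minus_sym l). lra.
Qed.

Lemma J_bound g t M : 0 < t -> ucont g -> (forall s, 0 <= s <= t -> norm (g s) <= M) ->
  norm (J a g t) <= M * Rpower t a / (a * Gamma a).
Proof.
  intros Ht Hg HM. apply (approaches_norm_le _ t _ _ (J_approaches t g Ht Hg)).
  exists t. split; [exact Ht|]. intros s Hs1 Hs2.
  eapply Rle_trans; [apply (norm_intX_kf t g 0 s M); trivial; try lra|].
  - intros; apply HM; lra.
  - rewrite Rminus_0_r. assert (P := Rpower_gt0 (t - s) a).
    assert (0 <= M). { apply Rle_trans with (norm (g 0)); [apply norm_ge_0|apply HM; lra]. }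
    apply Rmult_le_compat_r; [apply Rlt_le, Rinv_0_lt_compat, Rmult_lt_0_compat; lra|].
    apply Rmult_le_compat_l; lra.
Qed.

End FractionalIntegral.

(** * Oscillatory integrals and the symbol of the fractional derivative *)

Ltac toR := match goal with |- @eq _ ?x ?y => change (@eq R x y) end.

Lemma cis_plus x y : cis (x + y) = (cis x * cis y)%C.
Proof. unfold cis. apply injective_projections; simpl; [rewrite cos_plus|rewrite sin_plus]; ring. Qed.

Lemma Cmod_cis x : Cmod (cis x) = 1.
Proof.
  unfold Cmod, cis; simpl. replace (cos x * (cos x * 1) + sin x * (sin x * 1)) with 1; [apply sqrt_1|].
  generalize (sin2_cos2 x). unfold Rsqr. lra.
Qed.

Lemma cis_0 : cis 0 = RtoC 1.
Proof. unfold cis. now rewrite cos_0, sin_0. Qed.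

Lemma cis_opp_mult x : (cis x * cis (- x))%C = RtoC 1.
Proof. rewrite <- cis_plus, Rplus_opp_r. apply cis_0. Qed.

Lemma cis_PI : cis PI = RtoC (-1).
Proof. unfold cis. now rewrite cos_PI, sin_PI. Qed.

Lemma cis_2PI_INR n : cis (2 * PI * INR n) = RtoC 1.
Proof.
  induction n as [|n IH]; [simpl; rewrite Rmult_0_r; apply cis_0|].
  rewrite S_INR. replace (2 * PI * (INR n + 1)) with (2 * PI * INR n + (PI + PI)) by ring.
  rewrite !cis_plus, IH, cis_PI. apply injective_projections; simpl; ring.
Qed.

Lemma Cmod_le_sum u v : Cmod (u, v) <= Rabs u + Rabs v.
Proof.
  replace ((u, v) : C) with (Cplus (RtoC u) (Cmult (RtoC v) (0, 1)))
    by (apply injective_projections; simpl; ring).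
  eapply Rle_trans; [apply Cmod_triangle|]. rewrite Cmod_mult, !Cmod_R.
  replace (Cmod (0, 1)) with 1; [lra|].
  unfold Cmod; simpl. replace (0 * (0 * 1) + 1 * (1 * 1)) with 1 by ring. symmetry; apply sqrt_1.
Qed.

Lemma cos_lip x y : Rabs (cos x - cos y) <= Rabs (x - y).
Proof.
  destruct (MVT_gen cos y x (fun z => - sin z)) as [z [_ E]].
  - intros z _. auto_derive; [trivial|ring].
  - intros z _. apply continuity_cos.
  - rewrite E, Rabs_mult, Rabs_Ropp. assert (Rabs (sin z) <= 1) by apply Rabs_le, SIN_bound.
    assert (0 <= Rabs (x - y)) by apply Rabs_pos. nra.
Qed.

Lemma sin_lip x y : Rabs (sin x - sin y) <= Rabs (x - y).
Proof.
  destruct (MVT_gen sin y x (fun z => cos z)) as [z [_ E]].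
  - intros z _. auto_derive; [trivial|ring].
  - intros z _. apply continuity_sin.
  - rewrite E, Rabs_mult. assert (Rabs (cos z) <= 1) by apply Rabs_le, COS_bound.
    assert (0 <= Rabs (x - y)) by apply Rabs_pos. nra.
Qed.

Lemma cis_lip x y : Cmod (cis x - cis y) <= 2 * Rabs (x - y).
Proof.
  unfold cis, Cminus, Cplus, Copp; simpl. eapply Rle_trans; [apply Cmod_le_sum|].
  generalize (cos_lip x y) (sin_lip x y). unfold Rminus. lra.
Qed.

Lemma is_RInt_reflect (f : R -> R) t s l :
  is_RInt f (t - s) t l -> is_RInt (fun r => f (t - r)) 0 s l.
Proof.
  intros H. apply (is_RInt_swap (V := R_NormedModule)) in H.
  assert (K := is_RInt_comp_lin (V := R_NormedModule) f (-1) t 0 s (opp l)).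
  replace (-1 * 0 + t) with t in K by ring. replace (-1 * s + t) with (t - s) in K by ring.
  specialize (K H). apply (is_RInt_opp (V := R_NormedModule)) in K. rewrite opp_opp in K.
  eapply (is_RInt_ext (V := R_NormedModule)); [|exact K]. intros x _.
  unfold scal, opp; simpl; unfold mult; simpl.
  replace (-1 * x + t) with (t - x) by ring. ring.
Qed.

Definition isgn (eta : R) : R := if Rle_dec 0 eta then 1 else -1.

Section Oscillation.
Variable a : R.
Hypothesis Ha : 0 < a <= 1.
Variable eta : R.
Hypothesis Heta : eta <> 0.

Lemma isgn_abs : eta = isgn eta * Rabs eta.
Proof.
  unfold isgn. destruct (Rle_dec 0 eta); [rewrite Rabs_pos_eq by lra|rewrite Rabs_left by lra]; ring.
Qed.
Lemma isgn_cos s : cos (eta * s) = cos (Rabs eta * s).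
Proof.
  rewrite isgn_abs at 1. unfold isgn. destruct (Rle_dec 0 eta); [f_equal; ring|].
  rewrite <- cos_neg. f_equal; ring.
Qed.
Lemma isgn_sin s : sin (eta * s) = isgn eta * sin (Rabs eta * s).
Proof.
  rewrite isgn_abs at 1. unfold isgn. destruct (Rle_dec 0 eta); [rewrite Rmult_1_l; f_equal; ring|].
  replace (-1 * Rabs eta * s) with (- (Rabs eta * s)) by ring. rewrite sin_neg; ring.
Qed.
Lemma isgn_Rabs : Rabs (isgn eta) = 1.
Proof. unfold isgn. destruct (Rle_dec 0 eta); [apply Rabs_R1|rewrite Rabs_left; lra]. Qed.

Definition Ic (e T : R) : R := RInt (fun s => Rpower s (a - 1) * cos (eta * s)) e T.
Definition Is (e T : R) : R := RInt (fun s => Rpower s (a - 1) * sin (eta * s)) e T.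

Lemma continuous_cos_mult s : continuous (fun s => cos (eta * s)) s.
Proof. apply (ex_derive_continuous (fun s => cos (eta * s))). auto_derive; trivial. Qed.
Lemma continuous_sin_mult s : continuous (fun s => sin (eta * s)) s.
Proof. apply (ex_derive_continuous (fun s => sin (eta * s))). auto_derive; trivial. Qed.

Lemma Ic_correct e T : 0 < e -> e <= T ->
  is_RInt (fun s => Rpower s (a - 1) * cos (eta * s)) e T (Ic e T).
Proof.
  intros. apply (RInt_correct (V := R_CompleteNormedModule)).
  apply (ex_RInt_Rpower_mult a (fun s => cos (eta * s))); trivial. apply continuous_cos_mult.
Qed.
Lemma Is_correct e T : 0 < e -> e <= T ->
  is_RInt (fun s => Rpower s (a - 1) * sin (eta * s)) e T (Is e T).
Proof.
  intros. apply (RInt_correct (V := R_CompleteNormedModule)).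
  apply (ex_RInt_Rpower_mult a (fun s => sin (eta * s))); trivial. apply continuous_sin_mult.
Qed.

(** The increment length used for frequency eta: e^{- i eta h} = -1, so z(t) - z(t - h) is about 2
    z(t) for z close to the exponential. *)
Definition halfperiod : R := PI / Rabs eta.
Lemma halfperiod_pos : 0 < halfperiod.
Proof. apply Rdiv_lt_0_compat; [apply PI_RGT_0|now apply Rabs_pos_lt]. Qed.

Lemma cis_halfperiod t : cis (eta * (t - halfperiod)) = (RtoC (-1) * cis (eta * t))%C.
Proof.
  unfold cis. rewrite !isgn_cos, !isgn_sin.
  assert (Rabs eta <> 0) by now apply Rabs_no_R0.
  replace (Rabs eta * (t - halfperiod)) with (Rabs eta * t - PI) by (unfold halfperiod; field; trivial).
  rewrite cos_minus, sin_minus, cos_PI, sin_PI.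
  apply injective_projections; simpl; ring.
Qed.

Definition osc_c : R := Gamma a * (Rpower (Rabs eta) (- a) * cos (a * (PI / 2))).
Definition osc_s : R := Gamma a * (Rpower (Rabs eta) (- a) * (isgn eta * sin (a * (PI / 2)))).

Lemma osc_limit eps : a < 1 -> 0 < eps -> exists d S, 0 < d <= S /\
  forall e T, 0 < e <= d -> S <= T -> Rabs (Ic e T - osc_c) <= eps /\ Rabs (Is e T - osc_s) <= eps.
Proof.
  intros Ha1 He.
  destruct (osc_limit_pos a Ha (Rabs eta) eps Ha1 (Rabs_pos_lt _ Heta) He) as [d [S [HdS H]]].
  exists d, S. split; [exact HdS|]. intros e T He' HT. destruct (H e T He' HT) as [H1 H2].
  split.
  - unfold Ic, osc_c. erewrite RInt_ext; [exact H1|]. intros x _. simpl. now rewrite isgn_cos.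
  - unfold Is, osc_s.
    replace (RInt (fun s => Rpower s (a - 1) * sin (eta * s)) e T)
      with (isgn eta * RInt (fun s => Rpower s (a - 1) * sin (Rabs eta * s)) e T).
    + match goal with |- Rabs (?s * ?i - ?g * (?p * (?s * ?z))) <= _ =>
        replace (s * i - g * (p * (s * z))) with (s * (i - g * (p * z))) by ring end.
      rewrite Rabs_mult, isgn_Rabs, Rmult_1_l. exact H2.
    + symmetry. rewrite (RInt_ext (V := R_CompleteNormedModule) _ (fun s => scal (isgn eta) (Rpower s (a - 1) * sin (Rabs eta * s)))).
      * apply (RInt_scal (V := R_CompleteNormedModule)).
        apply (ex_RInt_Rpower_mult a (fun s => sin (Rabs eta * s))); [lra|lra|].
        intros s. apply (ex_derive_continuous (fun s => sin (Rabs eta * s))). auto_derive; trivial.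
      * intros x _. unfold scal; simpl; unfold mult; simpl. rewrite isgn_sin. ring.
Qed.

Lemma Gamma_1 : Gamma 1 = 1.
Proof.
  assert (K : forall e T, 0 < e <= 1 -> 1 <= T -> Rabs (Gamma 1 - 1) <= 2 * e + 2 * exp (- T)).
  { intros e T He HT. assert (G := Gamma_approx 1 ltac:(lra) e T He HT).
    rewrite Rpower_1 in G by lra.
    assert (E : is_RInt (gint 1) e T (minus (- exp (- T)) (- exp (- e)))).
    { apply (is_RInt_ext (V := R_NormedModule) (fun s => exp (- s))).
      - intros x Hx. rewrite Rmin_left in Hx by lra. unfold gint.
        replace (1 - 1) with 0 by ring. rewrite Rpower_O by lra. toR; ring.
      - apply (is_RInt_derive (V := R_CompleteNormedModule) (fun s => - exp (- s))).
        + intros x _. auto_derive; [trivial|ring].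
        + intros x _. apply (ex_derive_continuous (fun s => exp (- s))). auto_derive; trivial. }
    rewrite (is_RInt_unique (V := R_CompleteNormedModule) _ _ _ _ E) in G.
    unfold minus, plus, opp in G; simpl in G.
    assert (1 - e <= exp (- e)) by (generalize (exp_ineq1_le (- e)); lra).
    assert (exp (- e) <= 1) by (rewrite <- exp_0; apply exp_le_compat; lra).
    apply Rabs_le. generalize (exp_pos (- T)). lra. }
  apply Rminus_diag_uniq. destruct (Req_dec (Gamma 1 - 1) 0) as [|Hne]; [assumption|exfalso].
  apply Rabs_pos_lt in Hne. set (r := Rabs (Gamma 1 - 1)) in *.
  destruct (exp_opp_small (r / 8)) as [T [HT H]]; [lra|].
  set (e := Rmin 1 (r / 8)). assert (0 < e) by (apply Rmin_pos; lra).
  assert (e <= 1) by apply Rmin_l. assert (e <= r / 8) by apply Rmin_r.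
  specialize (K e T ltac:(lra) HT). fold r in K. lra.
Qed.

(** For a < 1 each integral converges by itself. For a = 1 neither does, but the oscillating terms
    at the upper limits t and t - [halfperiod] are opposite and cancel in the sum. *)
Lemma osc_pair eps : 0 < eps -> exists d S, 0 < d <= S /\
  forall e t, 0 < e <= d -> S <= t - halfperiod ->
  Rabs (Ic e t + Ic e (t - halfperiod) - 2 * osc_c) <= eps /\
  Rabs (Is e t + Is e (t - halfperiod) - 2 * osc_s) <= eps.
Proof.
  intros Heps. assert (Hh := halfperiod_pos).
  destruct (Rle_lt_or_eq_dec _ _ (proj2 Ha)) as [H1|H1].
  - destruct (osc_limit (eps / 2) H1 ltac:(lra)) as [d [S [HdS H]]].
    exists d, S. split; [exact HdS|]. intros e t He Ht.
    destruct (H e t He ltac:(lra)) as [A1 A2]. destruct (H e (t - halfperiod) He Ht) as [B1 B2].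
    apply Rabs_le_between in A1, A2, B1, B2. split; apply Rabs_le; lra.
  - assert (EIc : forall e T, 0 < e -> e <= T -> Ic e T = (sin (eta * T) - sin (eta * e)) / eta).
    { intros e T He HT. apply (is_RInt_unique (V := R_CompleteNormedModule)).
      replace ((sin (eta * T) - sin (eta * e)) / eta) with (minus (sin (eta * T) / eta) (sin (eta * e) / eta))
        by (unfold minus, plus, opp; simpl; field; exact Heta).
      apply (is_RInt_ext (V := R_NormedModule) (fun s => cos (eta * s))).
      - intros x Hx. rewrite Rmin_left in Hx by lra.
        rewrite H1. replace (1 - 1) with 0 by ring. rewrite Rpower_O by lra. toR; ring.
      - apply (is_RInt_derive (V := R_CompleteNormedModule) (fun s => sin (eta * s) / eta)).
        + intros x _. auto_derive; [trivial|field; exact Heta].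
        + intros x _. apply continuous_cos_mult. }
    assert (EIs : forall e T, 0 < e -> e <= T -> Is e T = (cos (eta * e) - cos (eta * T)) / eta).
    { intros e T He HT. apply (is_RInt_unique (V := R_CompleteNormedModule)).
      replace ((cos (eta * e) - cos (eta * T)) / eta) with (minus (- cos (eta * T) / eta) (- cos (eta * e) / eta))
        by (unfold minus, plus, opp; simpl; field; exact Heta).
      apply (is_RInt_ext (V := R_NormedModule) (fun s => sin (eta * s))).
      - intros x Hx. rewrite Rmin_left in Hx by lra.
        rewrite H1. replace (1 - 1) with 0 by ring. rewrite Rpower_O by lra. toR; ring.
      - apply (is_RInt_derive (V := R_CompleteNormedModule) (fun s => - cos (eta * s) / eta)).
        + intros x _. auto_derive; [trivial|field; exact Heta].
        + intros x _. apply continuous_sin_mult. }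
    (* After the cancellation only the lower limit contributes, at most 2 e in absolute value. *)
    exists (eps / 2), (eps / 2). split; [lra|]. intros e t He Ht.
    rewrite !EIc, !EIs by lra.
    assert (C := cis_halfperiod t). unfold cis in C. injection C as C1 C2.
    ring_simplify in C1. ring_simplify in C2.
    assert (P1 : Rpower (Rabs eta) (- a) = / Rabs eta).
    { rewrite H1, Rpower_Ropp, Rpower_1; [reflexivity|now apply Rabs_pos_lt]. }
    assert (Hab : Rabs eta <> 0) by now apply Rabs_no_R0.
    assert (Hap : 0 < Rabs eta) by now apply Rabs_pos_lt.
    unfold osc_c, osc_s. rewrite P1, H1, Gamma_1, !(Rmult_1_l (PI / 2)), cos_PI2, sin_PI2.
    split.
    + match goal with |- Rabs ?z <= _ => replace z with (- (2 * (sin (eta * e) / eta))) end.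
      2:{ rewrite C2. field; split; assumption. }
      rewrite Rabs_Ropp, Rabs_mult, (Rabs_pos_eq 2) by lra. unfold Rdiv. rewrite Rabs_mult, Rabs_inv.
      assert (Rabs (sin (eta * e)) <= Rabs eta * e).
      { generalize (sin_lip (eta * e) 0). rewrite sin_0, !Rminus_0_r, Rabs_mult, (Rabs_pos_eq e); lra. }
      apply Rle_trans with (2 * (Rabs eta * e * / Rabs eta)).
      * apply Rmult_le_compat_l; [lra|]. apply Rmult_le_compat_r; [apply Rlt_le, Rinv_0_lt_compat; lra|lra].
      * field_simplify; [lra|assumption].
    + match goal with |- Rabs ?z <= _ => replace z with (2 * ((cos (eta * e) - cos 0) / eta)) end.
      2:{ rewrite C1, cos_0.
          assert (Hs : / Rabs eta * (isgn eta * 1) = / eta).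
          { rewrite (isgn_abs) at 3. unfold isgn. destruct (Rle_dec 0 eta); field; lra. }
          rewrite Hs. field; assumption. }
      rewrite Rabs_mult, (Rabs_pos_eq 2) by lra. unfold Rdiv. rewrite Rabs_mult, Rabs_inv.
      assert (Rabs (cos (eta * e) - cos 0) <= Rabs eta * e).
      { generalize (cos_lip (eta * e) 0). rewrite !Rminus_0_r, Rabs_mult, (Rabs_pos_eq e); lra. }
      apply Rle_trans with (2 * (Rabs eta * e * / Rabs eta)).
      * apply Rmult_le_compat_l; [lra|]. apply Rmult_le_compat_r; [apply Rlt_le, Rinv_0_lt_compat; lra|lra].
      * field_simplify; [lra|assumption].
Qed.

(** This is (i eta)^(-a): modulus |eta|^(-a) and argument - a PI/2 times the sign of eta. *)
Definition symbol_inv : C :=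
  (Rpower (Rabs eta) (- a) * cos (a * (PI / 2)),
   - (Rpower (Rabs eta) (- a) * (isgn eta * sin (a * (PI / 2))))).

Lemma symbol_inv_Cpower : (symbol_inv * Cpower (0, eta) a)%C = RtoC 1.
Proof.
  assert (Hm : Cmod (0, eta) = Rabs eta).
  { unfold Cmod; simpl. replace (0 * (0 * 1) + eta * (eta * 1)) with (Rsqr eta) by (unfold Rsqr; ring).
    apply sqrt_Rsqr_abs. }
  assert (Hap : 0 < Rabs eta) by now apply Rabs_pos_lt.
  unfold Cpower. rewrite Hm. destruct (Req_EM_T (Rabs eta) 0) as [E|_]; [lra|].
  assert (Hg : Carg (0, eta) = isgn eta * (PI / 2)).
  { unfold Carg, isgn; simpl. rewrite Hm. replace (0 / Rabs eta) with 0 by (field; lra). rewrite acos_0.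
    destruct (Rle_dec 0 eta); ring. }
  rewrite Hg. unfold cis, symbol_inv.
  replace (a * (isgn eta * (PI / 2))) with (isgn eta * (a * (PI / 2))) by ring.
  assert (Hcs : cos (isgn eta * (a * (PI / 2))) = cos (a * (PI / 2)) /\
                sin (isgn eta * (a * (PI / 2))) = isgn eta * sin (a * (PI / 2)) /\ isgn eta * isgn eta = 1).
  { unfold isgn. destruct (Rle_dec 0 eta).
    - rewrite !Rmult_1_l. repeat split.
    - replace (-1 * (a * (PI / 2))) with (- (a * (PI / 2))) by ring.
      rewrite cos_neg, sin_neg. repeat split; ring. }
  destruct Hcs as [-> [-> Hs]].
  assert (Hp : Rpower (Rabs eta) (- a) * Rpower (Rabs eta) a = 1).
  { rewrite <- Rpower_plus. replace (- a + a) with 0 by ring. now apply Rpower_O. }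
  set (p := Rpower (Rabs eta) (- a)) in *. set (q := Rpower (Rabs eta) a) in *.
  assert (T := sin2_cos2 (a * (PI / 2))). unfold Rsqr in T.
  apply injective_projections; simpl; [|ring].
  transitivity ((p * q) * (isgn eta * isgn eta * (sin (a * (PI / 2)) * sin (a * (PI / 2))) + cos (a * (PI / 2)) * cos (a * (PI / 2)))); [ring|].
  rewrite Hp, Hs, Rmult_1_l, Rmult_1_l. exact T.
Qed.

End Oscillation.

(** * Increments of the fractional integral *)

Ltac norm_as_by B tac :=
  match goal with
  | |- context [@norm C_AbsRing ?V ?u] =>
    let H := fresh in
    assert (H : @norm C_AbsRing V u = @norm C_AbsRing V B) by (apply f_equal; v_prep; tac);
    rewrite H; clear H
  end.

Section Increments.
Context {X : CompleteNormedModule C_AbsRing}.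
Variable a : R.
Hypothesis Ha : 0 < a <= 1.
Implicit Types g : R -> X.

Let G0 : 0 < Gamma a := Gamma_gt0 a Ha.
Let aG0 : 0 < a * Gamma a := Rmult_lt_0_compat _ _ (proj1 Ha) G0.

Lemma approaches_minus (F F' : R -> X) t l l' : approaches F t l -> approaches F' t l' ->
  approaches (fun s => minus (F s) (F' s)) t (minus l l').
Proof.
  intros H H'. replace (minus l l') with (plus l (scal (RtoC (-1)) l')) by vring.
  apply (approaches_ext (fun s => plus (F s) (scal (RtoC (-1)) (F' s)))).
  - exists 1. split; [lra|]. intros s _ _. vring.
  - apply approaches_plus; [exact H|].
    apply (approaches_linear (fun x : X => scal (RtoC (-1)) x)); [apply is_linear_scal_C|exact H'].
Qed.

Lemma approaches_translate (F : R -> X) t h l : approaches F t l -> approaches (fun s => F (s - h)) (t + h) l.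
Proof.
  intros H e He. destruct (H e He) as [d [Hd H1]]. exists d. split; [exact Hd|].
  intros s H2 H3. apply H1; lra.
Qed.

Definition jinc (h : R) g (t : R) : X := minus (J a g t) (J a g (t - h)).

Lemma jinc_approaches h g t : 0 < h -> h < t -> ucont g ->
  approaches (fun s => minus (intX (kf a t g) 0 s) (intX (kf a (t - h) g) 0 (s - h))) t (jinc h g t).
Proof.
  intros Hh Ht Hg. apply approaches_minus.
  - apply J_approaches; trivial; lra.
  - assert (K := J_approaches a Ha (t - h) g ltac:(lra) Hg).
    apply (approaches_translate _ _ h) in K. replace (t - h + h) with t in K by ring. exact K.
Qed.

(** The kernel is decreasing in the lag, so the difference of the two kernels has constant sign and
    its mass is a difference of two values of [dif]. *)
Lemma kernel_increment h g t u v M : 0 < h -> ucont g -> u <= v -> v < t - h ->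
  (forall s, u <= s <= v -> norm (g s) <= M) ->
  norm (minus (intX (kf a t g) u v) (intX (kf a (t - h) g) u v)) <=
  M * (dif a h (t - v) - dif a h (t - u)) / (a * Gamma a).
Proof.
  intros Hh Hg Huv Hv HM.
  assert (X1 := exX_correct _ _ _ (exX_kf a t g u v Hg Huv ltac:(lra))).
  assert (X2 := exX_correct _ _ _ (exX_kf a (t - h) g u v Hg Huv Hv)).
  assert (X3 := isX_minus _ _ _ _ _ _ X1 X2).
  apply (norm_isX_le _ (fun s => minus (Rpower (t - h - s) (a - 1) / Gamma a * M) (Rpower (t - s) (a - 1) / Gamma a * M))
    _ _ _ _ Huv) with (2 := X3).
  - intros s Hs. unfold kf.
    norm_as (scal (RtoC (Rpower (t - s) (a - 1) / Gamma a) - RtoC (Rpower (t - h - s) (a - 1) / Gamma a))%C (g s)).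
    eapply Rle_trans; [apply norm_scal_C|]. rewrite <- RtoC_minus, Cmod_R, Rabs_minus_sym.
    assert (Rpower (t - s) (a - 1) <= Rpower (t - h - s) (a - 1)) by (apply Rpower_le_decr; lra).
    assert (Hi := Rinv_0_lt_compat _ G0).
    rewrite Rabs_pos_eq by (unfold Rdiv; nra).
    unfold minus, plus, opp; simpl.
    replace (Rpower (t - h - s) (a - 1) / Gamma a * M + - (Rpower (t - s) (a - 1) / Gamma a * M))
      with ((Rpower (t - h - s) (a - 1) / Gamma a - Rpower (t - s) (a - 1) / Gamma a) * M) by ring.
    apply Rmult_le_compat_l; [unfold Rdiv; nra|now apply HM].
  - replace (M * (dif a h (t - v) - dif a h (t - u)) / (a * Gamma a)) with
      (minus (M * (Rpower (t - h - u) a - Rpower (t - h - v) a) / (a * Gamma a))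
             (M * (Rpower (t - u) a - Rpower (t - v) a) / (a * Gamma a))).
    + apply (is_RInt_minus (V := R_NormedModule)); apply is_RInt_kf; trivial; lra.
    + unfold minus, plus, opp, dif; simpl.
      replace (t - v - h) with (t - h - v) by ring. replace (t - u - h) with (t - h - u) by ring.
      field; lra.
Qed.

(* The increment is controlled by the recent past of g, on [S, t]; what happens on
   [T0, S] and [0, T0] enters through decrements of [dif], which are small for long
   time lags. *)
Lemma jinc_bound h g t T0 S M m1 m2 : 0 < h -> ucont g -> 0 <= T0 -> T0 <= S -> S < t - h ->
  (forall s, 0 <= s <= T0 -> norm (g s) <= M) ->
  (forall s, T0 <= s <= S -> norm (g s) <= m1) ->
  (forall s, S <= s <= t -> norm (g s) <= m2) ->
  norm (jinc h g t) <= (M * (dif a h (t - T0) - dif a h t) + m1 * (dif a h (t - S) - dif a h (t - T0))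
    + m2 * (2 * Rpower h a)) / (a * Gamma a).
Proof.
  intros Hh Hg H0 H1 HS B0 B1 B2.
  apply (approaches_norm_le _ t _ _ (jinc_approaches h g t Hh ltac:(lra) Hg)).
  exists (t - h - S). split; [lra|]. intros s Hs1 Hs2.
  assert (E : forall t', s - h < t' -> intX (kf a t' g) 0 (s - h) =
     plus (plus (intX (kf a t' g) 0 T0) (intX (kf a t' g) T0 S)) (intX (kf a t' g) S (s - h))).
  { intros t' Ht'. rewrite !intX_Chasles; trivial; apply exX_kf; trivial; lra. }
  rewrite <- (intX_Chasles (kf a t g) 0 (s - h) s) by (apply exX_kf; trivial; lra).
  rewrite (E t), (E (t - h)) by lra.
  norm_as (plus (plus (minus (intX (kf a t g) 0 T0) (intX (kf a (t - h) g) 0 T0))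
                (minus (intX (kf a t g) T0 S) (intX (kf a (t - h) g) T0 S)))
          (plus (minus (intX (kf a t g) S (s - h)) (intX (kf a (t - h) g) S (s - h)))
                (intX (kf a t g) (s - h) s))).
  assert (I0 := kernel_increment h g t 0 T0 M Hh Hg H0 ltac:(lra) B0).
  assert (I1 := kernel_increment h g t T0 S m1 Hh Hg H1 ltac:(lra) B1).
  assert (I2 := kernel_increment h g t S (s - h) m2 Hh Hg ltac:(lra) ltac:(lra) ltac:(intros; apply B2; lra)).
  assert (I3 := norm_intX_kf a Ha t g (s - h) s m2 Hg ltac:(lra) Hs2 ltac:(intros; apply B2; lra)).
  rewrite Rminus_0_r in I0.
  replace (Rpower (t - (s - h)) a - Rpower (t - s) a) with (dif a h (t - (s - h))) in I3
    by (unfold dif; f_equal; f_equal; ring).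
  (* This bound h^a is used twice, for the kernel difference on [S, s - h] and for the window
     [s - h, s]; hence the 2 h^a of the statement. *)
  assert (D1 := dif_le a Ha h (t - (s - h)) Hh ltac:(lra)).
  assert (D2 := dif_ge0 a Ha h (t - S) Hh ltac:(lra)).
  assert (Hm2 : 0 <= m2) by (apply Rle_trans with (norm (g t)); [apply norm_ge_0|apply B2; lra]).
  eapply Rle_trans; [apply norm_plus_le|]. eapply Rle_trans; [apply Rplus_le_compat; apply norm_plus_le|].
  assert (Hi := Rinv_0_lt_compat _ aG0).
  apply Rle_trans with (M * (dif a h (t - T0) - dif a h t) / (a * Gamma a)
    + m1 * (dif a h (t - S) - dif a h (t - T0)) / (a * Gamma a)
    + (m2 * (dif a h (t - (s - h)) - dif a h (t - S)) / (a * Gamma a)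
    + m2 * dif a h (t - (s - h)) / (a * Gamma a))); [lra|].
  unfold Rdiv. rewrite <- !Rmult_plus_distr_r. apply Rmult_le_compat_r; [lra|]. nra.
Qed.

(** Translation and [J] commute up to the memory of the initial segment [0, r]. *)
Lemma J_shift_eq g r t : 0 <= r -> 0 < t -> ucont g ->
  J a g (t + r) = plus (intX (kf a (t + r) g) 0 r) (J a (shift r g) t).
Proof.
  intros Hr Ht Hg.
  assert (Hg' : ucont (shift r g)).
  { intros e He. destruct (Hg e He) as [d [Hd H]]. exists d. split; [exact Hd|].
    intros s s' Hs. apply H. replace (s' + r - (s + r)) with (s' - s) by ring. exact Hs. }
  apply J_eq; [exact Ha|lra|exact Hg|].
  apply (approaches_ext (fun s => plus (intX (kf a (t + r) g) 0 r) (intX (kf a t (shift r g)) 0 (s - r)))).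
  - exists t. split; [exact Ht|]. intros s Hs1 Hs2.
    rewrite <- (intX_Chasles (kf a (t + r) g) 0 r s) by (apply exX_kf; trivial; lra).
    apply f_equal. apply isX_unique.
    apply (isX_ext (fun s => kf a (t + r) g (s + r))); [lra| |].
    + intros x _. unfold kf, shift. replace (t + r - (x + r)) with (t - x) by ring. reflexivity.
    + apply isX_shift. replace (0 + r) with r by ring. replace (s - r + r) with s by ring.
      apply exX_correct, exX_kf; trivial; lra.
  - apply approaches_plus.
    + intros e He. exists 1. split; [lra|]. intros s _ _.
      norm_as (zero : X). rewrite norm_zero_C. lra.
    + apply approaches_translate. now apply J_approaches.
Qed.

Section Exponential.
Variable eta : R.
Hypothesis Heta : eta <> 0.
Let h := halfperiod eta.

Definition expo (x : X) (s : R) : X := scal (cis (eta * s)) x.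

Lemma BU_expo x : BU (expo x).
Proof.
  split.
  - exists (norm x). intros t. unfold expo. eapply Rle_trans; [apply norm_scal_C|].
    rewrite Cmod_cis. lra.
  - intros e He. assert (Hn := norm_ge_0 x). assert (Hp := Rabs_pos eta).
    assert (0 <= 2 * Rabs eta * norm x) by nra.
    exists (e / (2 * Rabs eta * norm x + 1)). split; [apply Rdiv_lt_0_compat; lra|].
    intros s t Hst. unfold expo.
    norm_as (scal (cis (eta * t) - cis (eta * s))%C x).
    eapply Rle_lt_trans; [apply norm_scal_C|].
    assert (L := cis_lip (eta * t) (eta * s)).
    replace (eta * t - eta * s) with (eta * (t - s)) in L by ring. rewrite Rabs_mult in L.
    apply Rle_lt_trans with ((2 * Rabs eta * norm x) * Rabs (t - s)).
    + apply Rle_trans with (2 * (Rabs eta * Rabs (t - s)) * norm x); [|lra].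
      apply Rmult_le_compat_r; lra.
    + assert (Hq := Rabs_pos (t - s)).
      apply Rle_lt_trans with ((2 * Rabs eta * norm x + 1) * Rabs (t - s)); [nra|].
      apply (Rmult_lt_compat_l (2 * Rabs eta * norm x + 1)) in Hst; [|lra].
      replace ((2 * Rabs eta * norm x + 1) * (e / (2 * Rabs eta * norm x + 1))) with e in Hst by (field; lra).
      exact Hst.
Qed.

Lemma isX_scal_vector (f : R -> R) u v l (x : X) : is_RInt f u v l ->
  isX (fun s => scal (RtoC (f s)) x) u v (scal (RtoC l) x).
Proof.
  intros H. apply (filterlim_ext (fun ptd => @scal _ (real_space X) (@scal _ R_NormedModule (sign (v - u)) (Riemann_sum f ptd)) x)).
  - intros ptd.
    transitivity (@scal _ (real_space X) (sign (v - u)) (@scal _ (real_space X) (Riemann_sum f ptd) x)).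
    { symmetry. exact (scal_assoc (V := real_space X) _ _ x). }
    apply f_equal. pattern ptd. apply SF_cons_ind; clear ptd.
    + intros x0. exact (scal_zero_l (V := real_space X) x).
    + intros p s IH. rewrite !Riemann_sum_cons, <- IH.
      transitivity (@plus (real_space X)
        (@scal _ (real_space X) (@scal _ R_NormedModule (SF_h s - fst p) (f (snd p))) x)
        (@scal _ (real_space X) (Riemann_sum f s) x)).
      { exact (scal_distr_r (V := real_space X) _ _ x). }
      apply (f_equal (fun y => @plus (real_space X) y _)).
      symmetry. exact (scal_assoc (V := real_space X) _ _ x).
  - apply (filterlim_comp _ _ _ (fun ptd => @scal _ R_NormedModule (sign (v - u)) (Riemann_sum f ptd))
      (fun c : R => @scal _ (real_space X) c x) _ (locally (T := R_UniformSpace) l)); [exact H|].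
    exact (filterlim_scal_l (V := real_space X) l x).
Qed.

Lemma intX_expo x t s : 0 < s -> s < t ->
  intX (kf a t (expo x)) 0 s =
  scal (cis (eta * t) * ((Ic a eta (t - s) t / Gamma a)%R, (- (Is a eta (t - s) t / Gamma a))%R))%C x.
Proof.
  intros Hs Hst. apply isX_unique.
  assert (C1 := is_RInt_reflect _ _ _ _ (Ic_correct a eta (t - s) t ltac:(lra) ltac:(lra))).
  assert (S1 := is_RInt_reflect _ _ _ _ (Is_correct a eta (t - s) t ltac:(lra) ltac:(lra))).
  apply (isX_scal_vector _ _ _ _ (scal (cis (eta * t) * RtoC (/ Gamma a))%C x)) in C1.
  apply (isX_scal_vector _ _ _ _ (scal (cis (eta * t) * (0%R, (- / Gamma a)%R))%C x)) in S1.
  assert (K := isX_plus _ _ _ _ _ _ C1 S1).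
  replace (scal (cis (eta * t) * ((Ic a eta (t - s) t / Gamma a)%R, (- (Is a eta (t - s) t / Gamma a))%R))%C x)
    with (plus (scal (RtoC (Ic a eta (t - s) t)) (scal (cis (eta * t) * RtoC (/ Gamma a))%C x))
               (scal (RtoC (Is a eta (t - s) t)) (scal (cis (eta * t) * (0%R, (- / Gamma a)%R))%C x))).
  2:{ v_prep. apply injective_projections; simpl; unfold Rdiv; ring. }
  apply isX_ext with (3 := K); [lra|]. intros r Hr. unfold kf, expo.
  v_prep.
  replace (eta * r) with (eta * t + - (eta * (t - r))) by ring. rewrite cis_plus.
  apply injective_projections; simpl; rewrite cos_neg, sin_neg; unfold Rdiv; ring.
Qed.

(** The lag substitution turns the increment into the integrals of [osc_pair]; shifting by half a
    period flips the sign of the second one, which gives the factor 2. Uniformity in x matters,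
    because [near_eigenvector] fits a new exponential at every time t. *)
Lemma jinc_expo_lim eps : 0 < eps -> exists T, h < T /\ forall t x, T <= t ->
  norm (minus (jinc h (expo x) t) (scal (RtoC 2 * symbol_inv a eta * cis (eta * t))%C x)) <= eps * norm x.
Proof.
  intros He. assert (Hh : 0 < h) by now apply halfperiod_pos.
  destruct (osc_pair a Ha eta Heta (eps * Gamma a / 2)) as [d [S [HdS HP]]].
  { apply Rdiv_lt_0_compat; [apply Rmult_lt_0_compat; trivial|lra]. }
  exists (S + h). split; [lra|]. intros t x Ht.
  assert (A := jinc_approaches h (expo x) t Hh ltac:(lra) (proj2 (BU_expo x))).
  assert (A2 : approaches (fun _ => scal (RtoC 2 * symbol_inv a eta * cis (eta * t))%C x) t
    (scal (RtoC 2 * symbol_inv a eta * cis (eta * t))%C x)).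
  { intros e Hee. exists 1. split; [lra|]. intros s _ _. norm_as (zero : X). rewrite norm_zero_C. lra. }
  apply (approaches_norm_le _ t _ _ (approaches_minus _ _ t _ _ A A2)).
  (* For s this close to t, the lower truncation t - s is below d and s - h is positive. *)
  exists (Rmin d (t - h)). split; [apply Rmin_pos; lra|]. intros s Hs1 Hs2.
  assert (Rmin d (t - h) <= d) by apply Rmin_l. assert (Rmin d (t - h) <= t - h) by apply Rmin_r.
  rewrite !intX_expo by lra. replace (t - h - (s - h)) with (t - s) by ring.
  unfold h at 1. rewrite cis_halfperiod by exact Heta.
  destruct (HP (t - s) t ltac:(lra) ltac:(fold h; lra)) as [P1 P2]. fold h in P1, P2.
  set (c1 := Ic a eta (t - s) t) in *. set (c2 := Ic a eta (t - s) (t - h)) in *.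
  set (s1 := Is a eta (t - s) t) in *. set (s2 := Is a eta (t - s) (t - h)) in *.
  norm_as_by (scal (cis (eta * t) * ((((c1 + c2) / Gamma a)%R, (- ((s1 + s2) / Gamma a))%R) - RtoC 2 * symbol_inv a eta))%C x)
    ltac:(apply injective_projections; simpl; unfold Rdiv; ring).
  eapply Rle_trans; [apply norm_scal_C|]. rewrite Cmod_mult, Cmod_cis, Rmult_1_l.
  apply Rmult_le_compat_r; [apply norm_ge_0|].
  unfold symbol_inv, Cminus, Cplus, Copp, Cmult, RtoC; simpl.
  eapply Rle_trans; [apply Cmod_le_sum|].
  assert (Hi := Rinv_0_lt_compat _ G0).
  match goal with |- Rabs ?u + Rabs ?v <= _ =>
    replace u with (/ Gamma a * (c1 + c2 - 2 * osc_c a eta)) by (unfold osc_c; field; lra);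
    replace v with (- (/ Gamma a * (s1 + s2 - 2 * osc_s a eta))) by (unfold osc_s; field; lra)
  end.
  rewrite Rabs_Ropp, !Rabs_mult, (Rabs_pos_eq (/ Gamma a)) by lra.
  rewrite <- Rmult_plus_distr_l.
  apply Rle_trans with (/ Gamma a * (eps * Gamma a)).
  - apply Rmult_le_compat_l; lra.
  - right; field; lra.
Qed.

End Exponential.
End Increments.

(** * Asymptotic homogeneous solutions *)

Section Homogeneous.
Context {X : CompleteNormedModule C_AbsRing}.
Variable a : R.
Hypothesis Ha : 0 < a <= 1.
Variable A : X -> X.
Hypothesis HA : is_linear A.
Implicit Types g z : R -> X.

Let G0 : 0 < Gamma a := Gamma_gt0 a Ha.
Let aG0 : 0 < a * Gamma a := Rmult_lt_0_compat _ _ (proj1 Ha) G0.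

Lemma dif_cauchy h : 0 < h -> forall e, 0 < e ->
  exists S, h < S /\ forall r s, S <= r -> S <= s -> dif a h r - dif a h s <= e.
Proof.
  intros Hh e He. destruct (dif_lim a Ha h Hh) as [l Hl].
  destruct (Hl (e / 2)) as [S [HS H]]; [lra|]. exists (Rmax S (h + 1)).
  assert (B1 := Rmax_l S (h + 1)). assert (B2 := Rmax_r S (h + 1)). split; [lra|].
  intros r s Hr Hs. specialize (H r ltac:(lra)) as H1. specialize (H s ltac:(lra)) as H2.
  apply Rabs_le_between in H1, H2. lra.
Qed.

(** Before [T0] only the crude bound [M] is known, but its weight is a decrement of [dif] at lags
    beyond [S]. The middle interval of [jinc_bound] is empty here. *)
Lemma jinc_evle h g m e : 0 < h -> BU g -> evle g m -> 0 < e ->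
  evle (jinc a h g) (m * (2 * Rpower h a) / (a * Gamma a) + e).
Proof.
  intros Hh [Hb Hu] [T HT] He. destruct (bdd_pos g Hb) as [M [HM0 HM]].
  destruct (dif_cauchy h Hh (e * (a * Gamma a) / M)) as [S [HS HD]].
  { apply Rdiv_lt_0_compat; [apply Rmult_lt_0_compat|]; lra. }
  set (T0 := Rmax T 0). assert (T <= T0) by apply Rmax_l. assert (0 <= T0) by apply Rmax_r.
  exists (T0 + S). intros t Ht.
  eapply Rle_trans.
  { apply (jinc_bound a Ha h g t T0 T0 M M m); trivial; try lra; intros; trivial. apply HT; lra. }
  specialize (HD (t - T0) t ltac:(lra) ltac:(lra)).
  apply (Rmult_le_compat_l M) in HD; [|lra].
  replace (M * (e * (a * Gamma a) / M)) with (e * (a * Gamma a)) in HD by (field; lra).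
  replace (m * (2 * Rpower h a) / (a * Gamma a) + e)
    with ((m * (2 * Rpower h a) + e * (a * Gamma a)) / (a * Gamma a)) by (field; lra).
  apply Rmult_le_compat_r; [apply Rlt_le, Rinv_0_lt_compat; lra|]. lra.
Qed.

Lemma jinc_vanish h g : 0 < h -> BU g -> vanish g -> vanish (jinc a h g).
Proof.
  intros Hh Hg Hv e He. assert (P := Rpower_gt0 h a).
  destruct (jinc_evle h g (e * (a * Gamma a) / (4 * Rpower h a)) (e / 2) Hh Hg) as [T HT].
  - apply Hv. apply Rdiv_lt_0_compat; [apply Rmult_lt_0_compat|]; lra.
  - lra.
  - exists T. intros t Ht. specialize (HT t Ht).
    replace (e * (a * Gamma a) / (4 * Rpower h a) * (2 * Rpower h a) / (a * Gamma a) + e / 2)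
      with e in HT by (field; lra). exact HT.
Qed.

Lemma jinc_vadd h g g' t : BU g -> BU g' ->
  jinc a h (vadd g g') t = plus (jinc a h g t) (jinc a h g' t).
Proof. intros Hg Hg'. unfold jinc. rewrite !J_vadd by assumption. vring. Qed.

Lemma jinc_vsc h c g t : BU g -> jinc a h (vsc c g) t = scal c (jinc a h g t).
Proof. intros Hg. unfold jinc. rewrite !J_vsc by assumption. vring. Qed.

Lemma jinc_vsub h g g' t : BU g -> BU g' ->
  jinc a h (vsub g g') t = minus (jinc a h g t) (jinc a h g' t).
Proof. intros Hg Hg'. unfold jinc. rewrite !J_vsub by assumption. vring. Qed.

(** By [J_shift_eq] the difference is a kernel increment over [0, r], a stretch that recedes as t
    grows. *)
Lemma jinc_shift_pos h r g : 0 < h -> 0 <= r -> BU g ->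
  vanish (fun t => minus (jinc a h (shift r g) t) (jinc a h g (t + r))).
Proof.
  intros Hh Hr [Hb Hu] e He. destruct (bdd_pos g Hb) as [M [HM0 HM]].
  destruct (dif_cauchy h Hh (e * (a * Gamma a) / M)) as [S [HS HD]].
  { apply Rdiv_lt_0_compat; [apply Rmult_lt_0_compat|]; lra. }
  exists S. intros t Ht. unfold jinc.
  replace (t + r - h) with (t - h + r) by ring.
  rewrite (J_shift_eq a Ha g r t), (J_shift_eq a Ha g r (t - h)) by (trivial; lra).
  assert (K := kernel_increment a Ha h g (t + r) 0 r M Hh Hu Hr ltac:(lra) (fun s _ => HM s)).
  replace (t + r - h) with (t - h + r) in K by ring. replace (t + r - r) with t in K by ring.
  rewrite Rminus_0_r in K. rewrite <- norm_opp_C in K.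
  norm_as (opp (minus (intX (kf a (t + r) g) 0 r) (intX (kf a (t - h + r) g) 0 r))).
  eapply Rle_trans; [exact K|].
  specialize (HD t (t + r) Ht ltac:(lra)). apply (Rmult_le_compat_l M) in HD; [|lra].
  replace (M * (e * (a * Gamma a) / M)) with (e * (a * Gamma a)) in HD by (field; lra).
  apply Rle_trans with (e * (a * Gamma a) / (a * Gamma a)); [|right; field; lra].
  apply Rmult_le_compat_r; [apply Rlt_le, Rinv_0_lt_compat; lra|]. exact HD.
Qed.

Lemma jinc_shift h r g : 0 < h -> BU g ->
  vanish (fun t => minus (jinc a h (shift r g) t) (jinc a h g (t + r))).
Proof.
  intros Hh Hg. destruct (Rle_dec 0 r) as [Hr|Hr]; [now apply jinc_shift_pos|].
  assert (K := jinc_shift_pos h (- r) (shift r g) Hh ltac:(lra) ltac:(now apply BU_shift)).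
  replace (shift (- r) (shift r g)) with g in K
    by (apply functional_extensionality; intros t; unfold shift; f_equal; ring).
  apply (vanish_shift r), (vanish_vsc (RtoC (-1))) in K.
  apply (vanish_eventually _ _ 0) with (2 := K). intros t _. unfold vsc, shift at 1.
  replace (t + r + - r) with t by ring. vring.
Qed.

(* Residue of the time increments of [D^a z = A z]. *)
Definition defect (h : R) z (t : R) : X := minus (minus (z t) (z (t - h))) (A (jinc a h z t)).

Definition hom z : Prop := BU z /\ forall h, 0 < h -> vanish (defect h z).

Lemma hom_vadd z z' : hom z -> hom z' -> hom (vadd z z').
Proof.
  intros [Hz H] [Hz' H']. split; [now apply BU_vadd|]. intros h Hh.
  apply (vanish_eventually _ _ 0) with (2 := vanish_vadd _ _ (H h Hh) (H' h Hh)).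
  intros t _. unfold defect, vadd at 1. rewrite jinc_vadd by assumption.
  rewrite (linear_plus A HA). unfold vadd. vring.
Qed.

Lemma hom_vsc c z : hom z -> hom (vsc c z).
Proof.
  intros [Hz H]. split; [now apply BU_vsc|]. intros h Hh.
  apply (vanish_eventually _ _ 0) with (2 := vanish_vsc c _ (H h Hh)).
  intros t _. unfold defect, vsc at 1. rewrite jinc_vsc by assumption.
  rewrite (linear_scal A HA). unfold vsc. vring.
Qed.

Lemma hom_ext z z' : (forall t, z t = z' t) -> hom z -> hom z'.
Proof. intros H. now rewrite (functional_extensionality z z' H). Qed.

Lemma hom_vsub z z' : hom z -> hom z' -> hom (vsub z z').
Proof.
  intros H H'. apply (hom_ext (vadd z (vsc (RtoC (-1)) z'))).
  - intros t. unfold vadd, vsub, vsc. vring.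
  - apply hom_vadd; [exact H|now apply hom_vsc].
Qed.

Lemma hom_shift r z : hom z -> hom (shift r z).
Proof.
  intros [Hz H]. split; [now apply BU_shift|]. intros h Hh.
  assert (K1 := vanish_shift r _ (H h Hh)).
  assert (K2 := vanish_linear A _ HA (jinc_shift h r z Hh Hz)).
  apply (vanish_eventually _ _ 0) with (2 := vanish_vsub _ _ K1 K2).
  intros t _. unfold defect, vsub, shift. rewrite (is_linear_minus A HA).
  replace (t - h + r) with (t + r - h) by ring. vring.
Qed.

Definition opbound (K : R) : Prop := 0 < K /\ forall v, norm (A v) <= K * norm v.

(** A bounded generator makes translations norm continuous on homogeneous solutions, with a modulus
    h^a independent of z. The passage from T_1 to its square roots rests on this. *)
Lemma hom_increment K h z : opbound K -> 0 < h -> hom z ->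
  asn (vsub z (shift (- h) z)) <= K * (2 * Rpower h a / (a * Gamma a)) * asn z.
Proof.
  intros [HK HKn] Hh [Hz H]. assert (P := Rpower_gt0 h a). apply asn_le. intros e He.
  set (c := K * (2 * Rpower h a / (a * Gamma a))).
  assert (Hc : 0 <= c).
  { apply Rmult_le_pos; [lra|]. apply Rlt_le, Rdiv_lt_0_compat; lra. }
  assert (He' : 0 < e / 3 / (c + 1)) by (apply Rdiv_lt_0_compat; lra).
  assert (He'' : 0 < e / 3 / K) by (apply Rdiv_lt_0_compat; lra).
  destruct (jinc_evle h z _ (e / 3 / K) Hh Hz (asn_ev z _ (BU_bdd z Hz) He') He'') as [T HT].
  destruct (H h Hh (e / 3)) as [S HS]; [lra|].
  exists (Rmax T S). intros t Ht. assert (B1 := Rmax_l T S). assert (B2 := Rmax_r T S).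
  specialize (HT t ltac:(lra)). specialize (HS t ltac:(lra)).
  unfold vsub, shift. replace (t + - h) with (t - h) by ring.
  unfold defect in HS.
  norm_as (plus (minus (minus (z t) (z (t - h))) (A (jinc a h z t))) (A (jinc a h z t))).
  eapply Rle_trans; [apply norm_plus_le|]. specialize (HKn (jinc a h z t)).
  apply (Rmult_le_compat_l K) in HT; [|lra].
  assert (c * (e / 3 / (c + 1)) <= e / 3).
  { apply Rle_trans with ((c + 1) * (e / 3 / (c + 1))); [nra|right; field; lra]. }
  set (x := e / 3 / (c + 1)) in *.
  replace (K * ((asn z + x) * (2 * Rpower h a) / (a * Gamma a) + e / 3 / K))
    with (c * asn z + c * x + e / 3) in HT by (unfold c; field; lra).
  lra.
Qed.

Lemma hom_increment_pos K r z : opbound K -> 0 < r -> hom z ->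
  asn (vsub (shift r z) z) <= K * (2 * Rpower r a / (a * Gamma a)) * asn z.
Proof.
  intros HK Hr Hz. eapply Rle_trans; [|apply (hom_increment K r z HK Hr Hz)]. right.
  rewrite <- (asn_shift r (vsub z (shift (- r) z))). apply asn_ext. intros t.
  unfold vsub, shift. replace (t + r + - r) with t by ring. reflexivity.
Qed.
End Homogeneous.

(** * Lower bounds off the spectrum *)

Section LowerBounds.
Context {X : CompleteNormedModule C_AbsRing}.
Variable a : R.
Hypothesis Ha : 0 < a <= 1.
Variable A : X -> X.
Hypothesis HA : is_linear A.
Implicit Types z : R -> X.

Let G0 : 0 < Gamma a := Gamma_gt0 a Ha.
Let aG0 : 0 < a * Gamma a := Rmult_lt_0_compat _ _ (proj1 Ha) G0.

Definition eigdev (eta s : R) z : R -> X := vsub (shift s z) (vsc (cis (eta * s)) z).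

Lemma bdd_eigdev eta s z : bdd z -> bdd (eigdev eta s z).
Proof. intros; unfold eigdev; auto with bdd. Qed.

Lemma eigdev_lip eta z : BU z -> forall e, 0 < e -> exists d, 0 < d /\
  forall s s' t, Rabs (s - s') < d -> norm (minus (eigdev eta s z t) (eigdev eta s' z t)) <= e.
Proof.
  intros [Hb Hu] e He. destruct (bdd_pos z Hb) as [M [HM0 HM]].
  destruct (Hu (e / 2)) as [d [Hd H]]; [lra|]. assert (Hp := Rabs_pos eta).
  set (q := 2 * Rabs eta * M + 1). assert (Hq : 0 < q) by (unfold q; nra).
  exists (Rmin d (e / 2 / q)). split; [apply Rmin_pos; [lra|apply Rdiv_lt_0_compat; lra]|].
  intros s s' t Hs. unfold eigdev, vsub, vsc, shift.
  norm_as (minus (minus (z (t + s)) (z (t + s'))) (scal (cis (eta * s) - cis (eta * s'))%C (z t))).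
  eapply Rle_trans; [apply norm_minus_le|].
  assert (H1 : norm (minus (z (t + s)) (z (t + s'))) < e / 2).
  { apply H. replace (t + s - (t + s')) with (s - s') by ring.
    apply Rlt_le_trans with (1 := Hs), Rmin_l. }
  assert (H2 : norm (scal (cis (eta * s) - cis (eta * s'))%C (z t)) <= e / 2); [|lra].
  eapply Rle_trans; [apply norm_scal_C|].
  assert (L := cis_lip (eta * s) (eta * s')).
  replace (eta * s - eta * s') with (eta * (s - s')) in L by ring. rewrite Rabs_mult in L.
  assert (Hs2 : Rabs (s - s') < e / 2 / q) by (apply Rlt_le_trans with (1 := Hs), Rmin_r).
  assert (Hn := norm_ge_0 (z t)). assert (Hr := Rabs_pos (s - s')).
  apply Rle_trans with (2 * (Rabs eta * Rabs (s - s')) * M).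
  { apply Rmult_le_compat; trivial. apply Cmod_ge_0. }
  apply Rle_trans with (q * Rabs (s - s')); [unfold q; nra|].
  apply (Rmult_lt_compat_l q) in Hs2; [|exact Hq].
  replace (q * (e / 2 / q)) with (e / 2) in Hs2 by (field; lra). lra.
Qed.

(** The seminorm bounds give a starting time for each s separately; equicontinuity in s reduces
    [0, L] to a grid of mesh d/2, hence to finitely many times. *)
Lemma eigdev_uniform eta z L m : BU z -> 0 <= L ->
  (forall s, 0 <= s <= L -> asn (eigdev eta (- s) z) <= m) ->
  forall e, 0 < e -> exists T, forall t s, T <= t -> 0 <= s <= L ->
  norm (eigdev eta (- s) z t) <= m + e.
Proof.
  intros Hz HL Hm e He. destruct (eigdev_lip eta z Hz (e / 2)) as [d [Hd H]]; [lra|].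
  assert (K : forall n, exists T, forall t j, T <= t -> (j <= n)%nat -> INR j * (d / 2) <= L ->
    norm (eigdev eta (- (INR j * (d / 2))) z t) <= m + e / 2).
  { assert (K1 : forall j, INR j * (d / 2) <= L -> exists T, forall t, T <= t ->
      norm (eigdev eta (- (INR j * (d / 2))) z t) <= m + e / 2).
    { intros j Hj. assert (Hj0 := pos_INR j).
      destruct (asn_ev (eigdev eta (- (INR j * (d / 2))) z) (e / 2)) as [T HT];
        [apply bdd_eigdev, Hz|lra|].
      exists T. intros t Ht. specialize (HT t Ht). specialize (Hm (INR j * (d / 2)) ltac:(nra)). lra. }
    induction n as [|n [T HT]].
    - destruct (K1 0%nat) as [T HT]; [simpl; lra|]. exists T. intros t j Ht Hj _.
      replace j with 0%nat by lia. now apply HT.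
    - destruct (Rle_dec (INR (S n) * (d / 2)) L) as [HS|HS].
      + destruct (K1 (S n) HS) as [T' HT']. exists (Rmax T T'). intros t j Ht Hj HjL.
        assert (B1 := Rmax_l T T'). assert (B2 := Rmax_r T T').
        destruct (Nat.eq_dec j (S n)) as [->|]; [apply HT'; lra|apply HT; trivial; [lra|lia]].
      + exists T. intros t j Ht Hj HjL. destruct (Nat.eq_dec j (S n)) as [->|]; [contradiction|].
        apply HT; trivial; lia. }
  destruct (INR_unbounded (L / (d / 2))) as [n Hn]. destruct (K n) as [T HT].
  exists T. intros t s Ht Hs.
  destruct (nfloor_ex (s / (d / 2))) as [j Hj].
  { apply Rmult_le_pos; [lra|apply Rlt_le, Rinv_0_lt_compat; lra]. }
  assert (Hd2 : 0 < d / 2) by lra.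
  assert (E : s = s / (d / 2) * (d / 2)) by (field; lra).
  assert (J1 : INR j * (d / 2) <= s) by (rewrite E; apply Rmult_le_compat_r; lra).
  assert (J2 : s < (INR j + 1) * (d / 2)) by (rewrite E at 1; apply Rmult_lt_compat_r; lra).
  assert (Hjn : (j <= n)%nat).
  { apply INR_le. apply Rle_trans with (s / (d / 2)); [lra|].
    apply Rle_trans with (L / (d / 2)); [|lra].
    apply Rmult_le_compat_r; [apply Rlt_le, Rinv_0_lt_compat; lra|lra]. }
  specialize (HT t j Ht Hjn ltac:(lra)).
  specialize (H (- s) (- (INR j * (d / 2))) t).
  eapply Rle_trans; [apply (norm_le_minus _ (eigdev eta (- (INR j * (d / 2))) z t))|].
  assert (norm (minus (eigdev eta (- s) z t) (eigdev eta (- (INR j * (d / 2))) z t)) <= e / 2); [|lra].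
  apply H. replace (- s - - (INR j * (d / 2))) with (- (s - INR j * (d / 2))) by ring.
  rewrite Rabs_Ropp, Rabs_pos_eq; lra.
Qed.

Definition regular (eta : R) : Prop := eta <> 0 /\
  exists S, is_bounded_inverse (fun x => minus (scal (Cpower (0, eta) a) x) (A x)) S.

(** At each late t, z is compared with the exponential that agrees with it at t. On the window of
    length L the two differ by d p, and earlier values carry little weight, so ((i eta)^a - A) z(t)
    is of size O(d p); the bounded inverse gives p <= p / 2 up to errors e. *)
Lemma near_eigenvector eta : regular eta -> exists L d, 0 < L /\ 0 < d /\
  forall z, hom a A z -> (forall s, 0 <= s <= L -> asn (eigdev eta (- s) z) <= d * asn z) ->
  asn z = 0.
Proof.
  intros [Heta [S [HS [HS1 _]]]]. set (h := halfperiod eta).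
  assert (Hh : 0 < h) by now apply halfperiod_pos.
  destruct (linear_norm A HA) as [K [HK HKn]].
  destruct (linear_norm S HS) as [N [HN HNn]].
  set (lam := Cpower (0, eta) a) in *. set (kap := symbol_inv a eta).
  assert (Hkl : (kap * lam)%C = RtoC 1) by now apply symbol_inv_Cpower.
  (* Bounds [x] by [w] below: lam / 2 times [w] is (lam - A) x, to which the inverse of norm at most
     [N] is applied. *)
  set (N' := N * Cmod lam / 2).
  assert (HN' : 0 <= N') by (unfold N'; assert (H := Cmod_ge_0 lam); nra).
  assert (P := Rpower_gt0 h a).
  set (q := (2 + 2 * Rpower h a) / (a * Gamma a)).
  assert (Hq : 0 < q) by (apply Rdiv_lt_0_compat; lra).
  set (C1 := 1 + K * q). assert (HC1 : 0 < C1) by (unfold C1; nra).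
  (* Chosen so that the final estimate p <= N' C1 d p + O(e) has factor at most 1/2. *)
  set (d := Rmin 1 (/ (2 * (N' * C1 + 1)))).
  assert (HNC : 0 <= N' * C1) by (apply Rmult_le_pos; lra).
  assert (Hd : 0 < d) by (apply Rmin_pos; [lra|apply Rinv_0_lt_compat; lra]).
  assert (Hd1 : d <= 1) by apply Rmin_l.
  assert (Hd2 : N' * C1 * d <= 1 / 2).
  { apply Rle_trans with ((N' * C1 + 1) * (/ (2 * (N' * C1 + 1)))).
    - apply Rmult_le_compat; try lra. apply Rmin_r.
    - right; field; lra. }
  (* The window length: [dif] drops by at most d at lags beyond L, so the behaviour of z before t -
     L costs only O(d p). *)
  destruct (dif_cauchy a Ha h Hh d Hd) as [L [HL HLd]].
  exists L, d. split; [lra|]. split; [exact Hd|]. intros z [Hz Hhom] Hdev.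
  assert (Hp := asn_ge0 z). set (p := asn z) in *.
  destruct (bdd_pos z (BU_bdd z Hz)) as [M [HM0 HM]].
  set (C2 := 2 + K * ((3 + 2 * Rpower h a) / (a * Gamma a) + 1)).
  assert (HC2 : 0 < C2).
  { assert (0 < (3 + 2 * Rpower h a) / (a * Gamma a)) by (apply Rdiv_lt_0_compat; lra). unfold C2. nra. }
  assert (main : forall e, 0 < e -> e <= 1 -> evle z (N' * (C1 * (d * p) + C2 * e))).
  { intros e He He1.
    destruct (eigdev_uniform eta z L (d * p) Hz ltac:(lra) Hdev e He) as [T1 H1].
    destruct (asn_ev z e (BU_bdd z Hz) He) as [T2 H2]. fold p in H2.
    destruct (Hhom h Hh e He) as [T3 H3].
    destruct (jinc_expo_lim (X := X) a Ha eta Heta (e / (M + 1))) as [T4 [HT4 H4]]; [apply Rdiv_lt_0_compat; lra|].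
    fold h in HT4.
    destruct (dif_cauchy a Ha h Hh (e / (2 * M))) as [T5 [HT5 H5]]; [apply Rdiv_lt_0_compat; lra|].
    (* From [T0] on z is bounded by p + e. Before it only 2 [M] bounds the difference from the
       exponential, and [T5] makes the corresponding weight at most e / (2 M). *)
    set (T0 := Rmax 0 T2). assert (B1 : 0 <= T0) by apply Rmax_l. assert (B2 : T2 <= T0) by apply Rmax_r.
    exists (Rmax T1 (Rmax T3 (Rmax T4 (T0 + T5 + L)))). intros t Ht.
    assert (Q1 := Rmax_l T1 (Rmax T3 (Rmax T4 (T0 + T5 + L)))).
    assert (Q2 := Rmax_r T1 (Rmax T3 (Rmax T4 (T0 + T5 + L)))).
    assert (Q3 := Rmax_l T3 (Rmax T4 (T0 + T5 + L))). assert (Q4 := Rmax_r T3 (Rmax T4 (T0 + T5 + L))).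
    assert (Q5 := Rmax_l T4 (T0 + T5 + L)). assert (Q6 := Rmax_r T4 (T0 + T5 + L)).
    set (x := z t). set (y := scal (cis (eta * - t)) x).
    assert (Hy : scal (cis (eta * t)) y = x).
    { unfold y. v_prep. replace (eta * - t) with (- (eta * t)) by ring.
      rewrite Cmult_assoc, cis_opp_mult. ring. }
    assert (Hny : norm y <= norm x).
    { unfold y. eapply Rle_trans; [apply norm_scal_C|]. rewrite Cmod_cis; lra. }
    assert (Hnx : norm x <= p + e) by (apply H2; lra).
    assert (HnM : norm x <= M) by apply HM.
    (* the exponential through (t, z t) agrees with z up to d p + e on [t - L, t] *)
    assert (Hdiff : forall s, 0 <= s <= L -> norm (vsub z (expo eta y) (t - s)) <= d * p + e).
    { intros s Hs. specialize (H1 t s ltac:(lra) Hs). unfold eigdev, vsub, vsc, shift in H1.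
      unfold vsub, expo.
      replace (scal (cis (eta * (t - s))) y) with (scal (cis (eta * - s)) x).
      - exact H1.
      - rewrite <- Hy. replace (eta * (t - s)) with (eta * - s + eta * t) by ring.
        rewrite cis_plus. vring. }
    assert (Hexp : forall s, norm (expo eta y s) <= norm x).
    { intros s. unfold expo. eapply Rle_trans; [apply norm_scal_C|]. rewrite Cmod_cis; lra. }
    assert (I1 : norm (jinc a h (vsub z (expo eta y)) t) <=
      (e + 2 * (p + e) * d + (d * p + e) * (2 * Rpower h a)) / (a * Gamma a)).
    { eapply Rle_trans.
      - apply (jinc_bound a Ha h (vsub z (expo eta y)) t T0 (t - L) (2 * M) (2 * (p + e)) (d * p + e)); trivial; try lra.
        + apply BU_vsub; [exact Hz|apply BU_expo].
        + intros s _. eapply Rle_trans; [apply norm_minus_le|]. specialize (HM s). specialize (Hexp s). lra.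
        + intros s Hs. eapply Rle_trans; [apply norm_minus_le|].
          specialize (H2 s ltac:(lra)). specialize (Hexp s). lra.
        + intros s Hs. replace s with (t - (t - s)) by ring. apply Hdiff; lra.
      - apply Rmult_le_compat_r; [apply Rlt_le, Rinv_0_lt_compat; lra|].
        apply Rplus_le_compat_r, Rplus_le_compat.
        + specialize (H5 (t - T0) t ltac:(lra) ltac:(lra)).
          apply (Rmult_le_compat_l (2 * M)) in H5; [|lra].
          replace (2 * M * (e / (2 * M))) with e in H5 by (field; lra). exact H5.
        + apply Rmult_le_compat_l; [lra|]. apply HLd; lra. }
    assert (I2 : norm (minus (jinc a h (expo eta y) t) (scal (RtoC 2 * kap)%C x)) <= e).
    { specialize (H4 t y ltac:(lra)). fold h kap in H4.
      replace (scal (RtoC 2 * kap * cis (eta * t))%C y) with (scal (RtoC 2 * kap)%C x) in H4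
        by (rewrite <- Hy; vring).
      apply Rle_trans with (1 := H4).
      apply Rle_trans with (e / (M + 1) * (M + 1)); [|right; field; lra].
      apply Rmult_le_compat_l; [apply Rlt_le, Rdiv_lt_0_compat; lra|]. lra. }
    assert (I3 : norm (plus x (z (t - h))) <= d * p + e).
    { specialize (H1 t h ltac:(lra) ltac:(lra)). unfold eigdev, vsub, vsc, shift in H1.
      assert (Ec : cis (eta * - h) = RtoC (-1)).
      { assert (E := cis_halfperiod eta Heta 0). fold h in E.
        replace (eta * (0 - h)) with (eta * - h) in E by ring. rewrite E, Rmult_0_r, cis_0. ring. }
      rewrite Ec in H1. fold x in H1. replace (t + - h) with (t - h) in H1 by ring.
      norm_as (minus (z (t - h)) (scal (RtoC (-1)) x)). exact H1. }
    specialize (H3 t ltac:(lra)). unfold defect in H3. fold x in H3.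
    (* The increment of z is about 2 x and that of J z about 2 (i eta)^(-a) x, so the vanishing
       defect of z makes [w] small. *)
    set (w := minus (scal (RtoC 2) x) (scal (RtoC 2 * kap)%C (A x))).
    assert (Hw : norm w <= (d * p + e) + e +
      K * ((e + 2 * (p + e) * d + (d * p + e) * (2 * Rpower h a)) / (a * Gamma a) + e)).
    { assert (Ej : jinc a h z t = plus (jinc a h (vsub z (expo eta y)) t) (jinc a h (expo eta y) t)).
      { rewrite jinc_vsub; [vring|exact Ha|exact Hz|apply BU_expo]. }
      assert (Ew : w = plus (plus (plus x (z (t - h))) (minus (minus x (z (t - h))) (A (jinc a h z t))))
        (plus (A (jinc a h (vsub z (expo eta y)) t))
              (A (minus (jinc a h (expo eta y) t) (scal (RtoC 2 * kap)%C x))))).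
      { unfold w. rewrite Ej, (linear_plus A HA), (is_linear_minus A HA), (linear_scal A HA).
        vring. }
      rewrite Ew. eapply Rle_trans; [apply norm_plus_le|].
      apply Rplus_le_compat.
      - eapply Rle_trans; [apply norm_plus_le|]. lra.
      - eapply Rle_trans; [apply norm_plus_le|]. rewrite Rmult_plus_distr_l.
        apply Rplus_le_compat; (eapply Rle_trans; [apply HKn|]); apply Rmult_le_compat_l; lra. }
    assert (Hx : norm x <= N' * norm w).
    { rewrite <- (HS1 x) at 1. eapply Rle_trans; [apply HNn|].
      unfold N'. replace (N * Cmod lam / 2 * norm w) with (N * (Cmod lam / 2 * norm w)) by field.
      apply Rmult_le_compat_l; [lra|].
      replace (Cmod lam / 2) with (Cmod (lam * RtoC (/ 2))%C).
      2:{ rewrite Cmod_mult, Cmod_R, Rabs_pos_eq by lra. reflexivity. }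
      apply Rle_trans with (norm (scal (lam * RtoC (/ 2))%C w)); [right|apply norm_scal_C].
      apply f_equal. unfold w. v_prep.
      - transitivity (- ((RtoC (/ 2) * RtoC 2) * (kap * lam)))%C.
        + rewrite Hkl. apply injective_projections; simpl; field.
        + ring.
      - apply injective_projections; simpl; field. }
    apply Rle_trans with (1 := Hx). apply Rmult_le_compat_l; [exact HN'|].
    apply Rle_trans with (1 := Hw).
    assert (Hdp : d * e <= e) by nra.
    unfold C1, C2, q.
    set (i := / (a * Gamma a)). assert (Hi : 0 < i) by (apply Rinv_0_lt_compat; lra).
    unfold Rdiv. fold i. set (P0 := Rpower h a) in *.
    assert (K * (i * (2 * (d * e))) <= K * (i * (2 * e))).
    { apply Rmult_le_compat_l; [lra|]. apply Rmult_le_compat_l; lra. }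
    lra. }
  destruct (Rle_lt_or_eq_dec 0 p Hp) as [Hpos|]; [exfalso|now symmetry].
  set (e := Rmin 1 (p / (4 * (N' * C2 + 1)))).
  assert (HN2 : 0 <= N' * C2) by (apply Rmult_le_pos; lra).
  assert (He : 0 < e) by (apply Rmin_pos; [lra|apply Rdiv_lt_0_compat; lra]).
  specialize (main e He (Rmin_l _ _)). apply asn_le_evle in main. fold p in main.
  assert (N' * C2 * e <= p / 4).
  { apply Rle_trans with ((N' * C2 + 1) * (p / (4 * (N' * C2 + 1)))).
    - apply Rmult_le_compat; try lra. apply Rmin_r.
    - right; field; lra. }
  assert (N' * C1 * d * p <= 1 / 2 * p) by (apply Rmult_le_compat_r; lra).
  lra.
Qed.

End LowerBounds.

Lemma angle_reduce x : exists x', cis x' = cis x /\ Rabs x' <= PI.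
Proof.
  assert (P := PI_RGT_0).
  assert (K : forall n x, Rabs x <= PI + 2 * PI * INR n -> exists x', cis x' = cis x /\ Rabs x' <= PI).
  { induction n as [|n IH]; intros y Hy.
    - exists y. split; [reflexivity|]. simpl in Hy. lra.
    - rewrite S_INR in Hy. destruct (Rle_dec (Rabs y) (PI + 2 * PI * INR n)) as [H|H]; [now apply IH|].
      assert (Hn : 0 <= 2 * PI * INR n) by (apply Rmult_le_pos; [lra|apply pos_INR]).
      destruct (Rle_dec 0 y) as [H0|H0].
      + rewrite Rabs_pos_eq in * by lra.
        destruct (IH (y - 2 * PI)) as [x' [E Hx']].
        { apply Rabs_le; lra. }
        exists x'. split; [|exact Hx']. rewrite E. replace (y - 2 * PI) with (y + - (2 * PI * INR 1)) by (simpl; ring).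
        rewrite cis_plus. assert (E1 := cis_opp_mult (2 * PI * INR 1)). rewrite cis_2PI_INR, Cmult_1_l in E1.
        rewrite E1. ring.
      + rewrite Rabs_left in * by lra.
        destruct (IH (y + 2 * PI * INR 1)) as [x' [E Hx']].
        { apply Rabs_le; simpl; lra. }
        exists x'. split; [|exact Hx']. rewrite E, cis_plus, cis_2PI_INR. ring. }
  destruct (INR_unbounded (Rabs x / (2 * PI))) as [n Hn]. apply (K n).
  apply (Rmult_lt_compat_r (2 * PI)) in Hn; [|lra].
  replace (Rabs x / (2 * PI) * (2 * PI)) with (Rabs x) in Hn by (field; lra). lra.
Qed.

(** The true bound is the square root of 2; 5/4 leaves exactly 1 after the loss of 1/4 in
    [eigdev_halve]. *)
Lemma Cmod_one_plus_cis x : Rabs x <= PI / 2 -> 5 / 4 <= Cmod (RtoC 1 + cis x).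
Proof.
  intros Hx. apply Rabs_le_between in Hx. assert (Hc : 0 <= cos x) by (apply cos_ge_0; lra).
  rewrite <- (sqrt_Rsqr (5 / 4)) by lra. unfold Cmod. apply sqrt_le_1_alt.
  unfold cis, Cplus, RtoC; simpl. generalize (sin2_cos2 x). unfold Rsqr. nra.
Qed.

(** * Square roots of the translation by one, and lower bounds on the unit circle *)

Section UnitCircleBounds.
Context {X : CompleteNormedModule C_AbsRing}.
Implicit Types z : R -> X.

Lemma asn_vsc_ge (c : C) z : bdd z -> Cmod c * asn z <= asn (vsc c z).
Proof.
  intros Hz. destruct (Req_dec (Cmod c) 0) as [H0|H0].
  { rewrite H0, Rmult_0_l. apply asn_ge0. }
  assert (Hc : c <> RtoC 0) by (intros ->; apply H0, Cmod_0).
  assert (Hpos : 0 < Cmod c) by now apply Cmod_gt_0.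
  assert (K := asn_vsc (/ c)%C (vsc c z) (bdd_vsc c z Hz)).
  rewrite (asn_ext (vsc (/ c)%C (vsc c z)) z) in K.
  2:{ intros t. unfold vsc. v_prep. field. exact Hc. }
  rewrite Cmod_inv in K by exact Hc.
  apply (Rmult_le_compat_l (Cmod c)) in K; [|lra].
  replace (Cmod c * (/ Cmod c * asn (vsc c z))) with (asn (vsc c z)) in K by (field; exact H0). exact K.
Qed.

(** T_{-s} - e^{- i eta s} is - e^{- i eta s} T_{-s} (T_s - e^{i eta s}), and T_{-s} is isometric
    for the seminorm. *)
Lemma asn_eigdev_opp eta s z : bdd z -> asn (eigdev eta (- s) z) <= asn (eigdev eta s z).
Proof.
  intros Hz. rewrite <- (asn_shift (- s) (eigdev eta s z)).
  rewrite (asn_ext (eigdev eta (- s) z) (vsc (- cis (eta * - s))%C (shift (- s) (eigdev eta s z)))).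
  - eapply Rle_trans; [apply asn_vsc; apply bdd_shift, bdd_eigdev, Hz|].
    rewrite Cmod_opp, Cmod_cis. lra.
  - intros t. unfold eigdev, vsub, vsc, shift. replace (t + - s + s) with t by ring.
    assert (Hcd : (cis (eta * - s) * cis (eta * s))%C = RtoC 1).
    { replace (eta * - s) with (- (eta * s)) by ring. rewrite Cmult_comm. apply cis_opp_mult. }
    transitivity (minus (scal (cis (eta * - s) * cis (eta * s))%C (z (t + - s))) (scal (cis (eta * - s)) (z t))).
    + rewrite Hcd. vring.
    + vring.
Qed.

(** The factorisation of T_{2s} - e^{2 i eta s} as a difference of squares. *)
Lemma eigdev_double eta s z t :
  eigdev eta (2 * s) z t =
  plus (shift s (eigdev eta s z) t) (scal (cis (eta * s)) (eigdev eta s z t)).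
Proof.
  unfold eigdev, vsub, vsc, shift. replace (t + 2 * s) with (t + s + s) by ring.
  replace (eta * (2 * s)) with (eta * s + eta * s) by ring. rewrite cis_plus. vring.
Qed.

Lemma eigdev_multiple eta s j z : bdd z ->
  asn (eigdev eta (INR j * s) z) <= INR j * asn (eigdev eta s z).
Proof.
  intros Hz. induction j as [|j IH].
  - simpl. rewrite !Rmult_0_l. rewrite asn_vanish; [lra|]. intros e He. exists 0. intros t _.
    unfold eigdev, vsub, shift, vsc. rewrite Rplus_0_r, Rmult_0_r, cis_0.
    norm_as (zero : X). rewrite norm_zero_C. lra.
  - rewrite S_INR.
    rewrite (asn_ext _ (vadd (shift s (eigdev eta (INR j * s) z)) (vsc (cis (eta * (INR j * s))) (eigdev eta s z)))).
    + eapply Rle_trans; [apply asn_vadd; [apply bdd_shift, bdd_eigdev, Hz|apply bdd_vsc, bdd_eigdev, Hz]|].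
      rewrite asn_shift.
      assert (K := asn_vsc (cis (eta * (INR j * s))) (eigdev eta s z) (bdd_eigdev eta s z Hz)).
      rewrite Cmod_cis in K. lra.
    + intros t. unfold eigdev, vadd, vsub, vsc, shift.
      replace (t + (INR j + 1) * s) with (t + s + INR j * s) by ring.
      replace (eta * ((INR j + 1) * s)) with (eta * (INR j * s) + eta * s) by ring.
      rewrite cis_plus. vring.
Qed.

Variable a : R.
Hypothesis Ha : 0 < a <= 1.
Variable A : X -> X.
Hypothesis HA : is_linear A.

Lemma hom_eigdev eta s z : hom a A z -> hom a A (eigdev eta s z).
Proof.
  intros Hz. unfold eigdev. apply hom_vsub; trivial; [now apply hom_shift|now apply hom_vsc].
Qed.

Lemma hom_increment_small e : 0 < e -> exists d, 0 < d /\
  forall r z, 0 < r <= d -> hom a A z -> asn (vsub (shift r z) z) <= e * asn z.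
Proof.
  intros He. destruct (linear_norm A HA) as [K HK]. destruct HK as [HK0 HK].
  assert (G0 := Gamma_gt0 a Ha).
  assert (aG0 : 0 < a * Gamma a) by (apply Rmult_lt_0_compat; [lra|now apply Gamma_gt0]).
  destruct (Rpower_small a (e * (a * Gamma a) / (2 * K))) as [d [Hd H]];
    [lra|apply Rdiv_lt_0_compat; [apply Rmult_lt_0_compat|]; lra|].
  exists d. split; [exact Hd|]. intros r z Hr Hz.
  eapply Rle_trans; [apply (hom_increment_pos a Ha A K r z (conj HK0 HK)); [lra|exact Hz]|].
  apply Rmult_le_compat_r; [apply asn_ge0|]. specialize (H r ltac:(lra) ltac:(lra)).
  apply Rle_trans with (K * (2 * (e * (a * Gamma a) / (2 * K)) / (a * Gamma a))).
  - apply Rmult_le_compat_l; [lra|].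
    apply Rmult_le_compat_r; [apply Rlt_le, Rinv_0_lt_compat; lra|lra].
  - right; field; lra.
Qed.

(** With g = e^{i eta s}, the factor T_s + g is (1 + g) + (T_s - 1). The first summand is at least
    5/4 in modulus and the second at most 1/4 in norm, so the factor does not decrease the
    seminorm. *)
Lemma eigdev_halve eta s z : hom a A z -> Rabs (eta * s) <= PI / 2 ->
  (forall x, hom a A x -> asn (vsub (shift s x) x) <= / 4 * asn x) ->
  asn (eigdev eta s z) <= asn (eigdev eta (2 * s) z).
Proof.
  intros Hz Hs Hinc. set (x := eigdev eta s z). set (g := cis (eta * s)).
  assert (Hx : hom a A x) by now apply hom_eigdev.
  assert (Hb : bdd x) by apply BU_bdd, Hx.
  assert (E : asn (eigdev eta (2 * s) z) = asn (vadd (shift s x) (vsc g x))).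
  { apply asn_ext. intros t. apply eigdev_double. }
  rewrite E. specialize (Hinc x Hx).
  assert (K1 := asn_vsc_ge (RtoC 1 + g) x Hb).
  assert (K2 : asn (vsc (RtoC 1 + g)%C x) <= asn (vadd (shift s x) (vsc g x)) + asn (vsub (shift s x) x)).
  { rewrite (asn_ext (vsc (RtoC 1 + g)%C x) (vsub (vadd (shift s x) (vsc g x)) (vsub (shift s x) x))).
    - apply asn_vsub; auto with bdd.
    - intros t. unfold vadd, vsub, vsc. vring. }
  assert (K3 := Cmod_one_plus_cis (eta * s) Hs). fold g in K3.
  assert (Hp := asn_ge0 x).
  assert (K4 := Rmult_le_compat_r _ _ _ Hp K3). lra.
Qed.

(** If T_s z were close to e^{i eta s} z, repeated halving would give the same for a tiny step [sg].
    Every r in [0, L] is a multiple of [sg] plus a remainder on which translations hardly move z, so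
    [near_eigenvector] would apply. *)
Lemma lower_bound_local eta s : regular a A eta -> 0 < s -> Rabs (eta * s) <= PI ->
  (forall r x, 0 < r <= s -> hom a A x -> asn (vsub (shift r x) x) <= / 4 * asn x) ->
  exists c, 0 < c /\ forall z, hom a A z -> c * asn z <= asn (eigdev eta s z).
Proof.
  intros Hreg Hs Hes Hinc.
  destruct (near_eigenvector a Ha A HA eta Hreg) as [L [d [HL [Hd Hnear]]]].
  destruct (hom_increment_small (d / 4)) as [r0 [Hr0 Hsmall]]; [lra|].
  assert (Hp := Rabs_pos eta).
  (* The step must be so short that, within one step, both the translation and the rotation cost at
     most d / 4. *)
  assert (Hn : exists n, s / 2 ^ n <= r0 /\ 2 * Rabs eta * (s / 2 ^ n) <= d / 4).
  { destruct (INR_unbounded (s / r0 + s * (2 * Rabs eta) / (d / 4))) as [n Hn].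
    assert (Hpow : INR n < 2 ^ n).
    { clear. induction n as [|n IH]; [simpl; lra|]. rewrite S_INR. simpl.
      assert (1 <= 2 ^ n) by (apply pow_R1_Rle; lra). lra. }
    assert (Hpow0 : 0 < 2 ^ n) by (apply pow_lt; lra).
    assert (U1 : 0 <= s / r0) by (apply Rlt_le, Rdiv_lt_0_compat; lra).
    assert (U2 : 0 <= s * (2 * Rabs eta) / (d / 4)).
    { apply Rmult_le_pos; [nra|apply Rlt_le, Rinv_0_lt_compat; lra]. }
    exists n. split.
    - apply Rmult_le_reg_r with (2 ^ n); [exact Hpow0|].
      replace (s / 2 ^ n * 2 ^ n) with (s / r0 * r0) by (field; lra). nra.
    - apply Rmult_le_reg_r with (2 ^ n); [exact Hpow0|].
      replace (2 * Rabs eta * (s / 2 ^ n) * 2 ^ n) with (s * (2 * Rabs eta) / (d / 4) * (d / 4)) by (field; lra). nra. }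
  destruct Hn as [n [Hn1 Hn2]]. set (sg := s / 2 ^ n) in *.
  assert (Hsg : 0 < sg) by (apply Rdiv_lt_0_compat; [lra|apply pow_lt; lra]).
  assert (Hiter : forall z, hom a A z -> asn (eigdev eta sg z) <= asn (eigdev eta s z)).
  { intros z Hz. unfold sg. clear - Hz Hs Hes Hinc Ha HA. induction n as [|n IH].
    - simpl. replace (s / 1) with s by field. lra.
    - apply Rle_trans with (2 := IH). simpl.
      assert (H2 : 0 < 2 ^ n) by (apply pow_lt; lra).
      assert (H3 : 1 <= 2 ^ n) by (apply pow_R1_Rle; lra).
      replace (s / 2 ^ n) with (2 * (s / (2 * 2 ^ n))) by (field; lra).
      assert (B : s / (2 * 2 ^ n) <= s / 2).
      { apply Rmult_le_compat_l; [lra|]. apply Rinv_le_contravar; lra. }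
      assert (B0 : 0 < s / (2 * 2 ^ n)) by (apply Rdiv_lt_0_compat; lra).
      apply eigdev_halve; trivial.
      + rewrite Rabs_mult, (Rabs_pos_eq (s / _)) by lra.
        rewrite Rabs_mult, (Rabs_pos_eq s) in Hes by lra.
        assert (Hp := Rabs_pos eta). nra.
      + intros x Hx. apply Hinc; [lra|exact Hx]. }
  (* At most L / [sg] steps of deviation c add up to d / 2; together with the two quarters this is
     the d that [near_eigenvector] allows. *)
  set (c := d / 2 * (sg / L)).
  assert (Hc : 0 < c) by (unfold c; apply Rmult_lt_0_compat; [lra|apply Rdiv_lt_0_compat; lra]).
  exists c. split; [exact Hc|]. intros z Hz.
  apply Rnot_lt_le. intros Hlt. assert (Hb := BU_bdd z (proj1 Hz)).
  assert (Hz0 : asn z = 0).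
  { apply Hnear; [exact Hz|]. intros r Hr. eapply Rle_trans; [apply asn_eigdev_opp, Hb|].
    destruct (nfloor_ex (r / sg)) as [j Hj].
    { apply Rmult_le_pos; [lra|apply Rlt_le, Rinv_0_lt_compat; lra]. }
    set (q := r - INR j * sg).
    assert (E : r = r / sg * sg) by (field; lra).
    assert (J1 : INR j * sg <= r) by (rewrite E; apply Rmult_le_compat_r; lra).
    assert (J2 : r < (INR j + 1) * sg) by (rewrite E; apply Rmult_lt_compat_r; lra).
    assert (Hq : 0 <= q < sg) by (unfold q; lra).
    assert (Hpz := asn_ge0 z).
    assert (P1 : asn (shift (INR j * sg) (vsub (shift q z) z)) <= d / 4 * asn z).
    { rewrite asn_shift. destruct (Rle_lt_or_eq_dec 0 q (proj1 Hq)) as [Hq0|Hq0].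
      - apply Hsmall; [lra|exact Hz].
      - rewrite <- Hq0, asn_vanish; [nra|]. intros e He. exists 0. intros t _.
        unfold vsub, shift. rewrite Rplus_0_r. norm_as (zero : X). rewrite norm_zero_C. lra. }
    assert (P2 : asn (eigdev eta (INR j * sg) z) <= d / 2 * asn z).
    { eapply Rle_trans; [apply eigdev_multiple, Hb|].
      assert (M0 := Hiter z Hz).
      assert (Hj1 : INR j <= L / sg).
      { apply Rle_trans with (r / sg); [lra|]. apply Rmult_le_compat_r; [apply Rlt_le, Rinv_0_lt_compat; lra|lra]. }
      apply Rle_trans with (L / sg * (c * asn z)).
      - apply Rmult_le_compat; [apply pos_INR|apply asn_ge0|exact Hj1|lra].
      - right. unfold c. field. lra. }
    assert (P3 : asn (vsc (cis (eta * (INR j * sg)) - cis (eta * r))%C z) <= d / 4 * asn z).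
    { eapply Rle_trans; [apply asn_vsc, Hb|]. apply Rmult_le_compat_r; [exact Hpz|].
      eapply Rle_trans; [apply cis_lip|].
      replace (eta * (INR j * sg) - eta * r) with (eta * - q) by (unfold q; ring).
      rewrite Rabs_mult, Rabs_Ropp, (Rabs_pos_eq q) by lra.
      apply Rle_trans with (2 := Hn2). rewrite Rmult_assoc.
      apply Rmult_le_compat_l; [lra|]. apply Rmult_le_compat_l; lra. }
    rewrite (asn_ext (eigdev eta r z) (vadd (vadd (shift (INR j * sg) (vsub (shift q z) z)) (eigdev eta (INR j * sg) z))
      (vsc (cis (eta * (INR j * sg)) - cis (eta * r))%C z))).
    - assert (bdd (eigdev eta (INR j * sg) z)) by now apply bdd_eigdev.
      eapply Rle_trans; [apply asn_vadd; auto with bdd|].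
      eapply Rle_trans; [apply Rplus_le_compat_r, asn_vadd; auto with bdd|]. lra.
    - intros t. unfold eigdev, vadd, vsub, vsc, shift.
      replace (t + INR j * sg + q) with (t + r) by (unfold q; ring). vring. }
  rewrite Hz0, Rmult_0_r in Hlt. generalize (asn_ge0 (eigdev eta s z)). lra.
Qed.

(** Fine scales are covered by [lower_bound_local]; coarser ones follow by downward induction, both
    factors of T_{2s} - e^{2 i eta s} being bounded below. The claim is for all eta over theta at
    once because the second factor changes eta. *)
Lemma lower_bound_dyadic theta : (forall eta, cis eta = cis theta -> regular a A eta) ->
  forall n eta, cis eta = cis theta ->
  exists c, 0 < c /\ forall z, hom a A z -> c * asn z <= asn (eigdev eta (/ 2 ^ n) z).
Proof.
  intros Hreg. destruct (hom_increment_small (/ 4)) as [r0 [Hr0 Hsmall]]; [lra|].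
  destruct (INR_unbounded (/ r0)) as [N HN].
  assert (Hpow : / 2 ^ N <= r0).
  { assert (INR N < 2 ^ N).
    { clear. induction N as [|n IH]; [simpl; lra|]. rewrite S_INR. simpl.
      assert (1 <= 2 ^ n) by (apply pow_R1_Rle; lra). lra. }
    rewrite <- (Rinv_inv r0). apply Rinv_le_contravar; [now apply Rinv_0_lt_compat|lra]. }
  (* The phase at scale 2^(-n) is reduced to |x| <= PI, and eta is replaced by 2^n x, which has the
     same phase there and still lies over theta. *)
  assert (base : forall n, (N <= n)%nat -> forall eta, cis eta = cis theta ->
    exists c, 0 < c /\ forall z, hom a A z -> c * asn z <= asn (eigdev eta (/ 2 ^ n) z)).
  { intros n Hn eta He. assert (H2 : 0 < 2 ^ n) by (apply pow_lt; lra).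
    destruct (angle_reduce (eta * / 2 ^ n)) as [x [Ex Hx]].
    assert (Hpw : forall m u v, cis u = cis v -> cis (2 ^ m * u) = cis (2 ^ m * v)).
    { induction m as [|m IH]; intros u v Huv; [simpl; now rewrite !Rmult_1_l|].
      simpl. replace (2 * 2 ^ m * u) with (2 ^ m * u + 2 ^ m * u) by ring.
      replace (2 * 2 ^ m * v) with (2 ^ m * v + 2 ^ m * v) by ring.
      rewrite !cis_plus, (IH u v Huv). reflexivity. }
    destruct (lower_bound_local (2 ^ n * x) (/ 2 ^ n)) as [c [Hc H]].
    - apply Hreg. rewrite <- He, (Hpw n _ _ Ex). f_equal. field. lra.
    - now apply Rinv_0_lt_compat.
    - replace (2 ^ n * x * / 2 ^ n) with x by (field; lra). exact Hx.
    - intros r z Hr Hz. apply Hsmall; [|exact Hz]. split; [lra|].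
      apply Rle_trans with (1 := proj2 Hr), Rle_trans with (2 := Hpow).
      apply Rinv_le_contravar; [apply pow_lt; lra|]. apply Rle_pow; [lra|exact Hn].
    - exists c. split; [exact Hc|]. intros z Hz. specialize (H z Hz).
      unfold eigdev in *. replace (2 ^ n * x * / 2 ^ n) with x in H by (field; lra).
      rewrite Ex in H. exact H. }
  assert (step : forall k n, (N <= n + k)%nat -> forall eta, cis eta = cis theta ->
    exists c, 0 < c /\ forall z, hom a A z -> c * asn z <= asn (eigdev eta (/ 2 ^ n) z)).
  { induction k as [|k IH]; intros n Hn eta He; [apply base; trivial; lia|].
    assert (H2 : 0 < 2 ^ n) by (apply pow_lt; lra).
    (* At scale 2^(-n-1) this adds PI to the phase: T + e^{i eta s} becomes T - e^{i eta' s}, with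
       eta' over the same theta. *)
    set (eta' := eta + 2 * PI * INR (2 ^ n)%nat).
    assert (He' : cis eta' = cis theta) by (unfold eta'; rewrite cis_plus, cis_2PI_INR, He; ring).
    destruct (IH (S n) ltac:(lia) eta He) as [c1 [Hc1 B1]].
    destruct (IH (S n) ltac:(lia) eta' He') as [c2 [Hc2 B2]].
    exists (c2 * c1). split; [nra|]. intros z Hz.
    rewrite (asn_ext (eigdev eta (/ 2 ^ n) z) (eigdev eta' (/ 2 ^ S n) (eigdev eta (/ 2 ^ S n) z))).
    - apply Rle_trans with (c2 * asn (eigdev eta (/ 2 ^ S n) z)).
      + rewrite Rmult_assoc. apply Rmult_le_compat_l; [lra|now apply B1].
      + apply B2. now apply hom_eigdev.
    - intros t. replace (/ 2 ^ n) with (2 * / 2 ^ S n) by (simpl; field; lra).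
      rewrite eigdev_double. unfold eigdev at 3. unfold vsub, vsc.
      assert (Ec : cis (eta' * / 2 ^ S n) = (- cis (eta * / 2 ^ S n))%C).
      { replace (eta' * / 2 ^ S n) with (eta * / 2 ^ S n + PI).
        - rewrite cis_plus, cis_PI. ring.
        - unfold eta'. rewrite pow_INR. replace (INR 2) with 2 by (simpl; ring).
          change (2 ^ S n) with (2 * 2 ^ n). field. lra. }
      rewrite Ec. vring. }
  intros n eta He. apply (step N n); [lia|exact He].
Qed.

Lemma lower_bound_unit theta : (forall eta, cis eta = cis theta -> regular a A eta) ->
  exists c, 0 < c /\ forall z, hom a A z -> c * asn z <= asn (eigdev theta 1 z).
Proof.
  intros H. destruct (lower_bound_dyadic theta H 0%nat theta eq_refl) as [c [Hc B]].
  exists c. split; [exact Hc|]. intros z Hz. specialize (B z Hz). simpl in B. rewrite Rinv_1 in B. exact B.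
Qed.

Lemma lower_bound_uniform b1 b2 :
  (forall theta, b1 <= theta <= b2 -> forall eta, cis eta = cis theta -> regular a A eta) ->
  exists c, 0 < c /\ forall theta z, b1 <= theta <= b2 -> hom a A z ->
    c * asn z <= asn (eigdev theta 1 z).
Proof.
  intros H.
  assert (K : forall theta, exists c : posreal, b1 <= theta <= b2 ->
    forall z, hom a A z -> 4 * c * asn z <= asn (eigdev theta 1 z)).
  { intros theta. destruct (Classical_Prop.classic (b1 <= theta <= b2)) as [Hin|Hout].
    - destruct (lower_bound_unit theta (H theta Hin)) as [c [Hc B]].
      assert (Hc4 : 0 < c / 4) by lra. exists (mkposreal (c / 4) Hc4). intros _ z Hz. simpl.
      replace (4 * (c / 4)) with c by field. now apply B.
    - exists (mkposreal 1 Rlt_0_1). now intros. }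
  set (delta := fun theta => proj1_sig (constructive_indefinite_description _ (K theta))).
  assert (Hdelta : forall theta, b1 <= theta <= b2 ->
    forall z, hom a A z -> 4 * delta theta * asn z <= asn (eigdev theta 1 z)).
  { intros theta. exact (proj2_sig (constructive_indefinite_description _ (K theta))). }
  (* Each theta has a tag t closer than [delta t] with d <= [delta t], but only under a double
     negation, hence the proof by contradiction: a failure at theta would bound the deviation at t
     by d + 2 [delta t], less than the 4 [delta t] known there. *)
  destruct (compactness_value_1d b1 b2 delta) as [d Hd].
  exists d. split; [apply cond_pos|]. intros theta z Hth Hz.
  apply Rnot_lt_le. intros Hlt. apply (Hd theta Hth). intros [t [Ht [Hclose Hdt]]].
  specialize (Hdelta t Ht z Hz). assert (Hp := asn_ge0 z). assert (Hb := BU_bdd z (proj1 Hz)).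
  assert (P : asn (eigdev t 1 z) <= asn (eigdev theta 1 z) + asn (vsc (cis theta - cis t)%C z)).
  { rewrite (asn_ext (eigdev t 1 z) (vadd (eigdev theta 1 z) (vsc (cis theta - cis t)%C z))).
    - apply asn_vadd; [now apply bdd_eigdev|now apply bdd_vsc].
    - intros s. unfold eigdev, vadd, vsub, vsc, shift. rewrite !Rmult_1_r. vring. }
  assert (Q := asn_vsc (cis theta - cis t) z Hb). assert (L := cis_lip theta t).
  assert (Hdt0 := cond_pos (delta t)).
  assert (Cmod (cis theta - cis t) * asn z <= 2 * delta t * asn z).
  { apply Rmult_le_compat_r; lra. }
  assert (d * asn z <= delta t * asn z) by (apply Rmult_le_compat_r; lra).
  nra.
Qed.

End UnitCircleBounds.

(** * Fejer sums of translations *)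

(** With n equal steps the quadratic errors add up to K (b2 - b1)^2 / n. This stands in for the
    triangle inequality of a function-valued integral under the seminorm. *)
Lemma subadditive_bound (q : R -> R) b1 b2 B K : b1 <= b2 -> 0 <= K ->
  (forall x y, b1 <= x -> x <= y -> y <= b2 -> q y <= q x + (y - x) * B + K * ((y - x) * (y - x))) ->
  q b2 <= q b1 + (b2 - b1) * B.
Proof.
  intros Hb HK Hq. apply le_epsilon. intros e He.
  set (D := b2 - b1). assert (HD : 0 <= D) by (unfold D; lra).
  destruct (INR_unbounded (K * (D * D) / e)) as [n Hn].
  assert (H0 : 0 <= K * (D * D) / e).
  { apply Rmult_le_pos; [nra|apply Rlt_le, Rinv_0_lt_compat; lra]. }
  assert (Hn0 : 0 < INR n) by lra.
  set (h := D / INR n). assert (Hh : 0 <= h) by (apply Rmult_le_pos; [exact HD|apply Rlt_le, Rinv_0_lt_compat; lra]).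
  assert (Hhn : INR n * h = D) by (unfold h; field; lra).
  assert (S : forall k, (k <= n)%nat -> q (b1 + INR k * h) <= q b1 + INR k * (h * B + K * (h * h))).
  { induction k as [|k IH]; intros Hk.
    - simpl. replace (b1 + 0 * h) with b1 by ring. lra.
    - specialize (IH ltac:(lia)). rewrite S_INR.
      assert (Hk1 : INR k + 1 <= INR n) by (rewrite <- S_INR; apply le_INR; lia).
      assert (Hk0 := pos_INR k).
      assert ((INR k + 1) * h <= D) by (rewrite <- Hhn; apply Rmult_le_compat_r; lra).
      assert (0 <= INR k * h) by nra.
      specialize (Hq (b1 + INR k * h) (b1 + (INR k + 1) * h) ltac:(lra) ltac:(lra) ltac:(unfold D in *; lra)).
      replace (b1 + (INR k + 1) * h - (b1 + INR k * h)) with h in Hq by ring. lra. }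
  specialize (S n (Nat.le_refl n)). rewrite Hhn in S. replace (b1 + D) with b2 in S by (unfold D; ring).
  assert (INR n * (K * (h * h)) <= e).
  { replace (INR n * (K * (h * h))) with (K * (D * D) / INR n) by (unfold h; field; lra).
    apply Rmult_le_reg_r with (INR n); [lra|].
    replace (K * (D * D) / INR n * INR n) with (K * (D * D) / e * e) by (field; lra). nra. }
  replace (INR n * (h * B + K * (h * h))) with (INR n * h * B + INR n * (K * (h * h))) in S by ring.
  rewrite Hhn in S. fold D. lra.
Qed.

Section Multipliers.
Context {X : CompleteNormedModule C_AbsRing}.
Implicit Types w x z v : R -> X.
Implicit Types gam : nat -> R.

(** Symmetric partial sum of the Fourier series in T_1: each coefficient acts on both T_n and
    T_{-n}, so only even multipliers occur. *)
Fixpoint psum gam w (m : nat) : R -> X :=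
  match m with
  | O => vsc (RtoC (gam O)) w
  | S m => vadd (psum gam w m)
      (vsc (RtoC (gam (S m))) (vadd (shift (INR (S m)) w) (shift (- INR (S m)) w)))
  end.

(** n times the Cesaro mean of the partial sums. *)
Fixpoint qsum gam w (n : nat) : R -> X :=
  match n with
  | O => vsc (RtoC 0) w
  | S n => vadd (qsum gam w n) (psum gam w n)
  end.

Lemma bdd_psum gam w m : bdd w -> bdd (psum gam w m).
Proof. intros Hw. induction m; simpl; auto with bdd. Qed.
Lemma bdd_qsum gam w n : bdd w -> bdd (qsum gam w n).
Proof. intros Hw. induction n; simpl; auto using bdd_psum with bdd. Qed.
Lemma BU_psum gam w m : BU w -> BU (psum gam w m).
Proof. intros Hw. induction m; simpl; auto with BU. Qed.

Lemma psum_lincomb k1 k2 g1 g2 w m t :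
  psum (fun n => k1 * g1 n + k2 * g2 n) w m t =
  plus (scal (RtoC k1) (psum g1 w m t)) (scal (RtoC k2) (psum g2 w m t)).
Proof.
  induction m as [|m IH]; simpl; unfold vadd, vsc.
  - rewrite RtoC_plus, !RtoC_mult. vring.
  - rewrite IH, RtoC_plus, !RtoC_mult. vring.
Qed.

Lemma qsum_lincomb k1 k2 g1 g2 w n t :
  qsum (fun n => k1 * g1 n + k2 * g2 n) w n t =
  plus (scal (RtoC k1) (qsum g1 w n t)) (scal (RtoC k2) (qsum g2 w n t)).
Proof.
  induction n as [|n IH]; simpl; unfold vadd; [unfold vsc; vring|].
  rewrite IH, psum_lincomb. vring.
Qed.

Lemma psum_ext g1 g2 w m t : (forall n, (n <= m)%nat -> g1 n = g2 n) ->
  psum g1 w m t = psum g2 w m t.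
Proof.
  induction m as [|m IH]; intros H; simpl; unfold vadd, vsc.
  - now rewrite H.
  - rewrite IH by (intros; apply H; lia). now rewrite (H (S m)).
Qed.

Lemma qsum_ext g1 g2 w n t : (forall m, (m < n)%nat -> g1 m = g2 m) ->
  qsum g1 w n t = qsum g2 w n t.
Proof.
  induction n as [|n IH]; intros H; simpl; unfold vadd; [reflexivity|].
  rewrite IH by (intros; apply H; lia). rewrite (psum_ext g1 g2); [reflexivity|].
  intros; apply H; lia.
Qed.

Lemma asn_pair w r : bdd w -> asn (vadd (shift r w) (shift (- r) w)) <= 2 * asn w.
Proof.
  intros Hw. eapply Rle_trans; [apply asn_vadd; auto with bdd|]. rewrite !asn_shift. lra.
Qed.

Lemma asn_vsc_R k w : bdd w -> asn (vsc (RtoC k) w) <= Rabs k * asn w.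
Proof. intros Hw. rewrite <- Cmod_R. now apply asn_vsc. Qed.

Lemma asn_psum_le gam w m d : bdd w -> (forall n, (n <= m)%nat -> Rabs (gam n) <= d) ->
  asn (psum gam w m) <= (2 * INR m + 1) * d * asn w.
Proof.
  intros Hw. assert (Hp := asn_ge0 w). induction m as [|m IH]; intros H.
  - simpl. eapply Rle_trans; [now apply asn_vsc_R|]. specialize (H 0%nat (Nat.le_refl _)).
    assert (Rabs (gam 0%nat) * asn w <= d * asn w) by (apply Rmult_le_compat_r; assumption). lra.
  - rewrite S_INR. simpl psum.
    eapply Rle_trans; [apply asn_vadd; auto using bdd_psum with bdd|].
    specialize (IH ltac:(intros; apply H; lia)). specialize (H (S m) (Nat.le_refl _)).
    eapply Rle_trans.
    { apply Rplus_le_compat; [exact IH|].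
      eapply Rle_trans; [apply asn_vsc_R; auto with bdd|].
      apply Rmult_le_compat; [apply Rabs_pos|apply asn_ge0|exact H|now apply asn_pair]. }
    lra.
Qed.

Lemma asn_qsum_le gam w N d : bdd w -> (forall n, (n <= N)%nat -> Rabs (gam n) <= d) ->
  asn (qsum gam w N) <= INR N * (2 * INR N + 1) * d * asn w.
Proof.
  intros Hw H. assert (Hp := asn_ge0 w).
  assert (Hd : 0 <= d).
  { apply Rle_trans with (2 := H 0%nat ltac:(lia)). apply Rabs_pos. }
  assert (K : forall n, (n <= N)%nat -> asn (qsum gam w n) <= INR n * ((2 * INR N + 1) * d * asn w)).
  { induction n as [|n IH]; intros Hn.
    - simpl. eapply Rle_trans; [now apply asn_vsc_R|]. rewrite Rabs_R0. lra.
    - rewrite S_INR. simpl qsum. eapply Rle_trans; [apply asn_vadd; auto using bdd_psum, bdd_qsum|].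
      specialize (IH ltac:(lia)).
      assert (B := asn_psum_le gam w n d Hw ltac:(intros; apply H; lia)).
      assert (Hnn : INR n <= INR N) by (apply le_INR; lia).
      assert ((2 * INR n + 1) * d * asn w <= (2 * INR N + 1) * d * asn w).
      { apply Rmult_le_compat_r; [exact Hp|]. apply Rmult_le_compat_r; [exact Hd|]. lra. }
      lra. }
  specialize (K N (Nat.le_refl _)). lra.
Qed.

(* [vp th r] is the power [r] of [e^{-i th} T_1]. *)
Definition vp (th r : R) w : R -> X := vsc (cis (- (th * r))) (shift r w).
Definition vdiff (th : R) w : R -> X := vsub (vp th 1 w) w.

Lemma vp_vp th r s w t : vp th r (vp th s w) t = vp th (s + r) w t.
Proof.
  unfold vp, vsc, shift. replace (- (th * (s + r))) with (- (th * r) + - (th * s)) by ring.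
  rewrite cis_plus. replace (t + (s + r)) with (t + r + s) by ring. vring.
Qed.

Lemma bdd_vp th r w : bdd w -> bdd (vp th r w).
Proof. intros; unfold vp; auto with bdd. Qed.

Lemma asn_vp th r w : bdd w -> asn (vp th r w) <= asn w.
Proof.
  intros Hw. unfold vp. eapply Rle_trans; [apply asn_vsc; auto with bdd|].
  rewrite Cmod_cis, asn_shift. lra.
Qed.

Fixpoint dirk (th : R) w (m : nat) : R -> X :=
  match m with
  | O => w
  | S m => vadd (dirk th w m) (vadd (vp th (INR (S m)) w) (vp th (- INR (S m)) w))
  end.

Fixpoint fej (th : R) w (n : nat) : R -> X :=
  match n with
  | O => vsc (RtoC 0) w
  | S n => vadd (fej th w n) (dirk th w n)
  end.

Lemma bdd_dirk th w m : bdd w -> bdd (dirk th w m).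
Proof. intros Hw. induction m; simpl; auto using bdd_vp with bdd. Qed.
Lemma bdd_fej th w n : bdd w -> bdd (fej th w n).
Proof. intros Hw. induction n; simpl; auto using bdd_dirk with bdd. Qed.

Lemma vdiff_dirk th w m t :
  vdiff th (dirk th w m) t = minus (vp th (INR m + 1) w t) (vp th (- INR m) w t).
Proof.
  induction m as [|m IH].
  - simpl. unfold vdiff, vsub. rewrite Rplus_0_l. apply f_equal.
    unfold vp, vsc, shift. rewrite Ropp_0, Rmult_0_r, Ropp_0, cis_0, Rplus_0_r. vring.
  - rewrite S_INR. change (dirk th w (S m)) with
      (vadd (dirk th w m) (vadd (vp th (INR (S m)) w) (vp th (- INR (S m)) w))). rewrite S_INR.
    assert (E1 := vp_vp th 1 (INR m + 1) w t). assert (E2 := vp_vp th 1 (- (INR m + 1)) w t).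
    replace (- (INR m + 1) + 1) with (- INR m) in E2 by ring.
    transitivity (plus (vdiff th (dirk th w m) t)
      (plus (minus (vp th 1 (vp th (INR m + 1) w) t) (vp th (INR m + 1) w t))
            (minus (vp th 1 (vp th (- (INR m + 1)) w) t) (vp th (- (INR m + 1)) w t)))).
    + unfold vdiff, vsub, vadd, vp, vsc, shift. vring.
    + rewrite IH, E1, E2. vring.
Qed.

(** With V = e^{- i th} T_1: one difference V - 1 telescopes the Dirichlet sum, a second one the
    Fejer sum. The result has seminorm at most 4 |w| for every n, so a lower bound for V - 1, used
    twice, bounds the Fejer sums uniformly. *)
Lemma vdiff2_fej th w n t :
  vdiff th (vdiff th (fej th w n)) t =
  plus (minus (vp th (INR n + 1) w t) (scal (RtoC 2) (vp th 1 w t))) (vp th (1 - INR n) w t).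
Proof.
  induction n as [|n IH].
  - simpl. rewrite Rplus_0_l, Rminus_0_r. unfold vdiff, vsub, vp, vsc, shift. v_prep; apply injective_projections; simpl; ring.
  - rewrite S_INR. change (fej th w (S n)) with (vadd (fej th w n) (dirk th w n)).
    assert (Ed : vdiff th (dirk th w n) = fun t => minus (vp th (INR n + 1) w t) (vp th (- INR n) w t)).
    { apply functional_extensionality; intros s; apply vdiff_dirk. }
    assert (E1 := vp_vp th 1 (INR n + 1) w t). assert (E2 := vp_vp th 1 (- INR n) w t).
    replace (- INR n + 1) with (1 - INR n) in E2 by ring.
    transitivity (plus (vdiff th (vdiff th (fej th w n)) t) (vdiff th (vdiff th (dirk th w n)) t)).
    + unfold vdiff, vsub, vadd, vp, vsc, shift. vring.
    + rewrite IH, Ed. replace (1 - (INR n + 1)) with (- INR n) by ring.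
      transitivity (plus (plus (minus (vp th (INR n + 1) w t) (scal (RtoC 2) (vp th 1 w t))) (vp th (1 - INR n) w t))
        (minus (minus (vp th 1 (vp th (INR n + 1) w) t) (vp th 1 (vp th (- INR n) w) t))
               (minus (vp th (INR n + 1) w t) (vp th (- INR n) w t)))).
      * apply f_equal. unfold vdiff, vsub. apply (f_equal (fun y => minus y _)).
        unfold vp, vsc, shift. vring.
      * rewrite E1, E2. vring.
Qed.

(** The multiplier estimates are needed on two spaces: homogeneous solutions in [phi_periodic] and
    asymptotically periodic functions in [phi_identity]. *)
Record stable (M : (R -> X) -> Prop) : Prop := {
  stable_vadd : forall x y, M x -> M y -> M (vadd x y);
  stable_vsc : forall c x, M x -> M (vsc c x);
  stable_shift : forall r x, M x -> M (shift r x);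
  stable_bdd : forall x, M x -> bdd x }.

Lemma stable_vsub M x y : stable M -> M x -> M y -> M (vsub x y).
Proof.
  intros HM Hx Hy. replace (vsub x y) with (vadd x (vsc (RtoC (-1)) y)).
  - apply (stable_vadd M HM); [exact Hx|now apply (stable_vsc M HM)].
  - apply functional_extensionality. intros t. unfold vadd, vsub, vsc. vring.
Qed.

Lemma stable_vp M th r x : stable M -> M x -> M (vp th r x).
Proof. intros HM Hx. apply (stable_vsc M HM), (stable_shift M HM), Hx. Qed.

Lemma stable_fej M th w n : stable M -> M w -> M (fej th w n).
Proof.
  intros HM Hw.
  assert (D : forall m, M (dirk th w m)).
  { induction m; simpl; [exact Hw|].
    repeat apply (stable_vadd M HM); trivial; now apply stable_vp. }
  induction n; simpl; [now apply (stable_vsc M HM)|]. now apply (stable_vadd M HM).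
Qed.

Lemma asn_fej M th w n c : stable M -> M w -> 0 < c ->
  (forall z, M z -> c * asn z <= asn (eigdev th 1 z)) ->
  asn (fej th w n) <= 4 / (c * c) * asn w.
Proof.
  intros HM Hw Hc Hlow.
  assert (K : forall z, M z -> c * asn z <= asn (vdiff th z)).
  { intros z Hz. eapply Rle_trans; [now apply Hlow|].
    assert (Hb := stable_bdd M HM z Hz).
    rewrite (asn_ext (eigdev th 1 z) (vsc (cis th) (vdiff th z))).
    - eapply Rle_trans; [apply asn_vsc|].
      + unfold vdiff. auto using bdd_vp with bdd.
      + rewrite Cmod_cis. lra.
    - intros t. unfold eigdev, vdiff, vp, vsub, vsc, shift. rewrite !Rmult_1_r.
      transitivity (minus (scal (cis th * cis (- th))%C (z (t + 1))) (scal (cis th) (z t))).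
      + rewrite cis_opp_mult. vring.
      + vring. }
  assert (HF := stable_fej M th w n HM Hw).
  assert (HD : M (vdiff th (fej th w n))).
  { unfold vdiff. apply stable_vsub; trivial. now apply stable_vp. }
  assert (K1 := K _ HF). assert (K2 := K _ HD). assert (Hb := stable_bdd M HM w Hw).
  assert (K3 : asn (vdiff th (vdiff th (fej th w n))) <= 4 * asn w).
  { rewrite (asn_ext _ (vadd (vsub (vp th (INR n + 1) w) (vsc (RtoC 2) (vp th 1 w))) (vp th (1 - INR n) w)))
      by (intros t; apply vdiff2_fej).
    assert (B1 := asn_vp th (INR n + 1) w Hb). assert (B2 := asn_vp th 1 w Hb).
    assert (B3 := asn_vp th (1 - INR n) w Hb).
    assert (B4 := asn_vsc_R 2 (vp th 1 w) (bdd_vp th 1 w Hb)). rewrite Rabs_pos_eq in B4 by lra.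
    eapply Rle_trans; [apply asn_vadd; auto using bdd_vp with bdd|].
    eapply Rle_trans; [apply Rplus_le_compat_r, asn_vsub; auto using bdd_vp with bdd|]. lra. }
  apply Rmult_le_reg_l with (c * c); [nra|].
  replace (c * c * (4 / (c * c) * asn w)) with (4 * asn w) by (field; lra). nra.
Qed.

Lemma cos_psum th w m t :
  scal (RtoC 2) (psum (fun n => cos (INR n * th)) w m t) = plus (dirk th w m t) (dirk (- th) w m t).
Proof.
  induction m as [|m IH].
  - simpl. unfold vsc. rewrite Rmult_0_l, cos_0. v_prep. apply injective_projections; simpl; ring.
  - change (psum (fun n => cos (INR n * th)) w (S m)) with
      (vadd (psum (fun n => cos (INR n * th)) w m)
        (vsc (RtoC (cos (INR (S m) * th))) (vadd (shift (INR (S m)) w) (shift (- INR (S m)) w)))).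
    change (dirk th w (S m)) with (vadd (dirk th w m) (vadd (vp th (INR (S m)) w) (vp th (- INR (S m)) w))).
    change (dirk (- th) w (S m)) with
      (vadd (dirk (- th) w m) (vadd (vp (- th) (INR (S m)) w) (vp (- th) (- INR (S m)) w))).
    set (r := INR (S m)). unfold vadd, vsc, vp, shift.
    transitivity (plus (plus (dirk th w m t) (dirk (- th) w m t))
      (scal (RtoC 2 * RtoC (cos (r * th)))%C (plus (w (t + r)) (w (t + - r))))).
    + rewrite <- IH. unfold vsc, shift. vring.
    + assert (E : (RtoC 2 * RtoC (cos (r * th)))%C = (cis (- (th * r)) + cis (th * r))%C).
      { unfold cis. rewrite cos_neg, sin_neg, (Rmult_comm r). apply injective_projections; simpl; ring. }
      rewrite E. unfold vsc, shift.
      replace (- (- th * r)) with (th * r) by ring. replace (- (- th * - r)) with (- (th * r)) by ring.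
      replace (- (th * - r)) with (th * r) by ring. vring.
Qed.

Lemma cos_qsum th w n t :
  scal (RtoC 2) (qsum (fun n => cos (INR n * th)) w n t) = plus (fej th w n t) (fej (- th) w n t).
Proof.
  induction n as [|n IH]; simpl; unfold vadd.
  - unfold vsc. v_prep. apply injective_projections; simpl; ring.
  - transitivity (plus (plus (fej th w n t) (fej (- th) w n t)) (plus (dirk th w n t) (dirk (- th) w n t))).
    + rewrite <- IH, <- cos_psum. vring.
    + vring.
Qed.

Lemma asn_cos_qsum M th w n c : stable M -> M w -> 0 < c ->
  (forall z, M z -> c * asn z <= asn (eigdev th 1 z)) ->
  (forall z, M z -> c * asn z <= asn (eigdev (- th) 1 z)) ->
  asn (qsum (fun n => cos (INR n * th)) w n) <= 4 / (c * c) * asn w.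
Proof.
  intros HM Hw Hc H1 H2. assert (Hb := stable_bdd M HM w Hw).
  assert (F1 := asn_fej M th w n c HM Hw Hc H1). assert (F2 := asn_fej M (- th) w n c HM Hw Hc H2).
  rewrite (asn_ext _ (vsc (RtoC (/ 2)) (vadd (fej th w n) (fej (- th) w n)))).
  - eapply Rle_trans; [apply asn_vsc_R; auto using bdd_fej with bdd|]. rewrite Rabs_pos_eq by lra.
    assert (K : asn (vadd (fej th w n) (fej (- th) w n)) <= asn (fej th w n) + asn (fej (- th) w n))
      by (apply asn_vadd; now apply bdd_fej). lra.
  - intros t. unfold vsc, vadd. rewrite <- cos_qsum. v_prep. apply injective_projections; simpl; field.
Qed.

End Multipliers.

(** * Fourier multipliers *)

Definition lipschitz (f : R -> R) (L : R) : Prop := forall x y, Rabs (f x - f y) <= L * Rabs (x - y).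

Lemma lipschitz_continuous f L : 0 <= L -> lipschitz f L -> forall x, continuous f x.
Proof.
  intros HL Hf x. apply (filterlim_locally (U := R_UniformSpace)). intros [e He].
  assert (Hd : 0 < e / (L + 1)) by (apply Rdiv_lt_0_compat; lra).
  exists (mkposreal _ Hd). intros y Hy. change (Rabs (y - x) < e / (L + 1)) in Hy.
  change (Rabs (f y - f x) < e). eapply Rle_lt_trans; [apply Hf|].
  assert (H0 := Rabs_pos (y - x)).
  apply Rle_lt_trans with ((L + 1) * Rabs (y - x)); [nra|].
  apply (Rmult_lt_compat_l (L + 1)) in Hy; [|lra].
  replace ((L + 1) * (e / (L + 1))) with e in Hy by (field; lra). exact Hy.
Qed.

Lemma ex_RInt_lipschitz f L u v : 0 <= L -> lipschitz f L -> ex_RInt f u v.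
Proof.
  intros HL Hf. apply (ex_RInt_continuous (V := R_CompleteNormedModule)). intros z _.
  now apply lipschitz_continuous with L.
Qed.

Lemma lipschitz_mult_cos f L k : 0 <= k -> lipschitz f L -> (forall x, Rabs (f x) <= 1) ->
  lipschitz (fun x => f x * cos (k * x)) (L + k).
Proof.
  intros Hk Hf Hb x y.
  replace (f x * cos (k * x) - f y * cos (k * y))
    with ((f x - f y) * cos (k * x) + f y * (cos (k * x) - cos (k * y))) by ring.
  eapply Rle_trans; [apply Rabs_triang|]. rewrite !Rabs_mult, Rmult_plus_distr_r.
  assert (C1 : Rabs (cos (k * x)) <= 1) by apply Rabs_le, COS_bound.
  assert (C2 := cos_lip (k * x) (k * y)).
  replace (k * x - k * y) with (k * (x - y)) in C2 by ring.
  rewrite Rabs_mult, (Rabs_pos_eq k) in C2 by exact Hk.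
  specialize (Hf x y). specialize (Hb y). assert (H0 := Rabs_pos (f x - f y)).
  assert (H1 := Rabs_pos (f y)). assert (H2 := Rabs_pos (cos (k * x))).
  assert (H3 := Rabs_pos (cos (k * x) - cos (k * y))).
  apply Rplus_le_compat; nra.
Qed.

Lemma RInt_lipschitz_step f L x y : 0 <= L -> lipschitz f L -> x <= y ->
  Rabs (RInt f x y - (y - x) * f x) <= L * ((y - x) * (y - x)).
Proof.
  intros HL Hf Hxy.
  assert (X1 := RInt_correct (V := R_CompleteNormedModule) f x y (ex_RInt_lipschitz f L x y HL Hf)).
  assert (X2 := is_RInt_const (V := R_NormedModule) x y (f x)).
  assert (X3 := is_RInt_minus (V := R_NormedModule) _ _ _ _ _ _ X1 X2).
  replace (L * ((y - x) * (y - x))) with ((y - x) * (L * (y - x))) by ring.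
  apply (norm_RInt_le_const (V := R_NormedModule) (fun s => minus (f s) (f x)) x y
    (minus (RInt f x y) (scal (y - x) (f x))) (L * (y - x)) Hxy).
  - intros s Hs. eapply Rle_trans; [apply (Hf s x)|]. apply Rmult_le_compat_l; [exact HL|].
    rewrite Rabs_pos_eq; lra.
  - exact X3.
Qed.

(** The n-th complex Fourier coefficient of the even extension of f, so that f(x) is formally
    [coef f 0] plus the sum of [coef f n] (e^{inx} + e^{-inx}). *)
Definition coef (f : R -> R) (n : nat) : R := / PI * RInt (fun x => f x * cos (INR n * x)) 0 PI.

Section Spectral.
Context {X : CompleteNormedModule C_AbsRing}.
Implicit Types w z v : R -> X.
Implicit Types gam : nat -> R.

(** The sum is the mean over x of f(x) times the Fejer sums at x and - x; these are bounded
    independently of N wherever f is nonzero. *)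
Lemma asn_coef_qsum M f L w N c b1 b2 : stable M -> M w -> 0 < c -> 0 <= L ->
  lipschitz f L -> (forall x, Rabs (f x) <= 1) ->
  (forall x, 0 <= x <= PI -> f x <> 0 -> b1 <= x <= b2) ->
  (forall th z, b1 <= th <= b2 -> M z -> c * asn z <= asn (eigdev th 1 z)) ->
  (forall th z, b1 <= th <= b2 -> M z -> c * asn z <= asn (eigdev (- th) 1 z)) ->
  asn (qsum (coef f) w N) <= 4 / (c * c) * asn w.
Proof.
  intros HM Hw Hc HL Hf Hf1 Hsupp Hlow1 Hlow2.
  assert (P := PI_RGT_0). assert (Hb := stable_bdd M HM w Hw). assert (Hp := asn_ge0 w).
  set (B := 4 / (c * c) * asn w).
  assert (HB : 0 <= B).
  { apply Rmult_le_pos; [apply Rlt_le, Rdiv_lt_0_compat; nra|exact Hp]. }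
  set (g := fun (n : nat) x => f x * cos (INR n * x)).
  assert (Hg : forall n, lipschitz (g n) (L + INR n)).
  { intros n. apply lipschitz_mult_cos; trivial. apply pos_INR. }
  assert (Hex : forall n s r, ex_RInt (g n) s r).
  { intros n s r. apply ex_RInt_lipschitz with (L + INR n); [|apply Hg].
    generalize (pos_INR n). lra. }
  (* Seminorm of the integral taken up to y. Over a short step it grows by at most B times the
     length plus a quadratic error, because f is Lipschitz, so [subadditive_bound] applies. *)
  set (q := fun y => asn (qsum (fun n => RInt (g n) 0 y) w N)).
  set (D := INR N * (2 * INR N + 1)).
  assert (HD : 0 <= D) by (assert (H := pos_INR N); unfold D; nra).
  assert (HN := pos_INR N).
  assert (main : q PI <= q 0 + (PI - 0) * B).
  { apply (subadditive_bound q 0 PI B (D * (L + INR N) * asn w)); [lra| |].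
    { apply Rmult_le_pos; [apply Rmult_le_pos; lra|exact Hp]. }
    intros x y H0x Hxy Hy. unfold q.
    set (rho := fun n => RInt (g n) x y - (y - x) * g n x).
    assert (E : forall t, qsum (fun n => RInt (g n) 0 y) w N t =
      vadd (vadd (qsum (fun n => RInt (g n) 0 x) w N) (vsc (RtoC ((y - x) * f x)) (qsum (fun n => cos (INR n * x)) w N)))
           (qsum rho w N) t).
    { intros t. unfold vadd, vsc.
      transitivity (qsum (fun n => 1 * (1 * RInt (g n) 0 x + ((y - x) * f x) * cos (INR n * x)) + 1 * rho n) w N t).
      - apply qsum_ext. intros n _.
        rewrite <- (RInt_Chasles (V := R_CompleteNormedModule) (g n) 0 x y) by apply Hex.
        unfold plus; simpl. unfold rho, g. ring.
      - rewrite (qsum_lincomb 1 1 (fun n => 1 * RInt (g n) 0 x + ((y - x) * f x) * cos (INR n * x)) rho).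
        rewrite (qsum_lincomb 1 ((y - x) * f x) (fun n => RInt (g n) 0 x) (fun n => cos (INR n * x))). vring. }
    rewrite (asn_ext _ _ E).
    assert (B1 : asn (vsc (RtoC ((y - x) * f x)) (qsum (fun n => cos (INR n * x)) w N)) <= (y - x) * B).
    { eapply Rle_trans; [apply asn_vsc_R, bdd_qsum, Hb|]. rewrite Rabs_mult, (Rabs_pos_eq (y - x)) by lra.
      rewrite Rmult_assoc. apply Rmult_le_compat_l; [lra|].
      destruct (Req_dec (f x) 0) as [Hfx|Hfx]; [rewrite Hfx, Rabs_R0, Rmult_0_l; exact HB|].
      specialize (Hsupp x ltac:(lra) Hfx).
      assert (Q := asn_cos_qsum M x w N c HM Hw Hc (fun z => Hlow1 x z Hsupp) (fun z => Hlow2 x z Hsupp)).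
      fold B in Q. specialize (Hf1 x). assert (H1 := Rabs_pos (f x)).
      assert (H2 := asn_ge0 (qsum (fun n => cos (INR n * x)) w N)). nra. }
    assert (B2 : asn (qsum rho w N) <= D * (L + INR N) * asn w * ((y - x) * (y - x))).
    { eapply Rle_trans; [apply (asn_qsum_le rho w N ((L + INR N) * ((y - x) * (y - x))) Hb)|].
      - intros n Hn. unfold rho. assert (Hn' : INR n <= INR N) by now apply le_INR.
        assert (H0n := pos_INR n).
        eapply Rle_trans; [apply (RInt_lipschitz_step (g n) (L + INR n)); [lra|apply Hg|exact Hxy]|].
        apply Rmult_le_compat_r; [nra|lra].
      - right. unfold D. ring. }
    eapply Rle_trans; [apply asn_vadd; auto using bdd_qsum with bdd|].
    eapply Rle_trans; [apply Rplus_le_compat_r, asn_vadd; auto using bdd_qsum with bdd|].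
    lra. }
  assert (q0 : q 0 <= 0).
  { unfold q. eapply Rle_trans; [apply (asn_qsum_le _ w N 0 Hb)|right; ring].
    intros n _. rewrite (RInt_point (V := R_CompleteNormedModule)). unfold zero; simpl. rewrite Rabs_R0. lra. }
  rewrite (asn_ext _ (vsc (RtoC (/ PI)) (qsum (fun n => RInt (g n) 0 PI) w N))).
  - eapply Rle_trans; [apply asn_vsc_R, bdd_qsum, Hb|].
    rewrite Rabs_pos_eq by (apply Rlt_le, Rinv_0_lt_compat; lra).
    fold (q PI). apply Rle_trans with (/ PI * (PI * B)).
    + apply Rmult_le_compat_l; [apply Rlt_le, Rinv_0_lt_compat; lra|lra].
    + right. field. lra.
  - intros t. unfold vsc.
    transitivity (qsum (fun n => / PI * RInt (g n) 0 PI + 0 * 0) w N t).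
    + apply qsum_ext. intros n _. unfold coef, g. ring.
    + rewrite (qsum_lincomb (/ PI) 0 (fun n => RInt (g n) 0 PI) (fun _ => 0)). vring.
Qed.

Definition decay gam (C : R) : Prop := forall n, (1 <= n)%nat -> Rabs (gam n) <= C / (INR n * INR n).

(** v is phi(T_1) z. The rate 1/m is that of the tail of the sum of 1/n^2, and its uniformity in t
    lets boundedness, continuity and vanishing pass to v. *)
Definition is_phi gam z v : Prop := exists C, 0 <= C /\
  forall m t, (1 <= m)%nat -> norm (minus (v t) (psum gam z m t)) <= C / INR m.

Lemma inv_sq_telescope n : (1 <= n)%nat -> / (INR (S n) * INR (S n)) <= / INR n - / INR (S n).
Proof.
  intros Hn. rewrite S_INR. assert (H : 1 <= INR n) by (change 1 with (INR 1); now apply le_INR).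
  apply Rmult_le_reg_r with ((INR n + 1) * (INR n + 1)); [nra|].
  replace (/ ((INR n + 1) * (INR n + 1)) * ((INR n + 1) * (INR n + 1))) with 1 by (field; lra).
  replace ((/ INR n - / (INR n + 1)) * ((INR n + 1) * (INR n + 1))) with (1 + / INR n) by (field; lra).
  assert (0 < / INR n) by (apply Rinv_0_lt_compat; lra). lra.
Qed.

Lemma psum_S gam z m t : psum gam z (S m) t =
  plus (psum gam z m t) (scal (RtoC (gam (S m))) (plus (z (t + INR (S m))) (z (t + - INR (S m))))).
Proof. reflexivity. Qed.

Lemma psum_tail gam z C M m k t : 0 <= C -> decay gam C -> (forall t, norm (z t) <= M) -> (1 <= m)%nat ->
  norm (minus (psum gam z (m + k) t) (psum gam z m t)) <= 2 * M * C * (/ INR m - / INR (m + k)).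
Proof.
  intros HC Hd HM Hm.
  assert (HM0 : 0 <= M) by (apply Rle_trans with (2 := HM 0); apply norm_ge_0).
  induction k as [|k IH].
  - rewrite Nat.add_0_r. norm_as (zero : X). rewrite norm_zero_C, Rminus_diag_eq; [lra|reflexivity].
  - rewrite Nat.add_succ_r, psum_S.
    set (n := (m + k)%nat) in *.
    assert (Hn : (1 <= n)%nat) by (unfold n; lia).
    assert (T := inv_sq_telescope n Hn).
    norm_as (plus (minus (psum gam z n t) (psum gam z m t))
      (scal (RtoC (gam (S n))) (plus (z (t + INR (S n))) (z (t + - INR (S n)))))).
    eapply Rle_trans; [apply norm_plus_le|].
    assert (B : norm (scal (RtoC (gam (S n))) (plus (z (t + INR (S n))) (z (t + - INR (S n)))))
       <= 2 * M * C * / (INR (S n) * INR (S n))).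
    { eapply Rle_trans; [apply norm_scal_real|].
      specialize (Hd (S n) ltac:(lia)).
      assert (norm (plus (z (t + INR (S n))) (z (t + - INR (S n)))) <= 2 * M).
      { eapply Rle_trans; [apply norm_plus_le|].
        generalize (HM (t + INR (S n))) (HM (t + - INR (S n))). lra. }
      apply Rle_trans with (C / (INR (S n) * INR (S n)) * (2 * M)).
      - apply Rmult_le_compat; trivial; [apply Rabs_pos|apply norm_ge_0].
      - right. unfold Rdiv. ring. }
    assert (2 * M * C * / (INR (S n) * INR (S n)) <= 2 * M * C * (/ INR n - / INR (S n))).
    { apply Rmult_le_compat_l; [nra|exact T]. }
    lra.
Qed.

Lemma is_phi_exists gam C z : 0 <= C -> decay gam C -> bdd z -> exists v, is_phi gam z v.
Proof.
  intros HC Hd Hz. destruct (bdd_pos z Hz) as [M [HM0 HM]].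
  assert (HMC : 0 <= 2 * M * C) by nra.
  assert (tail : forall m k t, (1 <= m)%nat ->
    norm (minus (psum gam z (m + k) t) (psum gam z m t)) <= 2 * M * C / INR m).
  { intros m k t Hm. eapply Rle_trans; [now apply (psum_tail gam z C M)|].
    assert (0 < / INR (m + k)).
    { apply Rinv_0_lt_compat. generalize (INR_ge1 (m + k) ltac:(lia)). lra. }
    unfold Rdiv. nra. }
  assert (lim : forall t, exists y : X, filterlim (fun m => psum gam z m t) eventually (locally y)).
  { intros t. apply (filterlim_locally_cauchy (U := X)). intros [e He].
    destruct (div_INR_small (2 * M * C) (e / 3)) as [N [HN1 HN2]]; [exact HMC|lra|].
    specialize (HN2 N (Nat.le_refl N)).
    exists (fun n => (N <= n)%nat). split; [now exists N|].
    intros i j Hi Hj. apply (norm_compat1 (V := X)).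
    assert (T1 := tail N (i - N)%nat t HN1). assert (T2 := tail N (j - N)%nat t HN1).
    replace (N + (i - N))%nat with i in T1 by lia. replace (N + (j - N))%nat with j in T2 by lia.
    simpl. eapply Rle_lt_trans; [apply (norm_minus_trans (psum gam z j t) (psum gam z N t))|].
    rewrite (norm_minus_sym (psum gam z N t)). lra. }
  set (v := fun t => proj1_sig (constructive_indefinite_description _ (lim t))).
  exists v, (2 * M * C). split; [exact HMC|]. intros m t Hm.
  assert (Hv : filterlim (fun m => psum gam z m t) eventually (locally (v t))).
  { exact (proj2_sig (constructive_indefinite_description _ (lim t))). }
  apply le_epsilon. intros e He.
  destruct (proj1 (filterlim_locally_ball_norm (K := C_AbsRing) (U := X) (F := eventually) _ _) Hv (mkposreal e He))
    as [N HN].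
  specialize (HN (m + N)%nat ltac:(lia)).
  change (norm (minus (psum gam z (m + N) t) (v t)) < e) in HN.
  specialize (tail m N t Hm).
  eapply Rle_trans; [apply (norm_minus_trans (v t) (psum gam z (m + N) t))|].
  rewrite (norm_minus_sym (v t)). lra.
Qed.

Lemma is_phi_unique gam z v v' t : is_phi gam z v -> is_phi gam z v' -> v t = v' t.
Proof.
  intros [C [HC H]] [C' [HC' H']]. apply eq_of_small_norm. intros e He.
  destruct (div_INR_small (C + C') e) as [m [Hm1 Hsmall]]; [lra|exact He|].
  specialize (Hsmall m (Nat.le_refl m)). specialize (H m t Hm1). specialize (H' m t Hm1).
  eapply Rle_trans; [apply (norm_minus_trans _ (psum gam z m t))|].
  rewrite (norm_minus_sym (psum gam z m t)). unfold Rdiv in *. lra.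
Qed.

Lemma bdd_is_phi gam z v : bdd z -> is_phi gam z v -> bdd v.
Proof.
  intros Hz [C [HC H]]. destruct (bdd_psum gam z 1 Hz) as [M HM]. exists (M + C / INR 1).
  intros t. eapply Rle_trans; [apply (norm_le_minus (v t) (psum gam z 1 t))|].
  specialize (H 1%nat t (Nat.le_refl _)). specialize (HM t). lra.
Qed.

Lemma BU_is_phi gam z v : BU z -> is_phi gam z v -> BU v.
Proof.
  intros Hz Hv. split; [apply (bdd_is_phi gam z); [apply Hz|exact Hv]|].
  destruct Hv as [C [HC H]]. intros e He.
  destruct (div_INR_small C (e / 4)) as [m [Hm1 HCm]]; [exact HC|lra|].
  specialize (HCm m (Nat.le_refl m)).
  destruct (proj2 (BU_psum gam z m Hz) (e / 4)) as [d [Hd Hp]]; [lra|].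
  exists d. split; [exact Hd|]. intros s t Hst. specialize (Hp s t Hst).
  assert (H1 := H m s Hm1). assert (H2 := H m t Hm1).
  eapply Rle_lt_trans; [apply (norm_minus_trans _ (psum gam z m t))|].
  eapply Rle_lt_trans; [apply Rplus_le_compat_l, (norm_minus_trans _ (psum gam z m s))|].
  rewrite (norm_minus_sym _ (v s)). lra.
Qed.

Lemma psum_vsub gam z z' m t :
  psum gam (vsub z z') m t = minus (psum gam z m t) (psum gam z' m t).
Proof.
  induction m as [|m IH]; simpl; unfold vadd.
  - unfold vsc, vsub. vring.
  - rewrite IH. unfold vsc, vsub, shift. vring.
Qed.

Lemma psum_linear (A : X -> X) gam z m t : is_linear A ->
  psum gam (fun t => A (z t)) m t = A (psum gam z m t).
Proof.
  intros HA. induction m as [|m IH]; simpl; unfold vadd.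
  - unfold vsc. now rewrite (linear_scal A HA).
  - rewrite IH. unfold vsc, shift. now rewrite !(linear_plus A HA), !(linear_scal A HA), (linear_plus A HA).
Qed.

Lemma psum_shift gam r z m t : psum gam (shift r z) m t = psum gam z m (t + r).
Proof.
  induction m as [|m IH]; simpl; unfold vadd; [reflexivity|].
  rewrite IH. unfold vsc, shift.
  set (k := match m with O => 1 | S _ => INR m + 1 end).
  replace (t + k + r) with (t + r + k) by ring. replace (t + - k + r) with (t + r + - k) by ring. reflexivity.
Qed.

Lemma is_phi_vsub gam z z' v v' : is_phi gam z v -> is_phi gam z' v' -> is_phi gam (vsub z z') (vsub v v').
Proof.
  intros [C [HC H]] [C' [HC' H']]. exists (C + C'). split; [lra|]. intros m t Hm.
  rewrite psum_vsub. unfold vsub.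
  norm_as (minus (minus (v t) (psum gam z m t)) (minus (v' t) (psum gam z' m t))).
  eapply Rle_trans; [apply norm_minus_le|]. specialize (H m t Hm). specialize (H' m t Hm).
  unfold Rdiv in *. lra.
Qed.

Lemma is_phi_linear (A : X -> X) gam z v : is_linear A -> is_phi gam z v ->
  is_phi gam (fun t => A (z t)) (fun t => A (v t)).
Proof.
  intros HA [C [HC H]]. destruct (linear_norm A HA) as [K [HK HKn]]. exists (K * C). split; [nra|].
  intros m t Hm. rewrite (psum_linear A gam z m t HA), <- (is_linear_minus A HA).
  eapply Rle_trans; [apply HKn|]. unfold Rdiv. rewrite Rmult_assoc. apply Rmult_le_compat_l; [lra|now apply H].
Qed.

Lemma is_phi_shift gam r z v : is_phi gam z v -> is_phi gam (shift r z) (shift r v).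
Proof.
  intros [C [HC H]]. exists C. split; [exact HC|]. intros m t Hm. rewrite psum_shift. now apply H.
Qed.

Lemma is_phi_coef_minus g1 g2 z v1 v2 : is_phi g1 z v1 -> is_phi g2 z v2 ->
  is_phi (fun n => g1 n - g2 n) z (vsub v1 v2).
Proof.
  intros [C [HC H]] [C' [HC' H']]. exists (C + C'). split; [lra|]. intros m t Hm.
  assert (E : psum (fun n => g1 n - g2 n) z m t = minus (psum g1 z m t) (psum g2 z m t)).
  { transitivity (psum (fun n => 1 * g1 n + -1 * g2 n) z m t).
    - apply psum_ext. intros; ring.
    - rewrite psum_lincomb. vring. }
  rewrite E. unfold vsub.
  norm_as (minus (minus (v1 t) (psum g1 z m t)) (minus (v2 t) (psum g2 z m t))).
  eapply Rle_trans; [apply norm_minus_le|]. specialize (H m t Hm). specialize (H' m t Hm).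
  unfold Rdiv in *. lra.
Qed.

Lemma asn_is_phi_tail gam z v C m : (1 <= m)%nat ->
  (forall t, norm (minus (v t) (psum gam z m t)) <= C / INR m) -> asn (vsub v (psum gam z m)) <= C / INR m.
Proof. intros Hm H. apply asn_le_evle. exists 0. intros t _. apply H. Qed.

Lemma vanish_is_phi gam C z v : 0 <= C -> decay gam C -> bdd z -> is_phi gam z v -> vanish z -> vanish v.
Proof.
  intros HC Hd Hz [C' [HC' Hv]] Hvan e He.
  assert (K : forall m, vanish (psum gam z m)).
  { induction m as [|m IH]; simpl; [now apply vanish_vsc|].
    apply vanish_vadd; [exact IH|]. apply vanish_vsc, vanish_vadd; now apply vanish_shift. }
  destruct (div_INR_small C' (e / 2)) as [m [Hm1 HCm]]; [exact HC'|lra|].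
  specialize (HCm m (Nat.le_refl m)).
  destruct (K m (e / 2)) as [T HT]; [lra|]. exists T. intros t Ht.
  eapply Rle_trans; [apply (norm_le_minus (v t) (psum gam z m t))|].
  specialize (HT t Ht). specialize (Hv m t Hm1). lra.
Qed.

(* Cesaro: [qsum gam w N] divided by [N] tends to [v]. *)
Lemma asn_is_phi_zero gam w v B : bdd w -> is_phi gam w v ->
  (forall N, asn (qsum gam w N) <= B) -> asn v = 0.
Proof.
  intros Hw Hphi HB. assert (Hbv := bdd_is_phi gam w v Hw Hphi). destruct Hphi as [C [HC Hv]].
  apply Rle_antisym; [|apply asn_ge0]. apply Rnot_lt_le. intros He. set (e := asn v) in *.
  set (T := asn (vsub v (psum gam w 0)) + C). assert (HT : C <= T) by (unfold T; generalize (asn_ge0 (vsub v (psum gam w 0))); lra).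
  assert (tailT : forall m, asn (vsub v (psum gam w m)) <= T).
  { intros [|m]; [unfold T; lra|]. eapply Rle_trans; [apply (asn_is_phi_tail gam w v C); [lia|intros; apply Hv; lia]|].
    apply Rle_trans with (2 := HT). assert (H1 := INR_ge1 (S m) ltac:(lia)).
    apply Rmult_le_reg_r with (INR (S m)); [lra|].
    replace (C / INR (S m) * INR (S m)) with C by (field; lra). nra. }
  destruct (div_INR_small C (e / 2)) as [m0 [Hm0 Hsmall]]; [exact HC|lra|].
  assert (Hm00 := pos_INR m0).
  assert (tail2 : forall m, (m0 <= m)%nat -> asn (vsub v (psum gam w m)) <= e / 2).
  { intros m Hm. apply Rle_trans with (2 := Hsmall m Hm).
    apply asn_is_phi_tail; [lia|]. intros; apply Hv; lia. }
  (* The first [m0] partial sums miss v by at most [T], later ones by at most e / 2. As [qsum] stays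
     below B, this gives N e <= B + m0 T + N e / 2, false for large N. *)
  assert (sum : forall N, asn (vsub (vsc (RtoC (INR N)) v) (qsum gam w N)) <= INR m0 * T + INR N * (e / 2)).
  { assert (step : forall N, asn (vsub (vsc (RtoC (INR (S N))) v) (qsum gam w (S N))) <=
      asn (vsub (vsc (RtoC (INR N)) v) (qsum gam w N)) + asn (vsub v (psum gam w N))).
    { intros N. rewrite (asn_ext _ (vadd (vsub (vsc (RtoC (INR N)) v) (qsum gam w N)) (vsub v (psum gam w N)))).
      - apply asn_vadd; auto using bdd_qsum, bdd_psum with bdd.
      - intros t. rewrite S_INR, RtoC_plus. simpl qsum. unfold vadd, vsub, vsc. vring. }
    assert (zero_case : asn (vsub (vsc (RtoC (INR 0)) v) (qsum gam w 0)) <= 0).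
    { right. apply asn_vanish. intros e' He'. exists 0. intros t _. simpl. unfold vsub, vsc.
      norm_as (zero : X). rewrite norm_zero_C. lra. }
    assert (T0 : 0 <= T) by lra.
    assert (sum1 : forall N, asn (vsub (vsc (RtoC (INR N)) v) (qsum gam w N)) <= INR N * T).
    { induction N as [|N IH]; [simpl in *; lra|]. eapply Rle_trans; [apply step|].
      rewrite S_INR. specialize (tailT N). lra. }
    assert (sum2 : forall k, asn (vsub (vsc (RtoC (INR (m0 + k))) v) (qsum gam w (m0 + k))) <=
      INR m0 * T + INR k * (e / 2)).
    { induction k as [|k IH]; [rewrite Nat.add_0_r; simpl; specialize (sum1 m0); lra|].
      rewrite Nat.add_succ_r. eapply Rle_trans; [apply step|]. rewrite S_INR.
      specialize (tail2 (m0 + k)%nat ltac:(lia)). lra. }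
    intros N. assert (HN := pos_INR N). destruct (Compare_dec.le_lt_dec m0 N) as [Hle|Hlt].
    - specialize (sum2 (N - m0)%nat). replace (m0 + (N - m0))%nat with N in sum2 by lia.
      rewrite minus_INR in sum2 by exact Hle. assert (0 <= INR m0 * (e / 2)) by (apply Rmult_le_pos; lra). lra.
    - specialize (sum1 N). assert (INR N <= INR m0) by (apply le_INR; lia). nra. }
  destruct (INR_unbounded ((INR m0 * T + B + 1) * 2 / e)) as [N HN].
  specialize (sum N). specialize (HB N).
  assert (K1 := asn_vsc_ge (RtoC (INR N)) v Hbv). rewrite Cmod_R, Rabs_pos_eq in K1 by apply pos_INR.
  assert (K2 := asn_le_vsub (vsc (RtoC (INR N)) v) (qsum gam w N) (bdd_vsc _ v Hbv) (bdd_qsum gam w N Hw)).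
  fold e in K1.
  apply (Rmult_lt_compat_r (e / 2)) in HN; [|lra].
  replace ((INR m0 * T + B + 1) * 2 / e * (e / 2)) with (INR m0 * T + B + 1) in HN by (field; lra).
  lra.
Qed.

End Spectral.

(** * Projection onto the asymptotically periodic part *)

(** Piecewise linear, so that the coefficients are explicit and O(1/n^2), and constant near 0, so
    that differences of two trapezoids vanish there. *)
Definition trap (h x : R) : R := Rmax 0 (Rmin 1 (2 - x / h)).

Section Trapezoid.
Variable h : R.
Hypothesis Hh : 0 < h.
Hypothesis Hpi : 2 * h <= PI.

Lemma trap_bounds x : 0 <= trap h x <= 1.
Proof.
  unfold trap. split; [apply Rmax_l|]. apply Rmax_lub; [lra|apply Rmin_l].
Qed.

Lemma trap_one x : x <= h -> trap h x = 1.
Proof.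
  intros Hx. unfold trap. assert (x / h <= 1).
  { apply Rmult_le_reg_r with h; [exact Hh|]. unfold Rdiv. rewrite Rmult_assoc, Rinv_l; lra. }
  rewrite Rmin_left, Rmax_right; lra.
Qed.

Lemma trap_ramp x : h <= x <= 2 * h -> trap h x = 2 - x / h.
Proof.
  intros Hx. unfold trap. assert (1 <= x / h <= 2).
  { split; apply Rmult_le_reg_r with h; trivial; unfold Rdiv; rewrite Rmult_assoc, Rinv_l; lra. }
  rewrite Rmin_right, Rmax_right; lra.
Qed.

Lemma trap_zero x : 2 * h <= x -> trap h x = 0.
Proof.
  intros Hx. unfold trap. assert (2 <= x / h).
  { apply Rmult_le_reg_r with h; trivial; unfold Rdiv; rewrite Rmult_assoc, Rinv_l; lra. }
  rewrite Rmin_right, Rmax_left; lra.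
Qed.

Lemma lipschitz_trap : lipschitz (trap h) (/ h).
Proof.
  intros x y. unfold trap.
  replace (/ h * Rabs (x - y)) with (Rabs (x / h - y / h)).
  - assert (B1 : forall p q, Rabs (Rmax 0 p - Rmax 0 q) <= Rabs (p - q)).
    { intros p q. unfold Rmax. destruct (Rle_dec 0 p), (Rle_dec 0 q); split_Rabs; lra. }
    assert (B2 : forall p q, Rabs (Rmin 1 p - Rmin 1 q) <= Rabs (p - q)).
    { intros p q. unfold Rmin. destruct (Rle_dec 1 p), (Rle_dec 1 q); split_Rabs; lra. }
    eapply Rle_trans; [apply B1|]. eapply Rle_trans; [apply B2|].
    rewrite <- Rabs_Ropp. right. f_equal. ring.
  - replace (x / h - y / h) with (/ h * (x - y)) by (unfold Rdiv; ring).
    rewrite Rabs_mult, Rabs_pos_eq; [reflexivity|]. apply Rlt_le, Rinv_0_lt_compat, Hh.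
Qed.

Lemma coef_trap n : (1 <= n)%nat ->
  coef (trap h) n = (cos (INR n * h) - cos (INR n * (2 * h))) / (PI * h * (INR n * INR n)).
Proof.
  intros Hn. assert (H1 := INR_ge1 n Hn). assert (P := PI_RGT_0).
  set (k := INR n) in *. unfold coef. fold k.
  assert (I1 : is_RInt (fun x => trap h x * cos (k * x)) 0 h (minus (sin (k * h) / k) (sin (k * 0) / k))).
  { apply (is_RInt_ext (V := R_NormedModule) (fun x => cos (k * x))).
    - intros x Hx. rewrite Rmin_left, Rmax_right in Hx by lra. rewrite trap_one by lra. toR; ring.
    - apply (is_RInt_derive (V := R_CompleteNormedModule) (fun x => sin (k * x) / k)).
      + intros x _. auto_derive; [trivial|field; lra].
      + intros x _. apply (ex_derive_continuous (fun x => cos (k * x))). auto_derive; trivial. }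
  assert (I2 : is_RInt (fun x => trap h x * cos (k * x)) h (2 * h)
    (minus ((2 - 2 * h / h) * sin (k * (2 * h)) / k - cos (k * (2 * h)) / (h * (k * k)))
           ((2 - h / h) * sin (k * h) / k - cos (k * h) / (h * (k * k))))).
  { apply (is_RInt_ext (V := R_NormedModule) (fun x => (2 - x / h) * cos (k * x))).
    - intros x Hx. rewrite Rmin_left, Rmax_right in Hx by lra. rewrite trap_ramp by lra. reflexivity.
    - apply (is_RInt_derive (V := R_CompleteNormedModule)
        (fun x => (2 - x / h) * sin (k * x) / k - cos (k * x) / (h * (k * k)))).
      + intros x _. auto_derive; [trivial|field; lra].
      + intros x _. apply (ex_derive_continuous (fun x => (2 - x / h) * cos (k * x))). auto_derive; trivial. }
  assert (I3 : is_RInt (fun x => trap h x * cos (k * x)) (2 * h) PI (scal (PI - 2 * h) 0)).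
  { apply (is_RInt_ext (V := R_NormedModule) (fun _ => 0)).
    - intros x Hx. rewrite Rmin_left, Rmax_right in Hx by lra. rewrite trap_zero by lra. toR; ring.
    - apply (is_RInt_const (V := R_NormedModule)). }
  assert (I := is_RInt_Chasles (V := R_NormedModule) _ _ _ _ _ _ (is_RInt_Chasles (V := R_NormedModule) _ _ _ _ _ _ I1 I2) I3).
  rewrite (is_RInt_unique (V := R_CompleteNormedModule) _ _ _ _ I).
  unfold plus, minus, opp, scal; simpl. unfold plus, opp, mult; simpl.
  rewrite Rmult_0_r, sin_0. field. lra.
Qed.

Lemma decay_trap : decay (coef (trap h)) (2 / h).
Proof.
  intros n Hn. rewrite coef_trap by exact Hn. assert (H1 := INR_ge1 n Hn).
  assert (P : 1 < PI) by (generalize PI2_1; lra).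
  unfold Rdiv. rewrite Rabs_mult, Rabs_inv.
  assert (Hk : 0 < INR n * INR n) by nra.
  rewrite (Rabs_pos_eq (PI * h * (INR n * INR n))) by (apply Rmult_le_pos; nra).
  assert (C1 := COS_bound (INR n * h)). assert (C2 := COS_bound (INR n * (2 * h))).
  apply Rle_trans with (2 * / (h * (INR n * INR n))).
  - apply Rmult_le_compat; [apply Rabs_pos|apply Rlt_le, Rinv_0_lt_compat; apply Rmult_lt_0_compat; nra|apply Rabs_le; lra|].
    apply Rinv_le_contravar; [nra|]. assert (0 < h * (INR n * INR n)) by nra. nra.
  - right. field. lra.
Qed.

(** The support has length 2 h, and on it consecutive cosines differ by at most x <= 2 h. This is
    the useful bound for n up to about 1 / h. *)
Lemma coef_trap_diff_small n : Rabs (coef (trap h) n - coef (trap h) (S n)) <= 4 * (h * h).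
Proof.
  assert (P : 1 < PI) by (generalize PI2_1; lra).
  assert (Hi : 0 < / h) by now apply Rinv_0_lt_compat.
  assert (HX : forall k x y, ex_RInt (fun x => trap h x * cos (INR k * x)) x y).
  { intros k x y. apply ex_RInt_lipschitz with (/ h + INR k); [generalize (pos_INR k); lra|].
    apply lipschitz_mult_cos; [apply pos_INR|apply lipschitz_trap|].
    intros u. generalize (trap_bounds u). intros. apply Rabs_le; lra. }
  assert (E : forall k, coef (trap h) k = / PI * RInt (fun x => trap h x * cos (INR k * x)) 0 (2 * h)).
  { intros k. unfold coef.
    rewrite <- (RInt_Chasles (V := R_CompleteNormedModule) _ 0 (2 * h) PI) by apply HX.
    rewrite (RInt_ext (V := R_CompleteNormedModule) (fun x => trap h x * cos (INR k * x)) (fun _ => 0) (2 * h)).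
    - rewrite (RInt_const (V := R_CompleteNormedModule)). unfold plus, scal; simpl. unfold mult; simpl. ring.
    - intros x Hx. rewrite Rmin_left in Hx by lra. rewrite trap_zero by lra. toR; ring. }
  rewrite !E, <- Rmult_minus_distr_l, Rabs_mult, Rabs_inv, (Rabs_pos_eq PI) by lra.
  assert (B : Rabs (RInt (fun x => trap h x * cos (INR n * x)) 0 (2 * h) -
                    RInt (fun x => trap h x * cos (INR (S n) * x)) 0 (2 * h)) <= (2 * h - 0) * (2 * h)).
  { apply (norm_RInt_le_const (V := R_NormedModule)
      (fun x => minus (trap h x * cos (INR n * x)) (trap h x * cos (INR (S n) * x))) 0 (2 * h)
      (minus (RInt (fun x => trap h x * cos (INR n * x)) 0 (2 * h)) (RInt (fun x => trap h x * cos (INR (S n) * x)) 0 (2 * h)))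
      (2 * h)); [lra| |].
    - intros x Hx. change (Rabs (trap h x * cos (INR n * x) - trap h x * cos (INR (S n) * x)) <= 2 * h).
      rewrite <- Rmult_minus_distr_l, Rabs_mult.
      assert (L := cos_lip (INR n * x) (INR (S n) * x)). rewrite S_INR in *.
      replace (INR n * x - (INR n + 1) * x) with (- x) in L by ring. rewrite Rabs_Ropp, (Rabs_pos_eq x) in L by lra.
      assert (T := trap_bounds x). rewrite (Rabs_pos_eq (trap h x)) by lra.
      assert (H0 := Rabs_pos (cos (INR n * x) - cos ((INR n + 1) * x))). nra.
    - apply (is_RInt_minus (V := R_NormedModule)); apply (RInt_correct (V := R_CompleteNormedModule)), HX. }
  assert (Hip : / PI <= 1) by (rewrite <- Rinv_1; apply Rinv_le_contravar; lra).
  assert (Hip0 : 0 < / PI) by (apply Rinv_0_lt_compat; lra).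
  match goal with |- _ * Rabs ?u <= _ => assert (H0 := Rabs_pos u); set (r := Rabs u) in * end. nra.
Qed.

(** Taken from the closed form: consecutive numerators differ by at most 3 h and are bounded by 2.
    Both terms can be summed by telescoping. *)
Lemma coef_trap_diff_large n : (1 <= n)%nat ->
  Rabs (coef (trap h) n - coef (trap h) (S n)) <=
  3 * / (INR (S n) * INR (S n)) + 2 / h * (/ (INR n * INR n) - / (INR (S n) * INR (S n))).
Proof.
  intros Hn. rewrite !coef_trap by lia. assert (H1 := INR_ge1 n Hn).
  assert (P : 1 < PI) by (generalize PI2_1; lra).
  rewrite S_INR. set (k := INR n) in *.
  set (u := cos (k * h) - cos (k * (2 * h))). set (v := cos ((k + 1) * h) - cos ((k + 1) * (2 * h))).
  assert (Huv : Rabs (u - v) <= 3 * h).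
  { unfold u, v.
    assert (L1 := cos_lip (k * h) ((k + 1) * h)). assert (L2 := cos_lip (k * (2 * h)) ((k + 1) * (2 * h))).
    replace (k * h - (k + 1) * h) with (- h) in L1 by ring.
    replace (k * (2 * h) - (k + 1) * (2 * h)) with (- (2 * h)) in L2 by ring.
    rewrite Rabs_Ropp, (Rabs_pos_eq h) in L1 by lra.
    rewrite Rabs_Ropp, (Rabs_pos_eq (2 * h)) in L2 by lra.
    apply Rabs_le_between in L1, L2. apply Rabs_le; lra. }
  assert (Hu : Rabs u <= 2).
  { unfold u. generalize (COS_bound (k * h)) (COS_bound (k * (2 * h))). intros; apply Rabs_le; lra. }
  assert (Hq : 0 <= / (k * k) - / ((k + 1) * (k + 1))).
  { assert (/ ((k + 1) * (k + 1)) <= / (k * k)) by (apply Rinv_le_contravar; nra). lra. }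
  assert (Hq1 : 0 < / ((k + 1) * (k + 1))) by (apply Rinv_0_lt_compat; nra).
  replace (u / (PI * h * (k * k)) - v / (PI * h * ((k + 1) * (k + 1))))
    with (/ PI * (/ h * ((u - v) * / ((k + 1) * (k + 1)) + u * (/ (k * k) - / ((k + 1) * (k + 1))))))
    by (field; repeat split; nra).
  assert (Hi : 0 < / h) by now apply Rinv_0_lt_compat.
  assert (Hip : / PI <= 1) by (rewrite <- Rinv_1; apply Rinv_le_contravar; lra).
  assert (Hip0 : 0 < / PI) by (apply Rinv_0_lt_compat; lra).
  rewrite Rabs_mult, Rabs_mult, (Rabs_pos_eq (/ PI)), (Rabs_pos_eq (/ h)) by lra.
  set (q := / (k * k) - / ((k + 1) * (k + 1))) in *. set (s := / ((k + 1) * (k + 1))) in *.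
  assert (B : Rabs ((u - v) * s + u * q) <= 3 * h * s + 2 * q).
  { eapply Rle_trans; [apply Rabs_triang|]. rewrite !Rabs_mult, (Rabs_pos_eq s), (Rabs_pos_eq q) by lra. nra. }
  replace (3 * s + 2 / h * q) with (1 * (/ h * (3 * h * s + 2 * q))) by (field; lra).
  apply Rmult_le_compat; [lra| |exact Hip|].
  - apply Rmult_le_pos; [lra|apply Rabs_pos].
  - apply Rmult_le_compat_l; lra.
Qed.

End Trapezoid.

Fixpoint variation (gam : nat -> R) (m : nat) : R :=
  match m with
  | O => 0
  | S m => variation gam m + Rabs (gam m - gam (S m))
  end.

(** With h = 1/K, the first K + 1 differences contribute at most 8/K, and the two telescoping tails
    3/K and 2/K. *)
Lemma variation_trap K m : (1 <= K)%nat -> 2 * / INR K <= PI ->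
  variation (coef (trap (/ INR K))) m <= 13 / INR K.
Proof.
  intros HK Hpi. assert (H1 := INR_ge1 K HK). set (k := INR K) in *.
  assert (Hh : 0 < / k) by (apply Rinv_0_lt_compat; lra).
  assert (Hkk : 0 <= 4 * (/ k * / k)) by (apply Rmult_le_pos; [lra|apply Rmult_le_pos; lra]).
  assert (S1 : forall m, variation (coef (trap (/ k))) m <= INR m * (4 * (/ k * / k))).
  { induction m0 as [|j IH]; simpl variation; [simpl; lra|]. rewrite S_INR.
    assert (D := coef_trap_diff_small (/ k) Hh Hpi j). lra. }
  assert (S2 : forall j, variation (coef (trap (/ k))) (S K + j) <=
     INR (S K) * (4 * (/ k * / k)) + 3 * (/ INR (S K) - / INR (S K + j))
     + 2 * k * (/ (INR (S K) * INR (S K)) - / (INR (S K + j) * INR (S K + j)))).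
  { induction j as [|j IH].
    - rewrite Nat.add_0_r. specialize (S1 (S K)). lra.
    - rewrite Nat.add_succ_r. remember (S K + j)%nat as n eqn:En.
      simpl variation. assert (Hn : (1 <= n)%nat) by lia.
      assert (D := coef_trap_diff_large (/ k) Hh Hpi n Hn).
      assert (T := inv_sq_telescope n Hn).
      replace (2 / / k) with (2 * k) in D by (field; lra). lra. }
  assert (Hfin : INR (S K) * (4 * (/ k * / k)) + 3 * / INR (S K) + 2 * k * / (INR (S K) * INR (S K)) <= 13 / k).
  { rewrite S_INR. fold k.
    assert (A1 : (k + 1) * (4 * (/ k * / k)) <= 8 / k).
    { apply Rle_trans with (2 * k * (4 * (/ k * / k))); [|right; field; lra].
      apply Rmult_le_compat_r; lra. }
    assert (A2 : / (k + 1) <= / k) by (apply Rinv_le_contravar; lra).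
    assert (A3 : k * / ((k + 1) * (k + 1)) <= / k).
    { apply Rmult_le_reg_r with (k * ((k + 1) * (k + 1))); [nra|].
      replace (k * / ((k + 1) * (k + 1)) * (k * ((k + 1) * (k + 1)))) with (k * k) by (field; lra).
      replace (/ k * (k * ((k + 1) * (k + 1)))) with ((k + 1) * (k + 1)) by (field; lra). nra. }
    unfold Rdiv in *. lra. }
  assert (Hpos : 0 <= 3 * / INR (S K) + 2 * k * / (INR (S K) * INR (S K))).
  { assert (0 < INR (S K)) by (apply lt_0_INR; lia).
    assert (0 < / INR (S K)) by now apply Rinv_0_lt_compat.
    assert (0 < / (INR (S K) * INR (S K))) by (apply Rinv_0_lt_compat; nra). nra. }
  destruct (Compare_dec.le_lt_dec m (S K)) as [Hm|Hm].
  - eapply Rle_trans; [apply S1|].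
    assert (INR m <= INR (S K)) by now apply le_INR.
    assert (INR m * (4 * (/ k * / k)) <= INR (S K) * (4 * (/ k * / k))) by (apply Rmult_le_compat_r; assumption). lra.
  - replace m with (S K + (m - S K))%nat by lia. eapply Rle_trans; [apply S2|].
    set (n := (S K + (m - S K))%nat). assert (0 < INR n) by (apply lt_0_INR; unfold n; lia).
    assert (0 < / INR n) by now apply Rinv_0_lt_compat.
    assert (0 < / (INR n * INR n)) by (apply Rinv_0_lt_compat; nra). nra.
Qed.

(** * Summation by parts and the spectral cut around 1 *)

Section Projection.
Context {X : CompleteNormedModule C_AbsRing}.
Implicit Types w z v : R -> X.
Implicit Types gam : nat -> R.

Fixpoint sbp gam z (m : nat) : R -> X :=
  match m with
  | O => vsc (RtoC 0) z
  | S m => vadd (sbp gam z m)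
      (vsc (RtoC (gam m - gam (S m))) (vsub (shift (INR m + 1) z) (shift (- INR m) z)))
  end.

(** Abel summation moves the difference T_1 - 1 from z to the coefficients, whose variation is small
    for a narrow trapezoid. *)
Lemma psum_by_parts gam z m t : psum gam (vsub (shift 1 z) z) m t =
  plus (scal (RtoC (gam m)) (minus (z (t + (INR m + 1))) (z (t + - INR m)))) (sbp gam z m t).
Proof.
  induction m as [|m IH].
  - simpl. unfold vsc, vsub, shift. rewrite Rplus_0_l, Ropp_0, Rplus_0_r. vring.
  - rewrite psum_S, IH. change (sbp gam z (S m)) with (vadd (sbp gam z m)
      (vsc (RtoC (gam m - gam (S m))) (vsub (shift (INR m + 1) z) (shift (- INR m) z)))).
    rewrite RtoC_minus. unfold vadd, vsc, vsub, shift. rewrite S_INR.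
    replace (t + - (INR m + 1) + 1) with (t + - INR m) by ring.
    replace (t + (INR m + 1) + 1) with (t + (INR m + 1 + 1)) by ring. vring.
Qed.

Lemma asn_psum_increment gam z m : bdd z ->
  asn (psum gam (vsub (shift 1 z) z) m) <= 2 * (Rabs (gam m) + variation gam m) * asn z.
Proof.
  intros Hz. assert (Hp := asn_ge0 z).
  assert (D : forall r s, asn (vsub (shift r z) (shift s z)) <= 2 * asn z).
  { intros r s. eapply Rle_trans; [apply asn_vsub; auto with bdd|]. rewrite !asn_shift. lra. }
  assert (Hb : forall m, bdd (sbp gam z m)) by (induction m0; simpl; auto with bdd).
  assert (S1 : forall m, asn (sbp gam z m) <= 2 * variation gam m * asn z).
  { induction m0 as [|j IH]; simpl.
    - eapply Rle_trans; [now apply asn_vsc_R|]. rewrite Rabs_R0. lra.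
    - eapply Rle_trans; [apply asn_vadd; auto with bdd|].
      assert (B : asn (vsc (RtoC (gam j - gam (S j))) (vsub (shift (INR j + 1) z) (shift (- INR j) z)))
        <= Rabs (gam j - gam (S j)) * (2 * asn z)).
      { eapply Rle_trans; [apply asn_vsc_R; auto with bdd|]. apply Rmult_le_compat_l; [apply Rabs_pos|apply D]. }
      lra. }
  rewrite (asn_ext _ (vadd (vsc (RtoC (gam m)) (vsub (shift (INR m + 1) z) (shift (- INR m) z))) (sbp gam z m))).
  - eapply Rle_trans; [apply asn_vadd; auto with bdd|].
    assert (B : asn (vsc (RtoC (gam m)) (vsub (shift (INR m + 1) z) (shift (- INR m) z))) <= Rabs (gam m) * (2 * asn z)).
    { eapply Rle_trans; [apply asn_vsc_R; auto with bdd|]. apply Rmult_le_compat_l; [apply Rabs_pos|apply D]. }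
    specialize (S1 m). lra.
  - intros t. apply psum_by_parts.
Qed.

(** 26 is twice the variation constant 13; the boundary coefficient and the tail of the series tend
    to 0 with m. *)
Lemma asn_phi_increment K z v : (1 <= K)%nat -> 2 * / INR K <= PI -> bdd z ->
  is_phi (coef (trap (/ INR K))) (vsub (shift 1 z) z) v -> asn v <= 26 / INR K * asn z.
Proof.
  intros HK Hpi Hz Hphi. assert (Hp := asn_ge0 z). assert (H1 := INR_ge1 K HK).
  assert (Hh : 0 < / INR K) by (apply Rinv_0_lt_compat; lra).
  assert (Hw : bdd (vsub (shift 1 z) z)) by auto with bdd.
  assert (Hbv := bdd_is_phi _ _ v Hw Hphi). destruct Hphi as [C [HC Hv]].
  apply le_epsilon. intros e He.
  set (D := C + 4 * INR K * asn z). assert (HD : 0 <= D) by (unfold D; nra).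
  destruct (div_INR_small D e HD He) as [m [Hm1 B7]]. specialize (B7 m (Nat.le_refl m)).
  assert (Hm := INR_ge1 m Hm1).
  assert (B1 := asn_is_phi_tail _ _ v C m Hm1 (fun t => Hv m t Hm1)).
  assert (B2 := asn_psum_increment (coef (trap (/ INR K))) z m Hz).
  assert (B3 := variation_trap K m HK Hpi).
  assert (B4 := decay_trap (/ INR K) Hh Hpi m Hm1).
  assert (B5 := asn_le_vsub v _ Hbv (bdd_psum (coef (trap (/ INR K))) _ m Hw)).
  replace (2 / / INR K / (INR m * INR m)) with (2 * INR K / INR m * / INR m) in B4 by (field; lra).
  assert (B6 : 2 * INR K / INR m * / INR m <= 2 * INR K / INR m).
  { assert (/ INR m <= 1) by (rewrite <- Rinv_1; apply Rinv_le_contravar; lra).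
    assert (0 <= 2 * INR K / INR m) by (apply Rmult_le_pos; [lra|apply Rlt_le, Rinv_0_lt_compat; lra]). nra. }
  set (var := variation (coef (trap (/ INR K))) m) in *. set (gm := Rabs (coef (trap (/ INR K)) m)) in *.
  assert (B8 : 2 * (gm + var) * asn z <= 2 * (2 * INR K / INR m + 13 / INR K) * asn z).
  { apply Rmult_le_compat_r; [exact Hp|]. lra. }
  replace (D / INR m) with (C / INR m + 2 * (2 * INR K / INR m) * asn z) in B7 by (unfold D; field; lra).
  replace (26 / INR K * asn z) with (2 * (13 / INR K) * asn z) by (field; lra). lra.
Qed.

Variable a : R.
Hypothesis Ha : 0 < a <= 1.
Variable A : X -> X.
Hypothesis HA : is_linear A.

Lemma stable_hom : stable (hom a A).
Proof.
  split.
  - intros; now apply hom_vadd.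
  - intros; now apply hom_vsc.
  - intros; now apply hom_shift.
  - intros x Hx. apply BU_bdd, Hx.
Qed.

(** (T_1 - 1) v is phi(T_1) w, and for the seminorm it does not change when the trapezoid is
    replaced by a narrower one of width 1/K, whose effect on w = (T_1 - 1) z is O(1/K). *)
Lemma phi_periodic d h z v : 0 < h -> 2 * h < d -> 2 * h <= PI ->
  (forall th, 0 < Rabs th < d -> forall eta, cis eta = cis th -> regular a A eta) ->
  BU z -> hom a A (vsub (shift 1 z) z) -> is_phi (coef (trap h)) z v ->
  asn (vsub (shift 1 v) v) = 0.
Proof.
  intros Hh Hhd Hpi Hreg Hz Hhom Hphi. assert (P := PI_RGT_0).
  set (w := vsub (shift 1 z) z) in *.
  assert (Hw : is_phi (coef (trap h)) w (vsub (shift 1 v) v)).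
  { apply is_phi_vsub; [now apply is_phi_shift|exact Hphi]. }
  assert (Hbw : bdd w) by apply BU_bdd, Hhom.
  set (v0 := vsub (shift 1 v) v) in *.
  assert (Hbv0 := bdd_is_phi _ _ _ Hbw Hw).
  apply Rle_antisym; [|apply asn_ge0]. apply le_epsilon. intros e He.
  destruct (INR_unbounded (1 / h + 26 * asn z / e + 1)) as [K HK].
  assert (Hp := asn_ge0 z).
  assert (U1 : 0 < 1 / h) by (apply Rdiv_lt_0_compat; lra).
  assert (U2 : 0 <= 26 * asn z / e) by (apply Rmult_le_pos; [lra|apply Rlt_le, Rinv_0_lt_compat; lra]).
  assert (HK1 : (1 <= K)%nat) by (apply INR_le; simpl; lra).
  set (k := / INR K). assert (Hk0 : 0 < k) by (apply Rinv_0_lt_compat; lra).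
  assert (Hkh : k < h).
  { unfold k. rewrite <- (Rinv_inv h). apply Rinv_lt_contravar; [|unfold Rdiv in *; lra].
    apply Rmult_lt_0_compat; [now apply Rinv_0_lt_compat|lra]. }
  assert (Hk2 : 2 * k <= PI) by lra.
  destruct (is_phi_exists (coef (trap k)) (2 / k) w) as [v1 Hv1].
  { apply Rlt_le, Rdiv_lt_0_compat; lra. }
  { now apply decay_trap. }
  { exact Hbw. }
  assert (Hbv1 := bdd_is_phi _ _ _ Hbw Hv1).
  assert (B1 : asn v1 <= 26 / INR K * asn z) by exact (asn_phi_increment K z v1 HK1 Hk2 (BU_bdd z Hz) Hv1).
  (* The difference is the multiplier [trap h - trap k], supported in k <= |theta| <= 2 h, where the
     lower bounds are uniform on both arcs. *)
  assert (B2 : asn (vsub v0 v1) = 0).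
  { destruct (lower_bound_uniform a Ha A HA k (2 * h)) as [c1 [Hc1 L1]].
    { intros th Hth. apply Hreg. rewrite Rabs_pos_eq; lra. }
    destruct (lower_bound_uniform a Ha A HA (- (2 * h)) (- k)) as [c2 [Hc2 L2]].
    { intros th Hth. apply Hreg. rewrite Rabs_left1; lra. }
    set (c := Rmin c1 c2). assert (Hc : 0 < c) by now apply Rmin_pos.
    assert (Hcc1 : c <= c1) by apply Rmin_l. assert (Hcc2 : c <= c2) by apply Rmin_r.
    set (f := fun x => trap h x - trap k x).
    apply (asn_is_phi_zero (coef f) w (vsub v0 v1) (4 / (c * c) * asn w)); [exact Hbw| |].
    - replace (coef f) with (fun n => coef (trap h) n - coef (trap k) n).
      + now apply is_phi_coef_minus.
      + apply functional_extensionality. intros n. unfold coef, f.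
        rewrite <- Rmult_minus_distr_l. apply f_equal. symmetry.
        apply (is_RInt_unique (V := R_CompleteNormedModule)).
        assert (HX : forall h', 0 < h' -> ex_RInt (fun x => trap h' x * cos (INR n * x)) 0 PI).
        { intros h' Hh'. assert (0 < / h') by now apply Rinv_0_lt_compat.
          apply ex_RInt_lipschitz with (/ h' + INR n); [generalize (pos_INR n); lra|].
          apply lipschitz_mult_cos; [apply pos_INR|now apply lipschitz_trap|].
          intros u. generalize (trap_bounds h' u). intros. apply Rabs_le; lra. }
        apply (is_RInt_ext (V := R_NormedModule)
          (fun x => minus (trap h x * cos (INR n * x)) (trap k x * cos (INR n * x)))).
        * intros x _. unfold minus, plus, opp; simpl. toR; ring.
        * apply (is_RInt_minus (V := R_NormedModule)); apply (RInt_correct (V := R_CompleteNormedModule)), HX; assumption.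
    - intros N. apply (asn_coef_qsum (hom a A) f (/ h + / k) w N c k (2 * h)); trivial.
      + apply stable_hom.
      + assert (0 < / h) by now apply Rinv_0_lt_compat. assert (0 < / k) by now apply Rinv_0_lt_compat. lra.
      + intros x y. unfold f. assert (Q1 := lipschitz_trap h Hh x y). assert (Q2 := lipschitz_trap k Hk0 x y).
        rewrite Rmult_plus_distr_r.
        replace (trap h x - trap k x - (trap h y - trap k y)) with ((trap h x - trap h y) + - (trap k x - trap k y)) by ring.
        eapply Rle_trans; [apply Rabs_triang|]. rewrite Rabs_Ropp. lra.
      + intros x. unfold f. generalize (trap_bounds h x) (trap_bounds k x). intros. apply Rabs_le; lra.
      + intros x Hx Hfx. split.
        * apply Rnot_lt_le. intros Hlt. apply Hfx. unfold f. rewrite !trap_one by lra. lra.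
        * apply Rnot_lt_le. intros Hlt. apply Hfx. unfold f. rewrite !trap_zero by lra. lra.
      + intros th z' Hth Hz'. apply Rle_trans with (c1 * asn z'); [|now apply L1].
        apply Rmult_le_compat_r; [apply asn_ge0|exact Hcc1].
      + intros th z' Hth Hz'. apply Rle_trans with (c2 * asn z'); [|apply L2; [lra|exact Hz']].
        apply Rmult_le_compat_r; [apply asn_ge0|exact Hcc2]. }
  assert (B3 := asn_le_vsub v0 v1 Hbv0 Hbv1).
  assert (26 / INR K * asn z <= e).
  { apply Rmult_le_reg_r with (INR K); [lra|].
    replace (26 / INR K * asn z * INR K) with (26 * asn z / e * e) by (field; lra).
    rewrite (Rmult_comm e). apply Rmult_le_compat_r; lra. }
  lra.
Qed.

(** The multiplier 1 - phi vanishes near 0, and away from 0 an asymptotically periodic function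
    satisfies the lower bounds trivially. *)
Lemma phi_identity h f v : 0 < h -> 2 * h <= PI -> bdd f -> asn (vsub (shift 1 f) f) = 0 ->
  is_phi (coef (trap h)) f v -> asn (vsub f v) = 0.
Proof.
  intros Hh Hpi Hf Hper Hphi. assert (P := PI_RGT_0).
  set (M := fun x : R -> X => bdd x /\ asn (vsub (shift 1 x) x) = 0).
  assert (HM : stable M).
  { split.
    - intros x y [Hx Hx1] [Hy Hy1]. split; [now apply bdd_vadd|].
      apply Rle_antisym; [|apply asn_ge0].
      rewrite (asn_ext _ (vadd (vsub (shift 1 x) x) (vsub (shift 1 y) y))).
      + eapply Rle_trans; [apply asn_vadd; auto with bdd|]. lra.
      + intros t. unfold vsub, vadd, shift. vring.
    - intros c x [Hx Hx1]. split; [now apply bdd_vsc|]. apply Rle_antisym; [|apply asn_ge0].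
      rewrite (asn_ext _ (vsc c (vsub (shift 1 x) x))).
      + eapply Rle_trans; [apply asn_vsc; auto with bdd|]. rewrite Hx1. lra.
      + intros t. unfold vsub, vsc, shift. vring.
    - intros r x [Hx Hx1]. split; [now apply bdd_shift|]. rewrite <- Hx1, <- (asn_shift r (vsub (shift 1 x) x)).
      apply asn_ext. intros t. unfold vsub, shift. replace (t + 1 + r) with (t + r + 1) by ring. reflexivity.
    - now intros x []. }
  (* On these functions T_1 - e^{i theta} acts as 1 - e^{i theta}, whose real part is at least 1 -
     cos h for h <= |theta| <= PI. *)
  set (c := 1 - cos h).
  assert (Hc : 0 < c).
  { unfold c. assert (cos h < cos 0) by (apply cos_decreasing_1; lra). rewrite cos_0 in *. lra. }
  assert (low : forall th x, cos th <= cos h -> M x -> c * asn x <= asn (eigdev th 1 x)).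
  { intros th x Hth [Hx Hx1].
    assert (K := asn_vsc_ge (RtoC 1 - cis th) x Hx).
    rewrite (asn_ext (vsc (RtoC 1 - cis th)%C x) (vsub (eigdev th 1 x) (vsub (shift 1 x) x))) in K.
    - assert (K2 := asn_vsub (eigdev th 1 x) (vsub (shift 1 x) x) (bdd_eigdev th 1 x Hx) (bdd_vsub _ _ (bdd_shift 1 x Hx) Hx)).
      assert (c <= Cmod (RtoC 1 - cis th)).
      { apply Rle_trans with (1 - cos th); [unfold c; lra|].
        apply Rle_trans with (Rabs (1 - cos th)); [apply Rle_abs|].
        exact (Rle_trans _ _ _ (Rmax_l _ _) (Rmax_Cmod (RtoC 1 - cis th)%C)). }
      assert (c * asn x <= Cmod (RtoC 1 - cis th) * asn x) by (apply Rmult_le_compat_r; [apply asn_ge0|assumption]).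
      lra.
    - intros t. unfold eigdev, vsub, vsc, shift. rewrite Rmult_1_r. vring. }
  set (f' := fun x => 1 - trap h x).
  assert (Hi : 0 < / h) by now apply Rinv_0_lt_compat.
  assert (Hphi' : is_phi (coef f') f (vsub f v)).
  (* In this normalisation the constant 1 has the coefficients 1, 0, 0, and so on, and its
     multiplier is the identity. *)
  { replace (coef f') with (fun n => (if Nat.eqb n 0 then 1 else 0) - coef (trap h) n).
    - apply is_phi_coef_minus; [|exact Hphi]. exists 0. split; [lra|]. intros m t _.
      assert (E : forall m, psum (fun n => if Nat.eqb n 0 then 1 else 0) f m t = f t).
      { induction m0 as [|j IH]; [simpl; unfold vsc; vring|]. rewrite psum_S, IH. simpl Nat.eqb. cbv iota. vring. }
      rewrite E. norm_as (zero : X). rewrite norm_zero_C. unfold Rdiv. lra.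
    - apply functional_extensionality. intros n. unfold coef, f'.
      assert (I2 : is_RInt (fun x => trap h x * cos (INR n * x)) 0 PI (RInt (fun x => trap h x * cos (INR n * x)) 0 PI)).
      { apply (RInt_correct (V := R_CompleteNormedModule)).
        apply ex_RInt_lipschitz with (/ h + INR n); [generalize (pos_INR n); lra|].
        apply lipschitz_mult_cos; [apply pos_INR|now apply lipschitz_trap|].
        intros u. generalize (trap_bounds h u). intros. apply Rabs_le; lra. }
      assert (I1 : is_RInt (fun x => cos (INR n * x)) 0 PI (PI * (if Nat.eqb n 0 then 1 else 0))).
      { destruct n as [|n]; simpl Nat.eqb; cbv iota.
        - apply (is_RInt_ext (V := R_NormedModule) (fun _ => 1)).
          + intros x _. simpl. rewrite Rmult_0_l, cos_0. reflexivity.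
          + replace (PI * 1) with (scal (PI - 0) 1) by (unfold scal; simpl; unfold mult; simpl; ring).
            apply (is_RInt_const (V := R_NormedModule)).
        - assert (Hn : INR (S n) <> 0) by (apply not_0_INR; lia).
          replace (PI * 0) with (minus (sin (INR (S n) * PI) / INR (S n)) (sin (INR (S n) * 0) / INR (S n))).
          + apply (is_RInt_derive (V := R_CompleteNormedModule) (fun x => sin (INR (S n) * x) / INR (S n))).
            * intros x _. set (r := INR (S n)) in *. auto_derive; [trivial|field; exact Hn].
            * intros x _. apply (ex_derive_continuous (fun x => cos (INR (S n) * x))). auto_derive; trivial.
          + unfold minus, plus, opp; simpl minus.
            assert (Hs : sin (INR (S n) * PI) = 0).
            { apply sin_eq_0_1. exists (Z.of_nat (S n)). now rewrite <- INR_IZR_INZ. }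
            change (sin (INR (S n) * PI) / INR (S n) + - (sin (INR (S n) * 0) / INR (S n)) = PI * 0).
            rewrite Hs, !Rmult_0_r, sin_0. field. exact Hn. }
      assert (I3 := is_RInt_minus (V := R_NormedModule) _ _ _ _ _ _ I1 I2).
      transitivity (/ PI * minus (PI * (if Nat.eqb n 0 then 1 else 0)) (RInt (fun x => trap h x * cos (INR n * x)) 0 PI)).
      + unfold minus, plus, opp; simpl. field. lra.
      + apply f_equal. symmetry. apply (is_RInt_unique (V := R_CompleteNormedModule)).
        apply (is_RInt_ext (V := R_NormedModule)) with (2 := I3). intros x _.
        unfold minus, plus, opp; simpl. toR; ring. }
  apply (asn_is_phi_zero (coef f') f (vsub f v) (4 / (c * c) * asn f)); [exact Hf|exact Hphi'|].
  intros N. apply (asn_coef_qsum M f' (/ h) f N c h PI); trivial.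
  - now split.
  - lra.
  - intros x y. unfold f'. replace (1 - trap h x - (1 - trap h y)) with (- (trap h x - trap h y)) by ring.
    rewrite Rabs_Ropp. now apply lipschitz_trap.
  - intros x. unfold f'. generalize (trap_bounds h x). intros. apply Rabs_le; lra.
  - intros x Hx Hfx. split; [|lra]. apply Rnot_lt_le. intros Hlt. apply Hfx. unfold f'. rewrite trap_one; lra.
  - intros th x Hth Hx. apply low; [|exact Hx]. destruct (Req_dec th h) as [->|]; [lra|].
    apply Rlt_le, cos_decreasing_1; lra.
  - intros th x Hth Hx. apply low; [|exact Hx]. rewrite cos_neg. destruct (Req_dec th h) as [->|]; [lra|].
    apply Rlt_le, cos_decreasing_1; lra.
Qed.

End Projection.

(** * Back to the half-line equation *)

Section HalfLine.
Context {X : CompleteNormedModule C_AbsRing}.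
Implicit Types u z v : R -> X.

(** Constant continuation to negative times keeps uniform continuity, and the integral equation too,
    since [J] is zero there. *)
Definition ext0 u : R -> X := fun t => u (Rmax t 0).

Lemma ext0_nonneg u t : 0 <= t -> ext0 u t = u t.
Proof. intros Ht. unfold ext0. now rewrite Rmax_left. Qed.

Lemma BU_ext0 u : BUC u -> BU (ext0 u).
Proof.
  intros [[M HM] Hu]. split.
  - exists M. intros t. apply HM, Rmax_r.
  - intros e He. destruct (Hu (mkposreal e He)) as [[d Hd] H]. exists d. split; [exact Hd|].
    intros s t Hst. apply H; try apply Rmax_r. simpl. apply Rle_lt_trans with (2 := Hst).
    unfold Rmax. destruct (Rle_dec t 0), (Rle_dec s 0); split_Rabs; lra.
Qed.

Lemma BUC_BU u : BU u -> BUC u.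
Proof.
  intros [[M HM] Hu]. split.
  - exists M. intros t _. apply HM.
  - intros [e He]. destruct (Hu e He) as [d [Hd H]]. exists (mkposreal d Hd).
    intros s t _ _ Hst. now apply H.
Qed.

Lemma ucont_continuous_on u : ucont u -> continuous_on (fun t : R => 0 <= t) u.
Proof.
  intros Hu t Ht P HP. destruct (ucont_continuous u t Hu P HP) as [d Hd].
  exists d. intros y Hy _. now apply Hd.
Qed.

Variable a : R.
Hypothesis Ha : 0 < a <= 1.
Variable A : X -> X.
Hypothesis HA : is_linear A.
Let G0 : 0 < Gamma a := Gamma_gt0 a Ha.
Let aG0 : 0 < a * Gamma a := Rmult_lt_0_compat _ _ (proj1 Ha) G0.

Lemma J_holder z M s t : BU z -> (forall t, norm (z t) <= M) -> s < t ->
  norm (minus (J a z t) (J a z s)) <= M * (2 * Rpower (t - s) a) / (a * Gamma a).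
Proof.
  intros Hz HM Hst.
  assert (HM0 : 0 <= M) by (apply Rle_trans with (2 := HM 0); apply norm_ge_0).
  assert (P := Rpower_gt0 (t - s) a).
  assert (Hi : 0 < / (a * Gamma a)) by now apply Rinv_0_lt_compat.
  destruct (Rle_dec t 0) as [Ht|Ht].
  - rewrite !J_nonpos by lra. norm_as (zero : X). rewrite norm_zero_C.
    apply Rmult_le_pos; [nra|lra].
  - destruct (Rle_dec s 0) as [Hs|Hs].
    + rewrite (J_nonpos a s) by lra. norm_as (J a z t).
      eapply Rle_trans; [apply (J_bound a Ha z t M); [lra|apply Hz|intros; apply HM]|].
      apply Rmult_le_compat_r; [lra|]. apply Rmult_le_compat_l; [exact HM0|].
      assert (Rpower t a <= Rpower (t - s) a) by (apply Rpower_le_incr; lra). lra.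
    (* With [T0] and [S] both 0 the two decrements of [dif] are zero, and only the term 2 h^a
       remains. *)
    + assert (K := jinc_bound a Ha (t - s) z t 0 0 M M M ltac:(lra) (proj2 Hz) ltac:(lra) ltac:(lra) ltac:(lra)
        (fun r _ => HM r) (fun r _ => HM r) (fun r _ => HM r)).
      unfold jinc in K. replace (t - (t - s)) with s in K by ring.
      apply Rle_trans with (1 := K). right. rewrite Rminus_0_r. f_equal. ring.
Qed.

Lemma ucont_J z : BU z -> ucont (J a z).
Proof.
  intros Hz e He. destruct (bdd_pos z (BU_bdd z Hz)) as [M [HM0 HM]].
  destruct (Rpower_small a (e * (a * Gamma a) / (4 * M))) as [d [Hd H]];
    [lra|apply Rdiv_lt_0_compat; [apply Rmult_lt_0_compat|]; lra|].
  exists d. split; [exact Hd|].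
  assert (K : forall s t, s < t -> t - s < d -> norm (minus (J a z t) (J a z s)) < e).
  { intros s t Hst Hd'. eapply Rle_lt_trans; [apply (J_holder z M s t Hz HM Hst)|].
    specialize (H (t - s) ltac:(lra) ltac:(lra)).
    apply Rle_lt_trans with (M * (2 * (e * (a * Gamma a) / (4 * M))) / (a * Gamma a)).
    - apply Rmult_le_compat_r; [apply Rlt_le, Rinv_0_lt_compat, aG0|]. apply Rmult_le_compat_l; lra.
    - replace (M * (2 * (e * (a * Gamma a) / (4 * M))) / (a * Gamma a)) with (e / 2) by (field; lra). lra. }
  intros s t Hst. destruct (Rtotal_order s t) as [Hlt|[->|Hgt]].
  - apply K; [exact Hlt|]. rewrite Rabs_pos_eq in Hst; lra.
  - norm_as (zero : X). rewrite norm_zero_C. exact He.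
  - rewrite norm_minus_sym. apply K; [exact Hgt|]. rewrite Rabs_left in Hst; lra.
Qed.

(** Late times are controlled by v, early ones by the growth bound for [J]; the Hoelder estimate
    gives uniform continuity. *)
Lemma BU_J_of_bounded z v (x0 : X) : BU z -> bdd v -> vanish (fun t => minus (v t) (plus x0 (J a z t))) ->
  BU (fun t => plus x0 (J a z t)).
Proof.
  intros Hz [N HN] Hvan. split.
  - destruct (bdd_pos z (BU_bdd z Hz)) as [M [HM0 HM]].
    destruct (Hvan 1 Rlt_0_1) as [T HT]. set (S := Rmax T 1).
    assert (B1 : T <= S) by apply Rmax_l. assert (B2 : 1 <= S) by apply Rmax_r.
    assert (Hq : 0 <= M * Rpower S a / (a * Gamma a)).
    { apply Rmult_le_pos; [|apply Rlt_le, Rinv_0_lt_compat, aG0].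
      apply Rmult_le_pos; [lra|apply Rlt_le, Rpower_gt0]. }
    assert (HN0 : 0 <= N) by (apply Rle_trans with (2 := HN 0); apply norm_ge_0).
    assert (Hx0 := norm_ge_0 x0).
    exists (N + 1 + (norm x0 + M * Rpower S a / (a * Gamma a))). intros t.
    destruct (Rle_dec T t) as [Ht|Ht].
    + specialize (HT t Ht). rewrite norm_minus_sym in HT. specialize (HN t).
      eapply Rle_trans; [apply (norm_le_minus _ (v t))|]. lra.
    + eapply Rle_trans; [apply norm_plus_le|].
      destruct (Rle_dec t 0) as [Ht0|Ht0].
      * rewrite J_nonpos by exact Ht0. rewrite norm_zero_C. lra.
      * assert (K := J_bound a Ha z t M ltac:(lra) (proj2 Hz) (fun s _ => HM s)).
        assert (M * Rpower t a / (a * Gamma a) <= M * Rpower S a / (a * Gamma a)).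
        { apply Rmult_le_compat_r; [apply Rlt_le, Rinv_0_lt_compat, aG0|].
          apply Rmult_le_compat_l; [lra|]. apply Rpower_le_incr; lra. }
        lra.
  - intros e He. destruct (ucont_J z Hz e He) as [d [Hd H]]. exists d. split; [exact Hd|].
    intros s t Hst. norm_as (minus (J a z t) (J a z s)). now apply H.
Qed.

(** The factor is 1 for t >= 0 and oscillates for t < 0; [cosine_tail] is built with it. *)
Lemma BU_cos_mult z : BU z -> BU (fun t => scal (RtoC (cos (Rmin t 0))) (z t)).
Proof.
  intros [Hb Hu]. destruct (bdd_pos z Hb) as [M [HM0 HM]].
  assert (C1 : forall t, Rabs (cos (Rmin t 0)) <= 1) by (intros; apply Rabs_le, COS_bound).
  split.
  - exists M. intros t. eapply Rle_trans; [apply norm_scal_real|].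
    specialize (C1 t). specialize (HM t). assert (H := norm_ge_0 (z t)). nra.
  - intros e He. destruct (Hu (e / 2)) as [d [Hd H]]; [lra|].
    exists (Rmin d (e / 2 / M)). split; [apply Rmin_pos; [lra|apply Rdiv_lt_0_compat; lra]|].
    intros s t Hst.
    assert (H1 := Rlt_le_trans _ _ _ Hst (Rmin_l _ _)). assert (H2 := Rlt_le_trans _ _ _ Hst (Rmin_r _ _)).
    norm_as (plus (scal (RtoC (cos (Rmin t 0))) (minus (z t) (z s)))
                  (scal (RtoC (cos (Rmin t 0)) - RtoC (cos (Rmin s 0)))%C (z s))).
    eapply Rle_lt_trans; [apply norm_plus_le|]. rewrite <- RtoC_minus.
    assert (B1 := norm_scal_real (cos (Rmin t 0)) (minus (z t) (z s))).
    assert (B2 := norm_scal_real (cos (Rmin t 0) - cos (Rmin s 0)) (z s)).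
    specialize (H s t H1). specialize (C1 t). specialize (HM s).
    assert (L := cos_lip (Rmin t 0) (Rmin s 0)).
    assert (L2 : Rabs (Rmin t 0 - Rmin s 0) <= Rabs (t - s)).
    { unfold Rmin. destruct (Rle_dec t 0), (Rle_dec s 0); split_Rabs; lra. }
    assert (N1 := norm_ge_0 (minus (z t) (z s))). assert (N2 := norm_ge_0 (z s)).
    assert (N3 := Rabs_pos (cos (Rmin t 0) - cos (Rmin s 0))). assert (N4 := Rabs_pos (t - s)).
    assert (Rabs (cos (Rmin t 0)) * norm (minus (z t) (z s)) <= norm (minus (z t) (z s))).
    { rewrite <- (Rmult_1_l (norm _)) at 2. now apply Rmult_le_compat_r. }
    assert (Rabs (cos (Rmin t 0) - cos (Rmin s 0)) * norm (z s) <= Rabs (t - s) * M).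
    { apply Rmult_le_compat; lra. }
    assert (Rabs (t - s) * M <= e / 2).
    { apply Rlt_le in H2. apply (Rmult_le_compat_r M) in H2; [|lra].
      replace (e / 2 / M * M) with (e / 2) in H2 by (field; lra). exact H2. }
    lra.
Qed.

(** The commutator of [J] with the translation T_r. *)
Definition memory z (r t : R) : X := minus (J a (shift r z) t) (J a z (t + r)).

(** The first bound is uniform in t and controls the tail of the series, n^(-2) n^a being summable
    for a < 1; the second decays in t for fixed r when a < 1 and makes each single term vanish. *)
Lemma memory_bound z M r t : BU z -> (forall t, norm (z t) <= M) -> r <> 0 -> 0 < t ->
  norm (memory z r t) <= M * Rpower (Rabs r) a / (a * Gamma a) /\
  (Rabs r < t -> norm (memory z r t) <= M * (Rabs r * Rpower t (a - 1)) / (a * Gamma a)).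
Proof.
  intros Hz HM Hr Ht. assert (Hi : 0 < / (a * Gamma a)) by now apply Rinv_0_lt_compat.
  assert (HM0 : 0 <= M) by (apply Rle_trans with (2 := HM 0); apply norm_ge_0).
  assert (scale : forall p q, p <= q -> M * p / (a * Gamma a) <= M * q / (a * Gamma a)).
  { intros p q Hpq. apply Rmult_le_compat_r; [lra|]. now apply Rmult_le_compat_l. }
  unfold memory. destruct (Rlt_dec 0 r) as [Hr0|Hr0].
  - rewrite (J_shift_eq a Ha z r t) by (try apply Hz; lra).
    norm_as (opp (intX (kf a (t + r) z) 0 r)). rewrite norm_opp_C.
    assert (K := norm_intX_kf a Ha (t + r) z 0 r M (proj2 Hz) ltac:(lra) ltac:(lra) (fun s _ => HM s)).
    rewrite Rminus_0_r in K. fold (dif a r (t + r)) in K.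
    rewrite Rabs_pos_eq by lra. split.
    + apply Rle_trans with (1 := K), scale. apply dif_le; trivial; lra.
    + intros _. apply Rle_trans with (1 := K), scale.
      eapply Rle_trans; [apply dif_le_linear; trivial; lra|].
      apply Rmult_le_compat_l; [lra|]. apply Rpower_le_decr; lra.
  - rewrite Rabs_left by lra. set (s := - r). assert (Hs : 0 < s) by (unfold s; lra).
    assert (HzS : BU (shift r z)) by now apply BU_shift.
    assert (large : s < t -> norm (minus (J a (shift r z) t) (J a z (t + r))) <= M * dif a s t / (a * Gamma a)).
    { intros Hst. replace t with (t - s + s) at 1 by ring.
      rewrite (J_shift_eq a Ha (shift r z) s (t - s)) by (try apply HzS; lra).
      replace (shift s (shift r z)) with z
        by (apply functional_extensionality; intros x; unfold shift, s; f_equal; ring).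
      replace (t + r) with (t - s) by (unfold s; ring). replace (t - s + s) with t by ring.
      norm_as (intX (kf a t (shift r z)) 0 s).
      assert (K := norm_intX_kf a Ha t (shift r z) 0 s M (proj2 HzS) ltac:(lra) ltac:(lra) (fun x _ => HM (x + r))).
      rewrite Rminus_0_r in K. exact K. }
    split.
    + destruct (Rlt_dec s t) as [Hst|Hst].
      * apply Rle_trans with (1 := large Hst), scale. apply dif_le; trivial; lra.
      (* Here t <= |r|, so t + r <= 0 and only one of the two terms is left. *)
      * rewrite (J_nonpos a (t + r)) by (unfold s in *; lra). norm_as (J a (shift r z) t).
        eapply Rle_trans; [apply (J_bound a Ha _ t M Ht (proj2 HzS)); intros; apply HM|].
        apply scale. apply Rpower_le_incr; lra.
    + intros Hst. apply Rle_trans with (1 := large Hst), scale. apply dif_le_linear; trivial; lra.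
Qed.

Lemma memory_vanish z r : a < 1 -> BU z -> r <> 0 -> vanish (memory z r).
Proof.
  intros Ha1 Hz Hr. destruct (bdd_pos z (BU_bdd z Hz)) as [M [HM0 HM]].
  assert (Hr0 : 0 < Rabs r) by now apply Rabs_pos_lt.
  apply (vanish_le _ (fun t => M * (Rabs r * Rpower t (a - 1)) / (a * Gamma a)) (Rabs r + 1)).
  - intros t Ht. apply (memory_bound z M r t Hz HM Hr); lra.
  - intros e He.
    destruct (Rpower_large (a - 1) (e * (a * Gamma a) / (M * Rabs r))) as [S [HS H]]; [lra| |].
    { apply Rdiv_lt_0_compat; apply Rmult_lt_0_compat; lra. }
    exists S. intros t Ht. specialize (H t Ht).
    apply Rle_trans with (M * (Rabs r * (e * (a * Gamma a) / (M * Rabs r))) / (a * Gamma a)).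
    + apply Rmult_le_compat_r; [apply Rlt_le, Rinv_0_lt_compat, aG0|].
      apply Rmult_le_compat_l; [lra|]. apply Rmult_le_compat_l; lra.
    + right. field. lra.
Qed.

Definition jpsum_gap (gam : nat -> R) z (m : nat) (t : R) : X :=
  minus (J a (psum gam z m) t) (psum gam (J a z) m t).

Lemma jpsum_gap_S gam z m t : BU z -> jpsum_gap gam z (S m) t =
  plus (jpsum_gap gam z m t) (scal (RtoC (gam (S m)))
    (plus (memory z (INR (S m)) t) (memory z (- INR (S m)) t))).
Proof.
  intros Hz. unfold jpsum_gap. rewrite psum_S.
  change (psum gam z (S m)) with (vadd (psum gam z m)
      (vsc (RtoC (gam (S m))) (vadd (shift (INR (S m)) z) (shift (- INR (S m)) z)))).
  rewrite J_vadd, J_vsc, J_vadd by (auto using BU_psum with BU). unfold memory. vring.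
Qed.

Lemma jpsum_gap_vanish gam z m : a < 1 -> BU z -> vanish (jpsum_gap gam z m).
Proof.
  intros Ha1 Hz. induction m as [|m IH].
  - apply (vanish_eventually (fun _ => zero) _ 0).
    + intros t _. unfold jpsum_gap. simpl. rewrite J_vsc by assumption. unfold vsc. vring.
    + intros e He. exists 0. intros t _. rewrite norm_zero_C. lra.
  - assert (Hn : INR (S m) <> 0) by (apply not_0_INR; lia).
    apply (vanish_eventually (vadd (jpsum_gap gam z m) (vsc (RtoC (gam (S m)))
      (vadd (memory z (INR (S m))) (memory z (- INR (S m)))))) _ 0).
    + intros t _. rewrite jpsum_gap_S by exact Hz. reflexivity.
    + apply vanish_vadd; [exact IH|]. apply vanish_vsc, vanish_vadd; apply memory_vanish; trivial.
      now apply Ropp_neq_0_compat.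
Qed.

(** Comparison of (n+1)^(a-2) with the difference of its primitive over [n, n+1], by the mean value
    theorem. *)
Lemma Rpower_telescope n : a < 1 -> (1 <= n)%nat ->
  Rpower (INR (S n)) a / (INR (S n) * INR (S n)) <=
  / (1 - a) * (Rpower (INR n) (a - 1) - Rpower (INR (S n)) (a - 1)).
Proof.
  intros Ha1 Hn. assert (H1 := INR_ge1 n Hn). rewrite S_INR. set (x := INR n) in *.
  destruct (MVT_gen (fun s => Rpower s (a - 1)) x (x + 1) (fun s => (a - 1) * Rpower s (a - 1 - 1))) as [c [Hc E]].
  - intros s Hs. rewrite Rmin_left in Hs by lra. apply is_derive_Rpower; lra.
  - intros s Hs. rewrite Rmin_left in Hs by lra. apply continuity_pt_filterlim, continuous_Rpower; lra.
  - rewrite Rmin_left, Rmax_right in Hc by lra.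
    replace (Rpower x (a - 1) - Rpower (x + 1) (a - 1)) with ((1 - a) * Rpower c (a - 1 - 1)) by lra.
    replace (/ (1 - a) * ((1 - a) * Rpower c (a - 1 - 1))) with (Rpower c (a - 1 - 1)) by (field; lra).
    apply Rle_trans with (Rpower (x + 1) (a - 1 - 1)).
    + right. rewrite (Rpower_split (x + 1) a), (Rpower_split (x + 1) (a - 1)) by lra. field. lra.
    + apply Rpower_le_decr; lra.
Qed.

Lemma jpsum_gap_tail gam z C M m k t : a < 1 -> 0 <= C -> decay gam C -> BU z ->
  (forall t, norm (z t) <= M) -> (1 <= m)%nat -> 0 < t ->
  norm (jpsum_gap gam z (m + k) t) <= norm (jpsum_gap gam z m t) +
    2 * C * M / (a * Gamma a) / (1 - a) * (Rpower (INR m) (a - 1) - Rpower (INR (m + k)) (a - 1)).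
Proof.
  intros Ha1 HC Hd Hz HM Hm Ht.
  assert (HM0 : 0 <= M) by (apply Rle_trans with (2 := HM 0); apply norm_ge_0).
  assert (Hi : 0 < / (a * Gamma a)) by now apply Rinv_0_lt_compat.
  induction k as [|k IH]; [rewrite Nat.add_0_r; lra|].
  rewrite Nat.add_succ_r. remember (m + k)%nat as n eqn:En. assert (Hn : (1 <= n)%nat) by lia.
  rewrite jpsum_gap_S by exact Hz. eapply Rle_trans; [apply norm_plus_le|].
  assert (T := Rpower_telescope n Ha1 Hn). assert (D := Hd (S n) ltac:(lia)).
  assert (H1 := INR_ge1 (S n) ltac:(lia)). set (r := INR (S n)) in *.
  assert (N1 := proj1 (memory_bound z M r t Hz HM ltac:(lra) Ht)).
  assert (N2 := proj1 (memory_bound z M (- r) t Hz HM ltac:(lra) Ht)).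
  rewrite Rabs_Ropp in N2. rewrite Rabs_pos_eq in N1, N2 by lra.
  assert (B : norm (scal (RtoC (gam (S n))) (plus (memory z r t) (memory z (- r) t))) <=
     2 * C * M / (a * Gamma a) * (Rpower r a / (r * r))).
  { eapply Rle_trans; [apply norm_scal_real|].
    apply Rle_trans with (C / (r * r) * (2 * (M * Rpower r a / (a * Gamma a)))).
    - apply Rmult_le_compat; [apply Rabs_pos|apply norm_ge_0|exact D|].
      eapply Rle_trans; [apply norm_plus_le|]. lra.
    - right. field. repeat split; lra. }
  assert (Hc : 0 <= 2 * C * M / (a * Gamma a)) by (apply Rmult_le_pos; [nra|lra]).
  apply (Rmult_le_compat_l _ _ _ Hc) in T.
  replace (2 * C * M / (a * Gamma a) * (/ (1 - a) * (Rpower (INR n) (a - 1) - Rpower r (a - 1))))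
    with (2 * C * M / (a * Gamma a) / (1 - a) * (Rpower (INR n) (a - 1) - Rpower r (a - 1))) in T by (unfold Rdiv; ring).
  lra.
Qed.

(** [J] and phi(T_1) commute at infinity: cut the series at m with a tail of commutators small
    uniformly in t, then let t grow in the finitely many remaining ones. *)
Lemma J_is_phi gam C z v w : a < 1 -> 0 <= C -> decay gam C -> BU z ->
  is_phi gam z v -> is_phi gam (J a z) w -> vanish (fun t => minus (w t) (J a v t)).
Proof.
  intros Ha1 HC Hd Hz Hv Hw. assert (HBv := BU_is_phi gam z v Hz Hv).
  destruct (bdd_pos z (BU_bdd z Hz)) as [M [HM0 HM]].
  destruct Hv as [C1 [HC1 Hv]]. destruct Hw as [C2 [HC2 Hw]].
  assert (Hi : 0 < / (a * Gamma a)) by now apply Rinv_0_lt_compat.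
  set (c := 2 * C * M / (a * Gamma a) / (1 - a)).
  assert (Hc : 0 <= c).
  { unfold c, Rdiv. apply Rmult_le_pos; [apply Rmult_le_pos; [nra|lra]|apply Rlt_le, Rinv_0_lt_compat; lra]. }
  assert (close : forall m t, (1 <= m)%nat -> 0 < t ->
    norm (minus (w t) (J a v t)) <= norm (jpsum_gap gam z m t) + c * Rpower (INR m) (a - 1)).
  { intros m t Hm Ht. apply le_epsilon. intros e He.
    (* Applying [J] to the remainder of the series costs a factor t^a; this is harmless because t is
       fixed while k grows. *)
    set (q := C1 * Rpower t a / (a * Gamma a) + C2).
    assert (Hq : 0 <= q).
    { assert (P := Rpower_gt0 t a). unfold q, Rdiv. assert (0 <= C1 * Rpower t a * / (a * Gamma a)); [|lra].
      apply Rmult_le_pos; [nra|lra]. }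
    destruct (div_INR_small q e Hq He) as [k [Hk Hqn]]. specialize (Hqn (m + k)%nat ltac:(lia)).
    assert (Hmk : (1 <= m + k)%nat) by lia. assert (H1 := INR_ge1 _ Hmk).
    assert (T := jpsum_gap_tail gam z C M m k t Ha1 HC Hd Hz HM Hm Ht).
    fold c in T. assert (P := Rpower_gt0 (INR (m + k)) (a - 1)).
    set (n := (m + k)%nat) in *.
    assert (B1 : norm (minus (J a v t) (J a (psum gam z n) t)) <= C1 / INR n * Rpower t a / (a * Gamma a)).
    { rewrite <- J_vsub by (auto using BU_psum with BU). apply J_bound; trivial.
      - apply BU_vsub; auto using BU_psum with BU.
      - intros s _. now apply Hv. }
    assert (B2 := Hw n t Hmk).
    norm_as (minus (minus (w t) (psum gam (J a z) n t))
       (plus (minus (J a v t) (J a (psum gam z n) t)) (minus (J a (psum gam z n) t) (psum gam (J a z) n t)))).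
    fold (jpsum_gap gam z n t).
    eapply Rle_trans; [apply norm_minus_le|].
    eapply Rle_trans; [apply Rplus_le_compat_l, norm_plus_le|].
    replace (q / INR n) with (C1 / INR n * Rpower t a / (a * Gamma a) + C2 / INR n) in Hqn
      by (unfold q; field; lra).
    assert (0 <= c * Rpower (INR n) (a - 1)) by (apply Rmult_le_pos; lra).
    rewrite Rmult_minus_distr_l in T. lra. }
  intros e He.
  destruct (Rpower_large (a - 1) (e / 2 / (c + 1))) as [S [HS Hlarge]]; [lra|apply Rdiv_lt_0_compat; lra|].
  destruct (INR_unbounded (S + 1)) as [m Hm].
  assert (Hm1 : (1 <= m)%nat) by (apply INR_le; simpl; lra).
  specialize (Hlarge (INR m) ltac:(lra)).
  destruct (jpsum_gap_vanish gam z m Ha1 Hz (e / 2)) as [T HT]; [lra|].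
  exists (Rmax T 1). assert (B1 := Rmax_l T 1). assert (B2 := Rmax_r T 1). intros t Ht.
  eapply Rle_trans; [apply (close m t Hm1); lra|]. specialize (HT t ltac:(lra)).
  assert (P := Rpower_gt0 (INR m) (a - 1)).
  assert (c * Rpower (INR m) (a - 1) <= e / 2); [|lra].
  apply Rle_trans with ((c + 1) * (e / 2 / (c + 1))); [|right; field; lra].
  apply Rmult_le_compat; lra.
Qed.

End HalfLine.

(** * Order one: the fractional integral as a primitive *)

Section OrderOne.
Context {X : CompleteNormedModule C_AbsRing}.
Implicit Types y z v : R -> X.

Let one_le : 0 < 1 <= 1 := conj Rlt_0_1 (Rle_refl 1).

Lemma exX_BU z r s : BU z -> exX z r s.
Proof.
  intros Hz. apply (ex_RInt_continuous (V := real_space X)). intros x _.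
  apply ucont_continuous, Hz.
Qed.

Lemma J1_eq z t : BU z -> 0 < t -> J 1 z t = intX z 0 t.
Proof.
  intros Hz Ht. apply (J_eq 1 one_le t z _ Ht (proj2 Hz)).
  destruct (bdd_pos z (BU_bdd z Hz)) as [M [HM0 HM]].
  intros e He. exists (Rmin t (e / M)). split; [apply Rmin_pos; [lra|apply Rdiv_lt_0_compat; lra]|].
  intros s Hs1 Hs2. assert (B1 := Rmin_l t (e / M)). assert (B2 := Rmin_r t (e / M)).
  assert (E : intX (kf 1 t z) 0 s = intX z 0 s).
  { apply isX_unique. apply (isX_ext z); [lra| |apply exX_correct, exX_BU, Hz].
    intros r Hr. unfold kf. replace (1 - 1) with 0 by ring. rewrite Rpower_O, Gamma_1 by lra.
    replace (1 / 1) with 1 by field. symmetry. exact (scal_one (z r)). }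
  rewrite E, <- (intX_Chasles z 0 s t) by now apply exX_BU.
  norm_as (opp (intX z s t)). rewrite norm_opp_C.
  apply Rle_trans with (scal (t - s) M).
  - apply (norm_intX_le z (fun _ => M)); [lra|now apply exX_BU|intros; apply HM|].
    apply (is_RInt_const (V := R_NormedModule)).
  - unfold scal; simpl; unfold mult; simpl.
    apply Rle_trans with (e / M * M); [apply Rmult_le_compat_r; lra|right; field; lra].
Qed.

Lemma J1_shift z r t : BU z -> 0 < t -> J 1 (shift r z) t = minus (intX z 0 (t + r)) (intX z 0 r).
Proof.
  intros Hz Ht. rewrite J1_eq by (auto with BU).
  rewrite <- (intX_Chasles z 0 r (t + r)) by now apply exX_BU.
  transitivity (intX z r (t + r)); [|vring].
  apply isX_unique. apply (isX_shift z r 0 t). rewrite Rplus_0_l. apply exX_correct, exX_BU, Hz.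
Qed.

(** The primitive from 0 of a translate is the translated primitive minus its value at time 0, so
    each commutator is constant in t and collects in the value at 0. *)
Lemma J1_psum gam z m t : BU z -> 0 < t ->
  J 1 (psum gam z m) t = minus (psum gam (intX z 0) m t) (psum gam (intX z 0) m 0).
Proof.
  intros Hz Ht. assert (E0 : intX z 0 0 = zero) by exact (RInt_point (V := real_space X) 0 z).
  induction m as [|m IH].
  - simpl. rewrite J_vsc by (trivial; lra). unfold vsc. rewrite E0, J1_eq by assumption. vring.
  - rewrite !psum_S.
    change (psum gam z (S m)) with (vadd (psum gam z m)
      (vsc (RtoC (gam (S m))) (vadd (shift (INR (S m)) z) (shift (- INR (S m)) z)))).
    rewrite J_vadd, J_vsc, J_vadd by (auto using BU_psum with BU; lra).
    rewrite IH, !J1_shift by assumption. rewrite !Rplus_0_l. vring.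
Qed.

Lemma J1_is_phi gam z v w t : BU z -> is_phi gam z v -> is_phi gam (intX z 0) w -> 0 < t ->
  J 1 v t = minus (w t) (w 0).
Proof.
  intros Hz Hv Hw Ht. assert (HBv := BU_is_phi gam z v Hz Hv).
  destruct Hv as [C1 [HC1 Hv]]. destruct Hw as [C2 [HC2 Hw]].
  assert (G1 : Gamma 1 = 1) by apply Gamma_1.
  apply eq_of_small_norm. intros e He.
  set (q := C1 * t + 2 * C2). assert (Hq : 0 <= q) by (unfold q; nra).
  destruct (div_INR_small q e Hq He) as [m [Hm1 Hqn]]. specialize (Hqn m (Nat.le_refl m)).
  assert (Hm := INR_ge1 m Hm1).
  assert (B1 : norm (minus (J 1 v t) (J 1 (psum gam z m) t)) <= C1 / INR m * t).
  { rewrite <- J_vsub by (auto using BU_psum with BU; lra).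
    eapply Rle_trans; [apply (J_bound 1 one_le _ t (C1 / INR m) Ht)|].
    - apply BU_vsub; auto using BU_psum with BU.
    - intros s _. now apply Hv.
    - rewrite G1, Rpower_1 by exact Ht. right. field. lra. }
  assert (B2 := Hw m t Hm1). assert (B3 := Hw m 0 Hm1).
  rewrite J1_psum in B1 by assumption.
  norm_as (minus (minus (J 1 v t) (minus (psum gam (intX z 0) m t) (psum gam (intX z 0) m 0)))
    (minus (minus (w t) (psum gam (intX z 0) m t)) (minus (w 0) (psum gam (intX z 0) m 0)))).
  eapply Rle_trans; [apply norm_minus_le|].
  eapply Rle_trans; [apply Rplus_le_compat_l, norm_minus_le|].
  unfold q in Hqn. unfold Rdiv in *. lra.
Qed.

(* The factor keeps the primitive of a function constant on [t <= 0] bounded there; this matters when the order is 1. *)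
Definition cosine_tail y : R -> X := fun t => scal (RtoC (cos (Rmin t 0))) (y t).

Lemma bdd_primitive y : BU y -> (forall t, t <= 0 -> y t = y 0) ->
  bdd (J 1 (cosine_tail y)) -> bdd (intX (cosine_tail y) 0).
Proof.
  intros Hy Hneg [N HN]. assert (HG := BU_cos_mult y Hy). fold (cosine_tail y) in HG.
  exists (Rmax N (norm (y 0))). intros t. destruct (Rlt_dec 0 t) as [Ht|Ht].
  - rewrite <- J1_eq by assumption. apply Rle_trans with (1 := HN t), Rmax_l.
  - assert (E : isX (cosine_tail y) 0 t (scal (RtoC (minus (sin t) (sin 0))) (y 0))).
    { apply (is_RInt_ext (V := real_space X) (fun s => scal (RtoC (cos s)) (y 0))).
      - intros s Hs. rewrite Rmin_right, Rmax_left in Hs by lra. unfold cosine_tail.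
        rewrite (Rmin_left s 0), (Hneg s) by lra. reflexivity.
      - apply isX_scal_vector. apply (is_RInt_derive (V := R_CompleteNormedModule) sin cos).
        + intros x _. auto_derive; [trivial|ring].
        + intros x _. apply (ex_derive_continuous cos). auto_derive; trivial. }
    rewrite (isX_unique _ _ _ _ E). apply Rle_trans with (2 := Rmax_r N _).
    eapply Rle_trans; [apply norm_scal_real|]. unfold minus, plus, opp; simpl.
    rewrite sin_0, Ropp_0, Rplus_0_r. rewrite <- (Rmult_1_l (norm (y 0))) at 2.
    apply Rmult_le_compat_r; [apply norm_ge_0|]. apply Rabs_le, SIN_bound.
Qed.

End OrderOne.

(** * Filtering the solution, and the spectral gap around 1 *)

Section Solution.
Context {X : CompleteNormedModule C_AbsRing}.
Implicit Types y z v : R -> X.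

(** phi(T_1) is applied to z = u0 + J G. It maps the constant to a constant, and commuting it with
    [J] costs a vanishing function for a < 1 and a further constant for a = 1. *)
Lemma phi_of_solution a gam C y (u0 : X) z v Gt : 0 < a <= 1 -> 0 <= C -> decay gam C ->
  BU y -> (forall t, t <= 0 -> y t = y 0) -> BU z ->
  (forall t, z t = plus u0 (J a (cosine_tail y) t)) ->
  is_phi gam z v -> is_phi gam (cosine_tail y) Gt ->
  exists x0, vanish (fun t => minus (v t) (plus x0 (J a Gt t))).
Proof.
  intros Ha HC Hd Hy Hneg Hz Hzeq Hv HGt.
  assert (HG : BU (cosine_tail y)) by now apply BU_cos_mult.
  destruct (is_phi_exists gam C (fun _ => u0) HC Hd (BU_bdd _ (BU_const u0))) as [v0 Hv0].
  assert (Hconst : forall t, v0 t = v0 0).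
  { intros t. assert (K := is_phi_shift gam t _ _ Hv0).
    rewrite <- (is_phi_unique gam (fun _ => u0) _ _ 0 K Hv0). unfold shift. f_equal. ring. }
  set (w := vsub v v0).
  assert (HJ : vsub z (fun _ => u0) = J a (cosine_tail y)).
  { apply functional_extensionality. intros t. unfold vsub. rewrite Hzeq. vring. }
  assert (Hw : is_phi gam (J a (cosine_tail y)) w) by (rewrite <- HJ; now apply is_phi_vsub).
  assert (HbJ : bdd (J a (cosine_tail y))) by (rewrite <- HJ; auto with bdd BU).
  destruct (Rle_lt_or_eq_dec _ _ (proj2 Ha)) as [Ha1|Ha1].
  - exists (v0 0). apply (vanish_eventually (fun t => minus (w t) (J a Gt t)) _ 0).
    + intros t _. unfold w, vsub. rewrite (Hconst t). vring.
    + exact (J_is_phi a Ha gam C (cosine_tail y) Gt w Ha1 HC Hd HG HGt Hw).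
  - subst a. assert (HbZ := bdd_primitive y Hy Hneg HbJ).
    destruct (is_phi_exists gam C (intX (cosine_tail y) 0) HC Hd HbZ) as [W HW].
    (* [W] is phi(T_1) of the primitive, whereas [J 1 Gt] is [W] minus its value at 0, so [W 0]
       joins the constant. For t > 0 the primitive equals [J], hence their images under phi(T_1)
       differ by a vanishing function. *)
    exists (plus (v0 0) (W 0)).
    apply (vanish_eventually (vsub w W) _ 1).
    + intros t Ht. rewrite (J1_is_phi gam (cosine_tail y) Gt W t HG HGt HW) by lra.
      unfold w, vsub. rewrite (Hconst t). vring.
    + apply (vanish_is_phi gam C (vsub (J 1 (cosine_tail y)) (intX (cosine_tail y) 0))); trivial.
      * now apply bdd_vsub.
      * now apply is_phi_vsub.
      * apply (vanish_eventually (fun _ => zero) _ 1).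
        -- intros t Ht. unfold vsub. rewrite J1_eq by (trivial; lra). vring.
        -- intros e He. exists 0. intros t _. rewrite norm_zero_C. lra.
Qed.

(** The closed set omits 1, hence a whole neighbourhood of 1; every eta over a point of the circle
    near 1 but different from 1 is therefore off the spectrum. *)
Lemma regular_near_one a (A : X -> X) :
  closed (fun z : C => exp_Sigma_i A a z /\ z <> RtoC 1) ->
  exists d, 0 < d /\ forall th, 0 < Rabs th < d -> forall eta, cis eta = cis th -> regular a A eta.
Proof.
  intros Hcl.
  assert (Hloc : locally (RtoC 1) (fun z : C => ~ (exp_Sigma_i A a z /\ z <> RtoC 1))).
  (* [closed] is stated by double negation: if 1 had no such neighbourhood it would belong to the
     set, which excludes it. *)
  { apply Classical_Prop.NNPP. intros H. destruct (Hcl (RtoC 1) H) as [_ H1]. now apply H1. }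
  destruct Hloc as [[e He] Hball].
  (* |th| < 1 < PI keeps [cis th] different from 1, and |th| < e / 2 keeps it in the ball around 1,
     cosine and sine being 1-Lipschitz. *)
  exists (Rmin 1 (e / 2)). split; [apply Rmin_pos; lra|]. intros th [Hth0 Hth] eta Heta.
  assert (B1 := Rmin_l 1 (e / 2)). assert (B2 := Rmin_r 1 (e / 2)).
  assert (Hne : cis th <> RtoC 1).
  { intros E. apply (f_equal fst) in E. simpl in E.
    assert (P := PI2_1).
    assert (Hc : cos (Rabs th) < cos 0) by (apply cos_decreasing_1; lra).
    rewrite cos_0 in Hc. unfold Rabs in Hc. destruct (Rcase_abs th); [rewrite cos_neg in Hc|]; lra. }
  assert (HnD : ~ (exp_Sigma_i A a (cis th) /\ cis th <> RtoC 1)).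
  { apply Hball. split.
    - change (Rabs (cos th - 1) < e). rewrite <- cos_0 at 1.
      apply Rle_lt_trans with (1 := cos_lip th 0). rewrite Rminus_0_r. lra.
    - change (Rabs (sin th - 0) < e). rewrite <- sin_0.
      apply Rle_lt_trans with (1 := sin_lip th 0). rewrite Rminus_0_r. lra. }
  split.
  - intros ->. apply Hne. rewrite <- Heta. apply cis_0.
  - assert (Hrho : rho A a (0, eta)).
    { apply Classical_Prop.NNPP. intros Hn. apply HnD. split; [|exact Hne].
      exists (0, eta). split; [split; [reflexivity|exact Hn]|].
      unfold Cexp. simpl. rewrite exp_0, <- Heta. ring. }
    destruct Hrho as [F HF]. apply locally_singleton in HF.
    exists (F (0, eta)). apply HF.
Qed.

End Solution.

Theorem theorem3p12 (X : CompleteNormedModule C_AbsRing) (alpha : R)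
    (A : X -> X) (f : R -> X)
    (Halpha : 0 < alpha <= 1)
    (HA : is_linear A)
    (Hf : asymptotic_1_periodic f)
    (Hclosed : closed (fun z : C => exp_Sigma_i A alpha z /\ z <> RtoC 1)) :
  (exists u : R -> X,
     asymptotic_mild_solution alpha A f u /\ asymptotic_1_periodic u) <->
  (exists u : R -> X, asymptotic_mild_solution alpha A f u).
Proof.
  split; [intros [u [Hu _]]; now exists u|].
  intros [u [HuB [eps [[HepsB Heps0] [_ Hmild]]]]].
  destruct Hf as [HfB Hfper].
  apply tends_to_zero_vanish in Heps0, Hfper.
  set (z := ext0 u). set (fe := ext0 f). set (ee := ext0 eps).
  assert (Hz : BU z) by now apply BU_ext0. assert (Hfe : BU fe) by now apply BU_ext0.
  assert (Hee : BU ee) by now apply BU_ext0.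
  assert (Hfvan : vanish (vsub (shift 1 fe) fe)).
  { apply (vanish_eventually _ _ 0) with (2 := Hfper). intros t Ht.
    unfold vsub, shift, fe. now rewrite !ext0_nonneg by lra. }
  assert (Hevan : vanish ee).
  { apply (vanish_eventually _ _ 0) with (2 := Heps0). intros t Ht. unfold ee. now rewrite ext0_nonneg. }
  set (g := vadd fe ee). assert (Hg : BU g) by now apply BU_vadd.
  assert (HAz : BU (fun t => A (z t))) by now apply BU_linear.
  set (y := vadd (fun t => A (z t)) g). assert (Hy : BU y) by now apply BU_vadd.
  assert (Hyneg : forall t, t <= 0 -> y t = y 0).
  { intros t Ht. unfold y, g, vadd, z, fe, ee, ext0. now rewrite !(Rmax_right t 0), !(Rmax_left 0 0) by lra. }
  assert (HGB : BU (cosine_tail y)) by now apply BU_cos_mult.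
  assert (HGy : forall t, 0 <= t -> cosine_tail y t = y t).
  { intros t Ht. unfold cosine_tail. rewrite Rmin_right, cos_0 by exact Ht. exact (scal_one (y t)). }
  assert (Heq : forall t, 0 <= t -> z t = plus (plus (A (J alpha z t)) (J alpha g t)) (u 0)).
  { intros t Ht. unfold z at 1. rewrite ext0_nonneg, (Hmild t Ht) by exact Ht.
    rewrite (J_ext alpha Halpha t z u), (J_ext alpha Halpha t g (fun t => plus (f t) (eps t))); trivial.
    - apply Hg.
    - intros s Hs. unfold g, vadd, fe, ee. now rewrite !ext0_nonneg by lra.
    - apply Hz.
    - intros s Hs. unfold z. now rewrite ext0_nonneg by lra. }
  (* Also for t <= 0, where both sides are u 0; phi(T_1) uses values on the whole line. *)
  assert (Hzeq : forall t, z t = plus (u 0) (J alpha (cosine_tail y) t)).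
  { intros t. destruct (Rlt_dec 0 t) as [Ht|Ht].
    - rewrite (Heq t) by lra.
      rewrite (J_ext alpha Halpha t (cosine_tail y) y); [|apply HGB|intros; apply HGy; lra].
      unfold y. rewrite J_vadd, (J_linear alpha Halpha A) by assumption. vring.
    - rewrite J_nonpos by lra. unfold z, ext0. rewrite Rmax_right by lra. vring. }
  (* T_1 g - g vanishes because f is asymptotically periodic and eps is in C_0; since increments of
     [J] commute with T_1 at infinity, only the homogeneous equation is left. *)
  assert (Hhom : hom alpha A (vsub (shift 1 z) z)).
  { split; [auto with BU|]. intros h Hh.
    assert (V1 : vanish (jinc alpha h (vsub (shift 1 g) g))).
    { apply jinc_vanish; [exact Halpha|exact Hh|auto with BU|].
      apply (vanish_eventually (vadd (vsub (shift 1 fe) fe) (vsub (shift 1 ee) ee)) _ 0).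
      - intros t _. unfold g, vsub, vadd, shift. vring.
      - apply vanish_vadd; [exact Hfvan|]. apply vanish_vsub; [now apply vanish_shift|exact Hevan]. }
    assert (V2 := vanish_linear A _ HA (jinc_shift alpha Halpha h 1 z Hh Hz)).
    assert (V3 := jinc_shift alpha Halpha h 1 g Hh Hg).
    apply (vanish_eventually _ _ h) with (2 := vanish_vsub _ _ V1 (vanish_vadd _ _ V2 V3)).
    intros t Ht.
    assert (D : forall s, h <= s -> minus (z s) (z (s - h)) = plus (A (jinc alpha h z s)) (jinc alpha h g s)).
    { intros s Hs. rewrite (Heq s), (Heq (s - h)) by lra. unfold jinc.
      rewrite (is_linear_minus A HA). vring. }
    assert (D1 := D t Ht). assert (D2 := D (t + 1) ltac:(lra)).
    unfold defect.
    rewrite (jinc_vsub alpha Halpha h (shift 1 z) z) by auto with BU.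
    unfold vsub, vadd. rewrite (jinc_vsub alpha Halpha h (shift 1 g) g) by auto with BU.
    rewrite !(is_linear_minus A HA).
    transitivity (minus (minus (minus (z (t + 1)) (z (t + 1 - h))) (minus (z t) (z (t - h))))
      (minus (A (jinc alpha h (shift 1 z) t)) (A (jinc alpha h z t)))); [|unfold shift; replace (t - h + 1) with (t + 1 - h) by ring; vring].
    rewrite D1, D2. unfold shift. vring. }
  destruct (regular_near_one alpha A Hclosed) as [d [Hd Hreg]].
  assert (HPI := PI_RGT_0).
  set (h := Rmin d PI / 4). assert (Hm1 := Rmin_l d PI). assert (Hm2 := Rmin_r d PI).
  assert (Hm3 : 0 < Rmin d PI) by (apply Rmin_pos; lra).
  assert (Hh : 0 < h) by (unfold h; lra). assert (Hhd : 2 * h < d) by (unfold h; lra).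
  assert (Hhp : 2 * h <= PI) by (unfold h; lra).
  set (gam := coef (trap h)). assert (Hdec : decay gam (2 / h)) by now apply decay_trap.
  assert (HC : 0 <= 2 / h) by (apply Rlt_le, Rdiv_lt_0_compat; lra).
  destruct (is_phi_exists gam (2 / h) z HC Hdec (BU_bdd z Hz)) as [v Hv].
  destruct (is_phi_exists gam (2 / h) (cosine_tail y) HC Hdec (BU_bdd _ HGB)) as [Gt HGt].
  destruct (is_phi_exists gam (2 / h) fe HC Hdec (BU_bdd _ Hfe)) as [ft Hft].
  assert (HvB := BU_is_phi gam z v Hz Hv). assert (HGtB := BU_is_phi gam _ Gt HGB HGt).
  assert (HftB := BU_is_phi gam fe ft Hfe Hft).
  destruct (phi_of_solution alpha gam (2 / h) y (u 0) z v Gt Halpha HC Hdec Hy Hyneg Hz Hzeq Hv HGt) as [x0 Hx0].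
  set (v' := fun t => plus x0 (J alpha Gt t)) in *.
  assert (Hv'B : BU v') by exact (BU_J_of_bounded alpha Halpha Gt v x0 HGtB (BU_bdd v HvB) Hx0).
  assert (Hvper : vanish (vsub (shift 1 v) v)).
  { apply vanish_asn; [auto with bdd BU|]. right.
    now apply (phi_periodic alpha Halpha A HA d h z v). }
  assert (Hftvan : vanish (vsub fe ft)).
  { apply vanish_asn; [auto with bdd BU|]. right.
    apply (phi_identity h fe ft Hh Hhp); [auto with bdd|now apply asn_vanish|exact Hft]. }
  (* Forced by the equation: v' = x0 + J Gt is a mild solution as soon as Gt = A v' + f + eps' on
     the half line. *)
  set (eps' := vsub (vsub Gt (fun t => A (v' t))) fe).
  assert (HAv' : BU (fun t => A (v' t))) by now apply BU_linear.
  assert (Heps'B : BU eps') by (unfold eps'; auto with BU).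
  assert (Heps'van : vanish eps').
  (* For t >= 0, [cosine_tail y] - A z - f is the given eps, and phi(T_1) keeps functions vanishing.
     Afterwards v and phi(T_1) f are replaced by v' and f, at the cost of vanishing terms. *)
  { assert (Hbal : vanish (vsub (vsub Gt (fun t => A (v t))) ft)).
    { apply (vanish_is_phi gam (2 / h) (vsub (vsub (cosine_tail y) (fun t => A (z t))) fe)); trivial.
      - auto with bdd BU.
      - apply is_phi_vsub; [|exact Hft]. apply is_phi_vsub; [exact HGt|]. now apply is_phi_linear.
      - apply (vanish_eventually ee _ 0); [|exact Hevan]. intros t Ht.
        unfold vsub. rewrite HGy by exact Ht. unfold y, g, vadd. vring. }
    assert (HAd := vanish_linear A _ HA Hx0).
    apply (vanish_eventually _ _ 0) with (2 := vanish_vadd _ _ Hbal (vanish_vsub _ _ HAd Hftvan)).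
    intros t _. unfold eps', vsub, vadd. fold (v' t). rewrite (is_linear_minus A HA). vring. }
  exists v'. split.
  - split; [now apply BUC_BU|]. exists eps'. split.
    + split; [now apply BUC_BU|now apply tends_to_zero_vanish].
    + split; [apply ucont_continuous_on, Hv'B|]. intros t Ht.
      rewrite <- (J_ext alpha Halpha t (vadd fe eps') (fun t => plus (f t) (eps' t))).
      * rewrite <- (J_linear alpha Halpha A v' t HA Hv'B).
        rewrite <- (J_vadd alpha Halpha) by auto with BU.
        (* The initial value of v' is x0, because [J] is zero at time 0. *)
        unfold v' at 1 3. rewrite (J_nonpos alpha 0) by lra.
        rewrite <- (J_ext alpha Halpha t Gt (vadd (fun s => A (v' s)) (vadd fe eps'))).
        -- vring.
        -- apply HGtB.
        -- intros s _. unfold eps', vadd, vsub. vring.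
      * apply BU_vadd; assumption.
      * intros s Hs. unfold vadd, fe. now rewrite ext0_nonneg by lra.
  - split; [now apply BUC_BU|]. apply tends_to_zero_vanish.
    apply (vanish_eventually _ _ 0) with (2 := vanish_vsub _ _ Hvper (vanish_vsub _ _ (vanish_shift 1 _ Hx0) Hx0)).
    intros t _. unfold vsub, shift. fold (v' t). fold (v' (t + 1)). vring.
Qed.
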